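(* There exist a strictly convex flux $f:\mathbb{R}\to\mathbb{R}$ of class $C^2$, a continuous function $u:\mathbb{R}^2\to\mathbb{R}$, a bounded Borel function $\mathfrak{g}:\mathbb{R}^2\to\mathbb{R}$ with $\partial_t u+\partial_x(f(u))=\mathfrak{g}$ in $\mathcal{D}'(\mathbb{R}^2)$, and a compact set $K\subset\mathbb{R}^2$ with $\mathcal{L}^2(K)>0$ such that: $u$ is Lipschitz continuous along all characteristic curves; for every $(\bar t,\bar x)\in K$ and every characteristic $\gamma$ through $(\bar t,\bar x)$ (i.e. $\gamma(\bar t)=\bar x$ with $\gamma$ defined in a neighbourhood of $\bar t$), the function $t\mapsto u(t,\gamma(t))$ is not differentiable at $\bar t$; and $u$ is not Hölder continuous for any exponent $\alpha>0$.
   Context: $\mathcal{L}^2$ is Lebesgue measure on $\mathbb{R}^2$; points of $\mathbb{R}^2$ are written $(t,x)$. A characteristic of $u$ is a $C^1$ function $\gamma:I\to\mathbb{R}$ ($I$ an interval) with $\dot\gamma(t)=f'(u(t,\gamma(t)))$; the corresponding characteristic curve is $t\mapsto(t,\gamma(t))$. ''$u$ is Lipschitz continuous along all characteristic curves'' means that there is a constant $G$ such that $t\mapsto u(t,\gamma(t))$ is $G$-Lipschitz for every characteristic $\gamma$. *)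

(* Defs.v *)
From HB Require Import structures.
From mathcomp Require Import all_boot all_order all_algebra.
From mathcomp Require Import all_classical all_reals all_analysis.

Set Implicit Arguments.
Unset Strict Implicit.
Unset Printing Implicit Defensive.

Import Order.TTheory GRing.Theory Num.Theory.
Import numFieldNormedType.Exports.

Local Open Scope ring_scope.
Local Open Scope classical_set_scope.

(* Points of the plane are pairs p = (t, x).  The measurable structure on
   R * R is the product of the Borel sigma-algebras of the two factors, that
   is, the Borel sigma-algebra of the plane. *)
Definition leb2 (R : realType) :=
  (@lebesgue_measure R \x @lebesgue_measure R)%E.

Definition strictly_convex (R : realType) (f : R -> R) : Prop :=
  forall (a b s : R), a != b -> 0 < s < 1 ->
    f (s * a + (1 - s) * b) < s * f a + (1 - s) * f b.

Definition classC2 (R : realType) (f : R -> R) : Prop :=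
  [/\ forall y, derivable f y 1,
      forall y, derivable f^`() y 1 &
      continuous f^`(2)].

Definition dt (R : realType) (phi : R * R -> R) : R * R -> R :=
  fun p => 'D_((1, 0) : R * R) phi p.

Definition dx (R : realType) (phi : R * R -> R) : R * R -> R :=
  fun p => 'D_((0, 1) : R * R) phi p.

Fixpoint classCk (R : realType) (k : nat) (phi : R * R -> R) : Prop :=
  if k is k'.+1 then
    [/\ continuous phi,
        forall p, derivable phi p ((1, 0) : R * R),
        forall p, derivable phi p ((0, 1) : R * R),
        classCk k' (dt phi) &
        classCk k' (dx phi)]
  else continuous phi.

Definition test_function (R : realType) (phi : R * R -> R) : Prop :=
  (forall k, classCk k phi) /\ compact (closure [set p | phi p != 0]).

(* d_t u + d_x (f (u)) = g in D'(R^2).  When u and f are continuous and g is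
   bounded and Borel, the three integrands are integrable, so that the
   real-valued integral is not truncated. *)
Definition balance_law (R : realType) (f : R -> R) (u g : R * R -> R) : Prop :=
  forall phi : R * R -> R, test_function phi ->
    - (\int[@leb2 R]_p (u p * dt phi p))
    - (\int[@leb2 R]_p (f (u p) * dx phi p))
    = \int[@leb2 R]_p (g p * phi p).

(* gamma is a C^1 function on the interval I with
   gamma'(t) = f'(u(t, gamma(t))).  Only the values of gamma on I matter; at an
   endpoint belonging to I the derivative is one-sided. *)
Definition characteristic (R : realType) (f : R -> R) (u : R * R -> R)
    (I : set R) (gamma : R -> R) : Prop :=
  [/\ is_interval I,
      {within I, continuous (fun t => f^`() (u (t, gamma t)))} &
      forall t, I t ->
        (gamma s - gamma t) / (s - t)
          @[s --> within I t^'] --> f^`() (u (t, gamma t))].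

Definition lipschitz_along_characteristics (R : realType) (f : R -> R)
    (u : R * R -> R) : Prop :=
  exists G : R, forall (I : set R) (gamma : R -> R),
    characteristic f u I gamma ->
    G.-lipschitz_I (fun t => u (t, gamma t)).

Definition holder_on (R : realType) (alpha : R) (A : set (R * R))
    (u : R * R -> R) : Prop :=
  exists C : R, forall p q : R * R, A p -> A q ->
    `|u p - u q| <= C * `|p - q| `^ alpha.

(* On R^2, Hoelder continuity is read locally: one constant for each compact
   set.  Its failure is then not an effect of growth at infinity, and it implies
   the failure of the global bound holder_on alpha setT u. *)
Definition holder_continuous (R : realType) (alpha : R) (u : R * R -> R) : Prop :=
  forall A : set (R * R), compact A -> holder_on alpha A u.

(* Main.v *)
(** The solution is [u(t,x) = t + w(t, x - f(t))], where [w] is a sum of [C^1]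
    waves with pairwise disjoint supports.  In the sheared coordinate
    [z = gamma - f(t)] a characteristic solves [z' = f'(t + w) - f'(t)], so it
    moves only where [f'] varies between [t] and [t + w].

    Level [n] has a time grid of period [T], a space grid of width [b] and a small
    relative gap size [e].  The second derivative of [f] equals [lam] inside the
    time gaps, and only the much smaller steepness of the next levels is seen
    between them, so that the waves hardly move characteristics there.  During a
    gap a pushing wave of height [- e^2 T] displaces characteristics to the left
    by up to [lam * e^2 T * e T = b], a whole space cell, but it is cut off near
    the left end of the cell: all characteristics of the cell accumulate in a thin
    strip.  They stay there until the middle of the next time cell, where a rising
    wave of height [T / 8] lives on that strip.

    The fat Cantor set [K] consists of the points that stay away from all gaps and
    strips; there [w = 0].  Along a characteristic through a point of [K], the
    difference quotient of [u] is [1] at the beginning of the next gap and at least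
    [1 + 1/16] in the middle of the next time cell, at every scale.

    The pushing wave varies by [e^2 T] over times of order [e T] and the rising one
    by [T / 8] over times of order [T], so that [d w / d t] is bounded.  A wave of
    height [a] has [(f'(t + w) - f'(t)) d w / d z] of order [lam a^2 / (e b)] for
    the steepness [lam] that it sees, and this is bounded too.  The source is the
    limit of those of the partial sums.  Finally the rising wave
    climbs by [T / 8] over a distance [b <= T^n], which rules out all Hoelder
    exponents. *)

Require Import Defs.
From HB Require Import structures.
From mathcomp Require Import all_boot all_order all_algebra.
From mathcomp Require Import all_classical all_reals all_analysis.
From mathcomp Require Import measurable_realfun.
From mathcomp Require Import ring lra.

Set Implicit Arguments.
Unset Strict Implicit.
Unset Printing Implicit Defensive.

Import Order.TTheory GRing.Theory Num.Theory.
Import numFieldNormedType.Exports.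

Local Open Scope ring_scope.
Local Open Scope classical_set_scope.

(** * Derivatives and functions of class C1 *)

Section RealDerivatives.
Variable R : realType.
Implicit Types (f g : R -> R) (x a b : R).

Lemma is_derive_addf f g x a b : is_derive x 1 f a -> is_derive x 1 g b ->
  is_derive x 1 (fun y => f y + g y) (a + b).
Proof. exact: is_deriveD. Qed.

Lemma is_derive_subf f g x a b : is_derive x 1 f a -> is_derive x 1 g b ->
  is_derive x 1 (fun y => f y - g y) (a - b).
Proof. exact: is_deriveB. Qed.

Lemma is_derive_mulf f g x a b : is_derive x 1 f a -> is_derive x 1 g b ->
  is_derive x 1 (fun y => f y * g y) (a * g x + f x * b).
Proof.
move=> fa gb; apply: (is_derive_eq (is_deriveM fa gb)).
by rewrite /GRing.scale /= addrC [g x * a]mulrC.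
Qed.

Lemma is_derive_compf f g x a b : is_derive (f x) 1 g b -> is_derive x 1 f a ->
  is_derive x 1 (fun y => g (f y)) (a * b).
Proof.
move=> gb fa; apply: (is_derive_eq (is_derive1_comp gb fa)).
by rewrite mulrC.
Qed.

Lemma is_derive_affine (k c x : R) : is_derive x 1 (fun y => k * y + c) k.
Proof.
have H := is_derive_addf
  (is_derive_mulf (is_derive_cst k x 1) (is_derive_id x 1))
  (is_derive_cst c x 1).
by apply: (is_derive_eq H); rewrite /cst; lra.
Qed.

Lemma is_derive_continuous f x a : is_derive x 1 f a -> {for x, continuous f}.
Proof. by move=> [df _]; apply: differentiable_continuous; apply/derivable1_diffP. Qed.

(** Dividing the error by [h] leaves at most [|c| * |h|]. This treats the squared positive part at
    all points at once, including 0 where its second derivative jumps. *)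
Lemma is_derive_quadratic f x d c :
  (forall h, `|f (x + h) - f x - h * d| <= c * h ^+ 2) -> is_derive x 1 f d.
Proof.
move=> H.
have Hc : h^-1 *: ((f \o shift x) (h *: 1) - f x) @[h --> (0:R)^'] --> d.
  apply/cvgrPdist_le => e e0.
  have c1 : 0 < `|c| + 1 by apply: ltr_wpDl.
  near=> h.
  have h0 : h != 0 by near: h; exact: nbhs_dnbhs_neq.
  have hh : `|h| < e / (`|c| + 1).
    near: h; apply: dnbhs0_lt; by rewrite divr_gt0.
  rewrite /= /GRing.scale /= mulr1 [h + x]addrC.
  rewrite -normrN opprB.
  have -> : h^-1 * (f (x + h) - f x) - d = h^-1 * (f (x + h) - f x - h * d).
    by rewrite [RHS]mulrBr mulKf.
  rewrite normrM normfV ler_pdivrMl ?normr_gt0//.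
  apply: le_trans (H h) _.
  rewrite -real_normK ?num_real// expr2 mulrA [_ * e]mulrC.
  apply: ler_wpM2r => //.
  apply: (@le_trans _ _ ((`|c| + 1) * `|h|)).
    apply: ler_wpM2r => //.
    by apply: le_trans (ler_norm _) _; rewrite lerDl.
  by rewrite -ler_pdivlMl// mulrC ltW.
apply: DeriveDef; first by apply/cvg_ex; exists d.
exact: cvg_lim.
Unshelve. all: by end_near. Qed.

(** The derivative is carried as an explicit function, so that it can be estimated by its
    formula. *)
Definition class_C1 f f' := (forall x, is_derive x 1 f (f' x)) /\ continuous f'.

Lemma class_C1_continuous f f' : class_C1 f f' -> continuous f.
Proof. by move=> [H _] x; exact: is_derive_continuous (H x). Qed.

Lemma class_C1_cst c : class_C1 (fun=> c) (fun=> 0).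
Proof. by split=> [x|x]; [exact: is_derive_cst|exact: cst_continuous]. Qed.

Lemma class_C1D f f' g g' : class_C1 f f' -> class_C1 g g' ->
  class_C1 (fun x => f x + g x) (fun x => f' x + g' x).
Proof.
move=> [F cF] [G cG]; split=> x; first exact: is_derive_addf.
exact: (cvgD (cF x) (cG x)).
Qed.

Lemma class_C1M f f' g g' : class_C1 f f' -> class_C1 g g' ->
  class_C1 (fun x => f x * g x) (fun x => f' x * g x + f x * g' x).
Proof.
move=> F G; have cf := class_C1_continuous F.
have cg := class_C1_continuous G.
move: F G => [F cF] [G cG]; split=> x; first exact: is_derive_mulf.
exact: (cvgD (cvgM (cF x) (cg x)) (cvgM (cf x) (cG x))).
Qed.

Lemma class_C1_scale c f f' : class_C1 f f' ->
  class_C1 (fun x => c * f x) (fun x => c * f' x).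
Proof.
move=> F; have [H1 H2] := class_C1M (class_C1_cst c) F.
have E : (fun x => 0 * f x + c * f' x) = (fun x => c * f' x).
  by apply/funext => x; rewrite mul0r add0r.
by rewrite -E.
Qed.

Lemma class_C1_affine f f' k c : class_C1 f f' ->
  class_C1 (fun x => f (k * x + c)) (fun x => k * f' (k * x + c)).
Proof.
move=> [F cF]; split=> x.
  exact: (is_derive_compf (F _)
    (is_derive_affine k c x)).
apply: cvgM; first exact: cvg_cst.
apply: (@continuous_comp _ _ _ (fun y : R => k * y + c) f').
  exact: (is_derive_continuous (is_derive_affine k c x)).
exact: cF.
Qed.

(** The first alternative covers the degenerate interval, which has no interior point; the time
    intervals used later may shrink to a point. *)
Lemma MVT_cc f f' a b : a <= b -> {within `[a, b], continuous f} ->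
  (forall x, a < x < b -> is_derive x 1 f (f' x)) ->
  a = b \/ exists2 c, a < c < b & f b - f a = f' c * (b - a).
Proof.
move=> ab cf df; case: (ltgtP a b) ab => // [ab _|->]; last by left.
right; have df' x : x \in `]a, b[%R -> is_derive x 1 f (f' x).
  by rewrite in_itv/=; exact: df.
have [c] := MVT ab df' cf.
by rewrite in_itv/= => cab E; exists c.
Qed.

Lemma MVT_bounds f f' a b m M : a <= b -> {within `[a, b], continuous f} ->
  (forall x, a < x < b -> is_derive x 1 f (f' x)) ->
  (forall x, a < x < b -> m <= f' x <= M) ->
  m * (b - a) <= f b - f a <= M * (b - a).
Proof.
move=> ab cf df mM; have [<-|[c cab ->]] := MVT_cc ab cf df.
  by rewrite !subrr !mulr0 lexx.
have /andP[h1 h2] := mM _ cab.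
by rewrite !ler_wpM2r// subr_ge0.
Qed.

End RealDerivatives.

(** * Smooth steps and periodic bumps *)

Section Bumps.
Variable R : realType.
Implicit Types (h : R -> R) (x y s l r T : R).

Definition sqr_pos x : R := Num.max x 0 ^+ 2.

Lemma class_C1_sqr_pos : class_C1 sqr_pos (fun x => 2 * Num.max x 0).
Proof.
split=> [x|x].
  apply: (@is_derive_quadratic _ _ _ _ 1) => h; rewrite /sqr_pos mul1r.
  rewrite ler_norml; apply/andP.
  have [x0|x0] := leP x 0; have [xh0|xh0] := leP (x + h) 0; split; nra.
apply: cvgM; first exact: cvg_cst.
by apply: continuous_max; [exact: cvg_id|exact: cvg_cst].
Qed.

(** The function that vanishes for [s <= 0] and has second derivative 4 on the left half of the unit
    interval, -4 on the right half and 0 outside. Its slope peaks at 2. The form [1 * s + c] fits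
    [class_C1_affine]. *)
Definition smoothstep s : R :=
  2 * sqr_pos (1 * s + 0) + (- 4 * sqr_pos (1 * s + - 2^-1)
  + 2 * sqr_pos (1 * s + - 1)).

Definition dsmoothstep s : R :=
  2 * (1 * (2 * Num.max (1 * s + 0) 0))
  + (- 4 * (1 * (2 * Num.max (1 * s + - 2^-1) 0))
  + 2 * (1 * (2 * Num.max (1 * s + - 1) 0))).

Lemma class_C1_smoothstep : class_C1 smoothstep dsmoothstep.
Proof.
have H k := class_C1_affine 1 k class_C1_sqr_pos.
apply: class_C1D; first exact: (class_C1_scale 2 (H 0)).
by apply: class_C1D; [exact: (class_C1_scale _ (H _))|exact: (class_C1_scale _ (H _))].
Qed.

Ltac smoothstep_cases s :=
  rewrite /smoothstep /dsmoothstep /sqr_pos ?mul1r ?addr0;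
  have [?|?] := leP s 0; have [?|?] := leP (s + - 2^-1) 0;
  have [?|?] := leP (s + - 1) 0.

Lemma smoothstep_eq0 s : s <= 0 -> smoothstep s = 0.
Proof. by move=> s0; smoothstep_cases s; nra. Qed.

Lemma smoothstep_eq1 s : 1 <= s -> smoothstep s = 1.
Proof. by move=> s0; smoothstep_cases s; nra. Qed.

Lemma smoothstep_lt1 s : s < 1 -> smoothstep s < 1.
Proof. by move=> s0; smoothstep_cases s; nra. Qed.

Lemma smoothstep_bounds s : 0 <= smoothstep s <= 1.
Proof. by apply/andP; split; smoothstep_cases s; nra. Qed.

Lemma dsmoothstep_bounds s : 0 <= dsmoothstep s <= 2.
Proof. by apply/andP; split; smoothstep_cases s; lra. Qed.

(** A smoothed trapezoid: it climbs on [[l, l']], equals 1 on [[l', r']] and descends on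
    [[r', r]]. *)
Definition bump l l' r' r y :=
  smoothstep ((l' - l)^-1 * y + - (l / (l' - l))) *
  smoothstep (- (r - r')^-1 * y + r / (r - r')).

Definition dbump l l' r' r y :=
  (l' - l)^-1 * dsmoothstep ((l' - l)^-1 * y + - (l / (l' - l))) *
  smoothstep (- (r - r')^-1 * y + r / (r - r')) +
  smoothstep ((l' - l)^-1 * y + - (l / (l' - l))) *
  (- (r - r')^-1 * dsmoothstep (- (r - r')^-1 * y + r / (r - r'))).

Section BumpFacts.
Variables l l' r' r : R.
Hypotheses (ll' : l < l') (lr' : l' <= r') (rr' : r' < r).
Let b := bump l l' r' r.
Let b' := dbump l l' r' r.

Lemma class_C1_bump : class_C1 b b'.
Proof.
by apply: class_C1M; exact: class_C1_affine class_C1_smoothstep.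
Qed.

Let argl y : (l' - l)^-1 * y + - (l / (l' - l)) = (y - l) / (l' - l).
Proof. by rewrite mulrBl mulrC. Qed.

Let argr y : - (r - r')^-1 * y + r / (r - r') = (r - y) / (r - r').
Proof. by rewrite mulrBl addrC mulNr [y / _]mulrC. Qed.

Let dl : 0 < l' - l. Proof. by rewrite subr_gt0. Qed.
Let dr : 0 < r - r'. Proof. by rewrite subr_gt0. Qed.

Lemma bump_bounds y : 0 <= b y <= 1.
Proof.
rewrite /b /bump.
have /andP[p0 p1] := smoothstep_bounds ((l' - l)^-1 * y + - (l / (l' - l))).
have /andP[q0 q1] := smoothstep_bounds (- (r - r')^-1 * y + r / (r - r')).
by rewrite mulr_ge0// mulr_ile1.
Qed.

Lemma bump_eq0 y : y <= l \/ r <= y -> b y = 0.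
Proof.
rewrite /b /bump argl argr => -[h|h].
  by rewrite smoothstep_eq0 ?mul0r// pmulr_lle0 ?invr_gt0// subr_le0.
rewrite mulrC smoothstep_eq0 ?mul0r//.
by rewrite pmulr_lle0 ?invr_gt0// subr_le0.
Qed.

Lemma bump_eq1 y : l' <= y <= r' -> b y = 1.
Proof.
move=> /andP[h1 h2]; rewrite /b /bump argl argr !smoothstep_eq1 ?mul1r//.
  by rewrite ler_pdivlMr// mul1r lerB.
by rewrite ler_pdivlMr// mul1r lerB.
Qed.

Lemma bump_neq0 y : b y != 0 -> l < y < r.
Proof.
apply: contra_neqT; rewrite negb_and -!leNgt => /orP h.
exact: bump_eq0.
Qed.

(** Both factors lie in [[0, 1]], and off the plateau one of them is strictly below 1. With this
    converse of [bump_eq1] the core can be defined by level sets of continuous functions, hence as a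
    closed set. *)
Lemma bump_plateau y : b y = 1 -> l' <= y <= r'.
Proof.
rewrite /b /bump argl argr.
have /andP[p0 p1] := smoothstep_bounds ((y - l) / (l' - l)).
have /andP[q0 q1] := smoothstep_bounds ((r - y) / (r - r')).
move=> E; apply/andP; split; rewrite leNgt; apply/negP => h.
  have : smoothstep ((y - l) / (l' - l)) < 1.
    by apply: smoothstep_lt1; rewrite ltr_pdivrMr// mul1r ltrD2r.
  by rewrite ltNge => /negP; apply; rewrite -E; exact: ler_piMr.
have : smoothstep ((r - y) / (r - r')) < 1.
  by apply: smoothstep_lt1; rewrite ltr_pdivrMr// mul1r ltrD2l ltrN2.
by rewrite ltNge => /negP; apply; rewrite -E; exact: ler_piMl.
Qed.

Lemma dbump_le d y : 0 < d -> d <= l' - l -> d <= r - r' -> `|b' y| <= 4 / d.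
Proof.
move=> d0 d1 d2; rewrite /b' /dbump.
set A := (l' - l)^-1 * y + _; set B := - (r - r')^-1 * y + _.
have /andP[p0 p1] := smoothstep_bounds A.
have /andP[q0 q1] := smoothstep_bounds B.
have /andP[s0 s1] := dsmoothstep_bounds A.
have /andP[t0 t1] := dsmoothstep_bounds B.
have il : 0 <= (l' - l)^-1 <= d^-1.
  by rewrite invr_ge0 ltW//= lef_pV2 ?posrE.
have ir : 0 <= (r - r')^-1 <= d^-1.
  by rewrite invr_ge0 ltW//= lef_pV2 ?posrE.
have aux u v w : 0 <= u <= d^-1 -> 0 <= v <= 2 -> 0 <= w <= 1 ->
    `|u * v * w| <= d^-1 * 2.
  move=> /andP[u0 u1] /andP[v0 v1] /andP[w0 w1].
  rewrite ger0_norm ?mulr_ge0//.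
  apply: (@le_trans _ _ (u * v)).
    by apply: ler_piMr => //; rewrite mulr_ge0.
  by rewrite ler_pM.
apply: le_trans (ler_normD _ _) _.
have -> : 4 / d = d^-1 * 2 + d^-1 * 2 by lra.
apply: lerD; first by apply: aux => //; apply/andP.
rewrite mulNr mulrN normrN mulrC.
by apply: aux => //; apply/andP.
Qed.

End BumpFacts.

Definition periodize h T x := h (x / T - (Num.floor (x / T))%:~R).

Lemma cell_decomposition T x : 0 < T ->
  exists (j : int) (y : R), 0 <= y < 1 /\ x = (j%:~R + y) * T.
Proof.
move=> T0; exists (Num.floor (x / T)), (x / T - (Num.floor (x / T))%:~R).
split; last by rewrite addrC subrK divfK ?gt_eqF.
have /andP[h1 h2] := floor_itv (x / T).
rewrite subr_ge0 h1/= ltrBlDr addrC; by rewrite intrD in h2.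
Qed.

Lemma periodize_cell h T (j : int) y : 0 < T -> h 0 = h 1 -> 0 <= y <= 1 ->
  periodize h T ((j%:~R + y) * T) = h y.
Proof.
move=> T0 h01 /andP[y0]; rewrite le_eqVlt => /predU1P[->|y1];
  rewrite /periodize mulfK ?gt_eqF//.
  by rewrite -(intrD R j 1) floorK ?intr_int// subrr h01.
rewrite (@floor_def _ _ j); first by congr h; lra.
by rewrite lerDl y0 intrD mulr1z ltrD2l.
Qed.

(** Near a given point a periodized profile is a single affine copy of the profile. The copy is
    chosen before [h], so that the same one serves for a function and its derivative. *)
Lemma periodize_near T x l r : 0 < T -> 0 < l -> l < r -> r < 1 ->
  exists m : int, forall h, (forall y, y <= l \/ r <= y -> h y = 0) ->
    \forall z \near x, periodize h T z = h (T^-1 * z + - m%:~R).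
Proof.
move=> T0 l0 lr r1.
have [j [y [/andP[y0 y1] xE]]] := cell_decomposition x T0.
exists j => h hh.
(* On a cell boundary two copies meet. To its left the previous copy is past [r] and the chosen one
   is before [l], so both vanish there. *)
have [y00|yn0] := eqVneq y 0.
  near=> z.
  have zl : z < (j%:~R + l) * T.
    by near: z; apply: lt_nbhsl; rewrite xE y00 ltr_pM2r// ltrD2l.
  have zr : (j%:~R + r - 1) * T < z.
    near: z; apply: lt_nbhsr; rewrite xE y00 ltr_pM2r//; lra.
  have zl' : z / T < j%:~R + l by rewrite ltr_pdivrMr.
  have zr' : j%:~R + r - 1 < z / T by rewrite ltr_pdivlMr.
  rewrite [T^-1 * z]mulrC.
  have [jz|jz] := leP (j%:~R) (z / T).
    rewrite /periodize (@floor_def _ _ j)// jz intrD mulr1z/=; lra.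
  rewrite [RHS]hh; last by left; lra.
  rewrite /periodize (@floor_def _ _ (j - 1)).
    by rewrite hh//; right; rewrite intrB mulr1z; lra.
  by rewrite subrK jz intrB mulr1z andbT; lra.
near=> z.
have zl : z < (j%:~R + 1) * T.
  by near: z; apply: lt_nbhsl; rewrite xE ltr_pM2r// ltrD2l.
have zr : j%:~R * T < z.
  near: z; apply: lt_nbhsr; rewrite xE ltr_pM2r//.
  by rewrite ltrDl lt_neqAle eq_sym yn0.
rewrite [T^-1 * z]mulrC /periodize (@floor_def _ _ j)//.
by rewrite intrD mulr1z ler_pdivlMr// ltr_pdivrMr// zl ltW.
Unshelve. all: by end_near. Qed.

Lemma class_C1_periodize h h' T l r : 0 < T -> 0 < l -> l < r -> r < 1 ->
  (forall y, y <= l \/ r <= y -> h y = 0) ->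
  (forall y, y <= l \/ r <= y -> h' y = 0) -> class_C1 h h' ->
  class_C1 (periodize h T) (fun x => T^-1 * periodize h' T x).
Proof.
move=> T0 l0 lr r1 H H' hC; split=> x;
  have [m Hm] := periodize_near x T0 l0 lr r1.
  have [H1 _] := class_C1_affine T^-1 (- m%:~R) hC.
  have := H1 x.
  have -> : periodize h' T x = h' (T^-1 * x + - m%:~R).
    exact: nbhs_singleton (Hm _ H').
  apply: near_eq_is_derive.
  by near=> z; apply: esym; near: z; exact: Hm.
have [_ H2] := class_C1_affine T^-1 (- m%:~R) hC.
have E : T^-1 * periodize h' T x = T^-1 * h' (T^-1 * x + - m%:~R).
  by congr (_ * _); exact: nbhs_singleton (Hm _ H').
rewrite /continuous_at E.
apply: cvg_trans (H2 x).
apply: near_eq_cvg; near=> z; congr (_ * _).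
by apply: esym; near: z; exact: Hm.
Unshelve. all: by end_near. Qed.

End Bumps.

(** * Geometrically dominated series and antiderivatives *)

Section GeometricallyDominatedSeries.
Variables (R : realType) (X : Type) (h : nat -> X -> R).
Hypothesis hM : forall k p, `|h k p| <= 2^-1 ^+ k.

Definition partial_sum N p := \sum_(0 <= k < N) h k p.
Definition total_sum p : R := limn (fun N => partial_sum N p).

Lemma geometric_tail N m :
  \sum_(N <= k < N + m) (2^-1 : R) ^+ k <= 2 * 2^-1 ^+ N.
Proof.
suff -> : \sum_(N <= k < N + m) (2^-1 : R) ^+ k
    = 2 * 2^-1 ^+ N - 2 * 2^-1 ^+ (N + m).
  by rewrite lerBlDr lerDl mulr_ge0// exprn_ge0.
elim: m => [|m IH]; first by rewrite addn0 big_geq// subrr.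
rewrite addnS big_nat_recr ?leq_addr//= IH exprS; lra.
Qed.

Lemma partial_sumB N M p : (N <= M)%N ->
  `|partial_sum M p - partial_sum N p| <= 2 * 2^-1 ^+ N.
Proof.
move=> NM; rewrite /partial_sum (big_cat_nat (leq0n N) NM)/= addrAC subrr add0r.
apply: le_trans (ler_norm_sum _ _ _) _.
rewrite -(subnKC NM); apply: le_trans (geometric_tail N (M - N)).
exact: ler_sum.
Qed.

Lemma partial_sum_cvg p : partial_sum N p @[N --> \oo] --> total_sum p.
Proof.
apply: (@normed_cvg _ R^o (fun k => h k p)).
apply: (@series_le_cvg _ _ (fun k => 2^-1 ^+ k)) => //.
- by move=> k /=.
- by move=> k /=.
have -> : series (fun k => (2^-1 : R) ^+ k) = series (geometric 1 2^-1).
  by congr series; apply/funext => k; rewrite /geometric/= mul1r.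
apply: is_cvg_geometric_series.
by rewrite ger0_norm ?invr_ge0// invf_lt1// ltr1n.
Qed.

Lemma total_sum_tail N p : `|total_sum p - partial_sum N p| <= 2 * 2^-1 ^+ N.
Proof.
have H : `|partial_sum M p - partial_sum N p| @[M --> \oo]
    --> `|total_sum p - partial_sum N p|.
  by apply: cvg_norm; apply: cvgB; [exact: partial_sum_cvg|exact: cvg_cst].
apply: (cvgr_to_le H); near=> M; apply: partial_sumB.
by near: M; exact: nbhs_infty_ge.
Unshelve. all: by end_near. Qed.

End GeometricallyDominatedSeries.

Lemma half_power_small (R : realType) (e : R) : 0 < e ->
  exists N, 2^-1 ^+ N < e.
Proof.
move=> e0.
have H : (2^-1 : R) ^+ n @[n --> \oo] --> 0.
  apply: cvg_expr; by rewrite ger0_norm ?invr_ge0// invf_lt1// ltr1n.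
have /cvgrPdist_lt/(_ _ e0)[N _ /(_ N (leqnn N))] := H.
rewrite sub0r normrN ger0_norm ?exprn_ge0// => HN; by exists N.
Qed.

Lemma continuous_total_sum (R : realType) (X : topologicalType)
  (h : nat -> X -> R) : (forall k p, `|h k p| <= 2^-1 ^+ k) ->
  (forall k, continuous (h k)) -> continuous (total_sum h).
Proof.
move=> hM hc p; apply/cvgrPdist_le => e e0.
(* Each of the two tails is at most [2 * (e / 8)]; with [e / 4] for the partial sum the total is
   [3 * e / 4]. *)
have [N HN] := @half_power_small R (e / 8) (divr_gt0 e0 (ltr0Sn _ 7)).
have cN : {for p, continuous (partial_sum h N)}.
  have -> : partial_sum h N = \sum_(0 <= k < N) h k.
    by apply/funext => q; rewrite /partial_sum fct_sumE.
  elim: N {HN} => [|N IH]; first by rewrite big_geq//; exact: cvg_cst.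
  rewrite big_nat_recr//=; exact: (cvgD IH (hc N p)).
have e4 : 0 < e / 4 by apply: divr_gt0.
move/cvgrPdist_le/(_ _ e4) : cN; apply: filterS => q Hq.
have H1 := total_sum_tail hM N p; have H2 := total_sum_tail hM N q.
have -> : total_sum h p - total_sum h q = (total_sum h p - partial_sum h N p)
  + (partial_sum h N p - partial_sum h N q) - (total_sum h q - partial_sum h N q).
  by lra.
move: H1 H2 Hq; rewrite !ler_norml => /andP[? ?] /andP[? ?] /andP[? ?].
by apply/andP; split; lra.
Qed.

(** * Antiderivatives of continuous functions on the whole line *)

Section Antiderivative.
Variables (R : realType) (h : R -> R).
Hypothesis hc : continuous h.
Notation mu := (@lebesgue_measure R).

Let int_h a b : mu.-integrable `[a, b] (EFin \o h).
Proof.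
apply: continuous_compact_integrable; first exact: segment_compact.
exact: continuous_subspaceT.
Qed.

Definition antiderivative (y : R) : R :=
  if 0 <= y then \int[mu]_(t in `]0, y]) h t else - \int[mu]_(t in `]y, 0]) h t.

(** With the base point moved to [- A], both signs of [y] are covered by one formula, to which the
    fundamental theorem of calculus on [[- A, A]] applies. *)
Let antiderivativeE A y : - A <= y -> 0 <= A ->
  antiderivative y = \int[mu]_(t in `[- A, y]) h t - \int[mu]_(t in `[- A, 0]) h t.
Proof.
move=> Ay A0; rewrite /antiderivative; have [y0|y0] := leP 0 y.
  rewrite (@Rintegral_itvB _ _ (BLeft (- A)) (BRight y) 0)//.
  by rewrite bnd_simp oppr_le0.
rewrite -[RHS]opprB (@Rintegral_itvB _ _ (BLeft (- A)) (BRight 0) y)//.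
by rewrite bnd_simp ltW.
Qed.

Lemma is_derive_antiderivative (y : R) : is_derive y 1 antiderivative (h y).
Proof.
pose A := `|y| + 1.
have A0 : 0 <= A by rewrite addr_ge0.
have [Ay yA] : - A < y /\ y < A.
  have := lexx `|y|; rewrite ler_norml /A => /andP[? ?]; split; lra.
have [D E] := continuous_FTC1_closed yA (int_h (- A) A) Ay (hc (x := y)).
pose H z := \int[mu]_(t in `[- A, z]) h t - \int[mu]_(t in `[- A, 0]) h t.
apply: (@near_eq_is_derive _ _ _ H).
  near=> z; apply: esym; apply: antiderivativeE => //; apply: ltW.
  by near: z; exact: lt_nbhsr.
have DF : is_derive y 1 (fun z => \int[mu]_(t in `[- A, z]) h t) (h y).
  by rewrite -E derive1E; exact: derivableP.
have DH := is_derive_subf DF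
  (is_derive_cst (\int[mu]_(t in `[- A, 0]) h t) y 1).
by apply: (is_derive_eq DH); rewrite subr0.
Unshelve. all: by end_near. Qed.

End Antiderivative.

(** * Integration on the plane *)

Section PlaneIntegration.
Variable R : realType.
Notation mu := (@lebesgue_measure R).
Implicit Types (F G : R * R -> R) (t x M : R).

Lemma continuous_section1 F t : continuous F -> continuous (fun x => F (t, x)).
Proof.
move=> cF x; apply: (@continuous_comp _ _ _ (fun x : R => ((t, x) : R * R)) F x);
  last exact: cF.
by apply: (@cvg_pair _ _ _ _ (nbhs t) (nbhs x)); [exact: cvg_cst|exact: cvg_id].
Qed.

Lemma continuous_section2 F x : continuous F -> continuous (fun t => F (t, x)).
Proof.
move=> cF t; apply: (@continuous_comp _ _ _ (fun t : R => ((t, x) : R * R)) F t);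
  last exact: cF.
by apply: (@cvg_pair _ _ _ _ (nbhs t) (nbhs x)); [exact: cvg_id|exact: cvg_cst].
Qed.

(* Discretise the first variable: [F] is the limit of functions that are
   constant in [t] on the cells of length [1/(n+1)]. *)
Lemma continuous_measurable_plane F : continuous F -> measurable_fun setT F.
Proof.
move=> cF.
pose disc (n : nat) t : R := (Num.floor (n.+1%:R * t))%:~R / n.+1%:R.
pose F_ n (p : R * R) := F (disc n p.1, p.2).
apply: (measurable_fun_cvg (h := F_)).
  move=> n _ B mB; rewrite setTI.
  have -> : F_ n @^-1` B = \bigcup_(k : int)
      ([set t : R | Num.floor (n.+1%:R * t) = k] `*`
       [set x : R | B (F (k%:~R / n.+1%:R, x))]).
    apply/seteqP; split=> [[t x] h|[t x] [k _ [/= E h]]].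
      by exists (Num.floor (n.+1%:R * t)).
    by rewrite /F_ /disc /= E.
  apply: countable_bigcupT_measurable; first exact: countableP.
  move=> k; apply: measurableX.
    have -> : [set t : R | Num.floor (n.+1%:R * t) = k] =
        `[k%:~R / n.+1%:R, (k + 1)%:~R / n.+1%:R[%classic.
      apply/seteqP; split=> t /=; rewrite in_itv/= ler_pdivrMr// ltr_pdivlMr//
        mulrC.
        by move=> <-; exact: floor_itv.
      by move=> h; exact: floor_def.
    exact: measurable_itv.
  have mc := continuous_measurable_fun (continuous_section1 (t := k%:~R / n.+1%:R) cF).
  have := mc measurableT B mB; rewrite setTI; exact.
move=> [t x] _; rewrite /F_ /=.
apply: (@cvg_comp _ _ _ (fun n => ((disc n t, x) : R * R)) F _ (nbhs ((t, x) : R * R)));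
  last exact: cF.
apply: (@cvg_pair _ _ _ _ (nbhs t) (nbhs x)); last exact: cvg_cst.
apply/cvgrPdist_le => e e0.
near=> n.
have n0 : 0 < n.+1%:R :> R by [].
have ne : n.+1%:R^-1 <= e.
  near: n; have := @near_infty_natSinv_lt R (PosNum e0).
  by apply: filterS => m /= /ltW.
have /andP[h1 h2] := floor_itv (n.+1%:R * t).
rewrite intrD mulr1z in h2.
apply: le_trans ne; rewrite /disc /= ler_norml; apply/andP; split.
  apply: (@le_trans _ _ 0); first by rewrite oppr_le0 invr_ge0.
  by rewrite subr_ge0 ler_pdivrMr// [t * _]mulrC.
rewrite lerBlDr -[X in X + _]mul1r -mulrDl ler_pdivlMr// [t * _]mulrC addrC.
exact: ltW.
Unshelve. all: by end_near. Qed.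

Definition box M : set (R * R) := `[- M, M]%classic `*` `[- M, M]%classic.

Lemma box_measurable M : measurable (box M).
Proof. by apply: measurableX; exact: measurable_itv. Qed.

Lemma box_finite M : (@leb2 R (box M) < +oo)%E.
Proof.
rewrite /leb2 product_measure1E; [|exact: measurable_itv|exact: measurable_itv].
have E := lebesgue_measure_itv `[- M, M]%R.
change (mu `[(- M)%R, M]%classic * mu `[(- M)%R, M]%classic < +oo)%E.
by rewrite E/=; case: ifP => _; rewrite ?mule0 ?ltry// -EFinD -EFinM ltry.
Qed.

Lemma integrable_in_box F M C : measurable_fun setT F ->
  (forall p, `|F p| <= C) -> (forall p, ~ box M p -> F p = 0) ->
  (@leb2 R).-integrable setT (EFin \o F).
Proof.
move=> mF FC F0.
have -> : EFin \o F = (EFin \o F) \_ (box M).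
  apply/funext => p; rewrite patchE; case: ifPn => // /negP h /=.
  by rewrite F0// => h'; apply: h; rewrite inE.
have [H _] := @integrable_mkcond _ _ _ (@leb2 R) (box M) (EFin \o F) (box_measurable M).
apply: H.
apply: measurable_bounded_integrable.
- exact: box_measurable.
- exact: box_finite.
- exact: measurable_funS mF.
- exists C; split; first exact: num_real.
  by move=> y Cy p _ /=; exact: le_trans (FC p) (ltW Cy).
Qed.

Lemma integral_derivative_vanishes (H H' : R -> R) M : 0 < M ->
  (forall s : R, is_derive s 1 H (H' s)) -> continuous H' ->
  (forall s, M <= `|s| -> H s = 0) -> (forall s, M <= `|s| -> H' s = 0) ->
  (\int[mu]_s (H' s)%:E = 0)%E.
Proof.
move=> M0 dH cH' H0 H'0.
have -> : (fun s => (H' s)%:E) = (fun s => (H' s)%:E) \_ `[- M, M].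
  apply/funext => s; rewrite patchE; case: ifPn => // /negP h.
  rewrite H'0// leNgt; apply/negP; rewrite ltr_norml => /andP[h1 h2].
  by apply: h; rewrite inE/= in_itv/= !ltW.
rewrite -integral_mkcond.
have cH s : {for s, continuous H} := is_derive_continuous (dH s).
rewrite (@continuous_FTC2 _ H' H).
- by rewrite !H0 ?normrN ?subee//; rewrite ger0_norm// ltW.
- by rewrite gtrN.
- exact: continuous_subspaceT.
- split; first by move=> s _; have [] := dH s.
    by apply: cvg_at_right_filter; exact: cH.
  by apply: cvg_at_left_filter; exact: cH.
- by move=> s _; rewrite derive1E; apply: derive_val.
Qed.

(** Fubini with time as the inner variable: each inner integral is the increment of [F] between two
    points where it vanishes. The next lemma is the same with space inside. *)
Lemma integral_dt_vanishes F F' M : 0 < M ->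
  (forall t x : R, is_derive t 1 (fun s => F (s, x)) (F' (t, x))) ->
  continuous F' -> (exists C, forall p, `|F' p| <= C) ->
  (forall t x, M <= `|t| \/ M <= `|x| -> F (t, x) = 0 /\ F' (t, x) = 0) ->
  \int[@leb2 R]_p F' p = 0.
Proof.
move=> M0 dF cF' [C FC] F0.
have iF : (@leb2 R).-integrable setT (EFin \o F').
  apply: (@integrable_in_box _ M C) => //; first exact: continuous_measurable_plane.
  move=> [t x] h; apply: (proj2 (F0 _ _ _)).
  have [|tM] := leP M `|t|; first by left.
  have [|xM] := leP M `|x|; first by right.
  exfalso; apply: h; move: tM xM; rewrite !ltr_norml => /andP[? ?] /andP[? ?].
  by split; rewrite /= in_itv/= !ltW.
rewrite /Rintegral /leb2 -(integral21_prod_meas1 iF).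
rewrite (eq_integral (cst 0%E)) ?integral0// => x _.
rewrite /fubini_G/=.
apply: (@integral_derivative_vanishes (fun s => F (s, x)) (fun s => F' (s, x)) M) => //.
- exact: continuous_section2.
- by move=> s Ms; apply: (proj1 (F0 _ _ _)); left.
- by move=> s Ms; apply: (proj2 (F0 _ _ _)); left.
Qed.

Lemma integral_dx_vanishes F F' M : 0 < M ->
  (forall t x : R, is_derive x 1 (fun s => F (t, s)) (F' (t, x))) ->
  continuous F' -> (exists C, forall p, `|F' p| <= C) ->
  (forall t x, M <= `|t| \/ M <= `|x| -> F (t, x) = 0 /\ F' (t, x) = 0) ->
  \int[@leb2 R]_p F' p = 0.
Proof.
move=> M0 dF cF' [C FC] F0.
have iF : (@leb2 R).-integrable setT (EFin \o F').
  apply: (@integrable_in_box _ M C) => //; first exact: continuous_measurable_plane.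
  move=> [t x] h; apply: (proj2 (F0 _ _ _)).
  have [|tM] := leP M `|t|; first by left.
  have [|xM] := leP M `|x|; first by right.
  exfalso; apply: h; move: tM xM; rewrite !ltr_norml => /andP[? ?] /andP[? ?].
  by split; rewrite /= in_itv/= !ltW.
rewrite /Rintegral /leb2 -(integral12_prod_meas1 iF).
rewrite (eq_integral (cst 0%E)) ?integral0// => t _.
rewrite /fubini_F/=.
apply: (@integral_derivative_vanishes (fun s => F (t, s)) (fun s => F' (t, s)) M) => //.
- exact: continuous_section1.
- by move=> s Ms; apply: (proj1 (F0 _ _ _)); right.
- by move=> s Ms; apply: (proj2 (F0 _ _ _)); right.
Qed.

(** Dominated convergence, with [C] times the indicator of the box as majorant. *)
Lemma Rintegral_bounded_cvg (F_ : nat -> R * R -> R) F M C :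
  (forall n, measurable_fun setT (F_ n)) ->
  (forall n p, `|F_ n p| <= C) -> (forall n p, ~ box M p -> F_ n p = 0) ->
  (forall p, F_ n p @[n --> \oo] --> F p) ->
  \int[@leb2 R]_p F_ n p @[n --> \oo] --> \int[@leb2 R]_p F p.
Proof.
move=> mF FC F0 cF.
have C0 : 0 <= C := le_trans (normr_ge0 _) (FC 0%N (0, 0)).
pose g (p : R * R) := C * \1_(box M) p.
have mg : measurable_fun setT g.
  by apply: measurable_funM => //; exact: measurable_indic (box_measurable M).
have gE p : g p = if `[< box M p >] then C else 0.
  by rewrite /g indicE /in_mem /= /in_set; case: asboolP => _; rewrite ?mulr1 ?mulr0.
have ig : (@leb2 R).-integrable setT (EFin \o g).
  apply: (@integrable_in_box _ M C) => //.
    by move=> p; rewrite gE; case: asboolP => _; rewrite ?normr0// ger0_norm.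
  by move=> p h; rewrite gE; case: asboolP.
have mlim := measurable_fun_cvg mF (fun p _ => cF p).
have [||iF _ H] := @dominated_convergence _ _ _ (@leb2 R) setT measurableT
  (fun n p => (F_ n p)%:E) (fun p => (F p)%:E) (EFin \o g)
  (fun n => (proj2 (measurable_EFinP _ _) (mF n)))
  (proj2 (measurable_EFinP _ _) mlim) _ ig.
- by apply: aeW => p _; apply: cvg_EFin; [exact: nearW|exact: cF].
- apply: aeW => p n _; rewrite /= lee_fin gE; case: asboolP => // h.
  by rewrite F0// normr0.
apply: fine_cvg.
rewrite /Rintegral fineK; first exact: H.
exact: integrable_fin_num iF.
Qed.

End PlaneIntegration.

(** * Test functions and curves *)

Section FiniteSums.
Variable R : realType.

Lemma is_derive_sumf (F F' : nat -> R -> R) (N : nat) (x : R) :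
  (forall k, is_derive x 1 (F k) (F' k x)) ->
  is_derive x 1 (fun y => \sum_(0 <= k < N) F k y) (\sum_(0 <= k < N) F' k x).
Proof.
move=> dF; elim: N => [|N IH].
  rewrite big_geq//; have -> : (fun y => \sum_(0 <= k < 0) F k y) = cst 0.
    by apply/funext => y; rewrite big_geq.
  exact: is_derive_cst.
rewrite big_nat_recr//=.
have -> : (fun y => \sum_(0 <= k < N.+1) F k y) =
    (fun y => \sum_(0 <= k < N) F k y + F N y).
  by apply/funext => y; rewrite big_nat_recr.
exact: is_derive_addf.
Qed.

Lemma continuous_sumf (X : topologicalType) (F : nat -> X -> R) (N : nat) :
  (forall k, continuous (F k)) ->
  continuous (fun y => \sum_(0 <= k < N) F k y).
Proof.
move=> cF; elim: N => [|N IH].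
  have -> : (fun y => \sum_(0 <= k < 0) F k y) = cst 0.
    by apply/funext => y; rewrite big_geq.
  by move=> x; exact: cvg_cst.
have -> : (fun y => \sum_(0 <= k < N.+1) F k y) =
    (fun y => \sum_(0 <= k < N) F k y + F N y).
  by apply/funext => y; rewrite big_nat_recr.
by move=> x; exact: (cvgD (IH x) (cF N x)).
Qed.

End FiniteSums.

Section PlaneFunctions.
Variable R : realType.
Implicit Types (F : R * R -> R) (phi : R * R -> R).

Lemma continuous_fst_plane : continuous (fun p : R * R => p.1).
Proof. by move=> p; exact: cvg_fst. Qed.

Lemma continuous_snd_plane : continuous (fun p : R * R => p.2).
Proof. by move=> p; exact: cvg_snd. Qed.

Lemma continuous_compf (X : topologicalType) (f : X -> R) (g : R -> R) :
  continuous f -> continuous g -> continuous (fun x => g (f x)).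
Proof. by move=> cf cg x; apply: continuous_comp; [exact: cf|exact: cg]. Qed.

Lemma continuous_addf (X : topologicalType) (f g : X -> R) :
  continuous f -> continuous g -> continuous (fun x => f x + g x).
Proof. by move=> cf cg x; exact: (cvgD (cf x) (cg x)). Qed.

Lemma continuous_subf (X : topologicalType) (f g : X -> R) :
  continuous f -> continuous g -> continuous (fun x => f x - g x).
Proof. by move=> cf cg x; exact: (cvgB (cf x) (cg x)). Qed.

Lemma continuous_mulf (X : topologicalType) (f g : X -> R) :
  continuous f -> continuous g -> continuous (fun x => f x * g x).
Proof. by move=> cf cg x; exact: (cvgM (cf x) (cg x)). Qed.

Lemma continuous_bounded_on_compact (X : topologicalType) (f : X -> R) K :
  compact K -> continuous f -> exists C, forall x, K x -> `|f x| <= C.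
Proof.
move=> cK cf.
have cfK := continuous_compact (continuous_subspaceT cf) cK.
have [M [_ H]] := compact_bounded cfK.
exists (M + 1) => x Kx.
by apply: (H (M + 1)); [rewrite ltrDl|exists x].
Qed.

Lemma continuous_bounded_in_box F M : continuous F ->
  (forall p, ~ box M p -> F p = 0) -> exists C, forall p, `|F p| <= C.
Proof.
move=> cF F0.
have cK : compact (box M) by apply: compact_setX; exact: segment_compact.
have [C HC] := continuous_bounded_on_compact cK cF.
exists (Num.max C 0) => p; have [/HC h|h] := pselect (box M p).
  by rewrite le_max h.
by rewrite F0// normr0 le_max lexx orbT.
Qed.

(** Links the directional derivative in the plane to the one-variable derivative of a section, to
    which the product rule applies. *)
Lemma is_derive_dt phi (t x : R) : derivable phi (t, x) ((1, 0) : R * R) ->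
  is_derive t 1 (fun s => phi (s, x)) (dt phi (t, x)).
Proof.
move=> d.
have E : (fun h : R => h^-1 *: (phi (h *: ((1, 0) : R * R) + (t, x)) - phi (t, x)))
   = (fun h : R => h^-1 *: (phi (h *: (1 : R) + t, x) - phi (t, x))).
  apply/funext => h; congr (_ *: (phi _ - _)).
  by apply: injective_projections => /=; rewrite ?scaler0 ?add0r.
apply: DeriveDef; first by move: d; rewrite /derivable E.
by rewrite /dt /derive E.
Qed.

Lemma is_derive_dx phi (t x : R) : derivable phi (t, x) ((0, 1) : R * R) ->
  is_derive x 1 (fun s => phi (t, s)) (dx phi (t, x)).
Proof.
move=> d.
have E : (fun h : R => h^-1 *: (phi (h *: ((0, 1) : R * R) + (t, x)) - phi (t, x)))
   = (fun h : R => h^-1 *: (phi (t, h *: (1 : R) + x) - phi (t, x))).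
  apply/funext => h; congr (_ *: (phi _ - _)).
  by apply: injective_projections => /=; rewrite ?scaler0 ?add0r.
apply: DeriveDef; first by move: d; rewrite /derivable E.
by rewrite /dx /derive E.
Qed.

(** Far out [phi] vanishes on a whole neighbourhood, so its derivatives vanish too. Integrability
    uses the complement of the box, while integration by parts also needs the boundary lines; hence
    the two descriptions of the outside. *)
Lemma test_function_support phi : test_function phi -> exists2 M, 0 < M &
  forall p : R * R, ~ box M p \/ M <= `|p.1| \/ M <= `|p.2| ->
    [/\ phi p = 0, dt phi p = 0 & dx phi p = 0].
Proof.
move=> [_ cpt]; have [M [_ H]] := compact_bounded cpt.
pose N := `|M| + 1.
have MN : M < N by rewrite /N (le_lt_trans (ler_norm M))// ltrDl.
have N0 : 0 < N by rewrite /N ltr_wpDl.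
have phi0 (p : R * R) : N < `|p| -> phi p = 0.
  move=> h; apply/eqP; apply: contraT => pn0; move: h; rewrite ltNge => /negP[].
  by apply: (H N MN); exact: subset_closure.
(* The extra 1 puts also the boundary points at norm above [N], in the open region where [phi] is
   zero. *)
exists (N + 1); first by rewrite addr_gt0.
move=> p hp.
have {}hp : N < `|p|.
  have [h1|h1] := ltP N `|p.1|; first by rewrite prod_normE lt_max h1.
  have [h2|h2] := ltP N `|p.2|; first by rewrite prod_normE lt_max h2 orbT.
  exfalso; case: hp => [hp|]; last first.
    by case=> h; [move: h1|move: h2]; lra.
  apply: hp; move: h1 h2; rewrite !ler_norml => /andP[? ?] /andP[? ?].
  by split; rewrite /= in_itv/=; apply/andP; split; lra.
have E : \near p, phi p = cst 0 p.
  have : \forall q \near p, N < `|q|.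
    exact: (@cvgr_norm_gt _ _ _ (nbhs p) _ id p cvg_id N hp).
  by apply: filterS => q; exact: phi0.
split; first exact: phi0.
  by rewrite /dt (near_eq_derive _ E) derive_cst.
by rewrite /dx (near_eq_derive _ E) derive_cst.
Qed.

End PlaneFunctions.

(** * From difference quotients relative to an interval to continuity and derivatives *)

Section Curves.
Variable R : realType.
Implicit Types (g : R -> R) (I : set R) (s c : R).

Lemma quotient_growth g I s c :
  (g r - g s) / (r - s) @[r --> within I s^'] --> c ->
  \forall r \near s, I r -> `|g r - g s| <= (`|c| + 1) * `|r - s|.
Proof.
move=> /cvgrPdist_le/(_ _ ltr01); rewrite near_withinE near_withinE.
apply: filterS => r H Ir; have [->|rs] := eqVneq r s.
  by rewrite !subrr normr0 mulr0.
have {H} := H rs Ir.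
have rs0 : 0 < `|r - s| by rewrite normr_gt0 subr_eq0.
set q := _ / _ => H.
have -> : g r - g s = q * (r - s) by rewrite divfK// subr_eq0.
rewrite normrM ler_pM2r//.
rewrite -[q](subKr c); apply: le_trans (ler_normB _ _) _.
by rewrite lerD2l.
Qed.

Lemma quotient_within_continuous g I (a b : R) (c : R -> R) :
  (forall s, I s -> (g r - g s) / (r - s) @[r --> within I s^'] --> c s) ->
  (forall s, a <= s <= b -> I s) ->
  forall s, a <= s <= b -> g r @[r --> within `[a, b] (nbhs s)] --> g s.
Proof.
move=> H abI s sab; apply/cvgrPdist_le => e e0; rewrite near_withinE.
have c0 : 0 < `|c s| + 1 by rewrite ltr_wpDl.
near=> r; move=> /= rab; rewrite distrC.
have /abI Ir : a <= r <= b by rewrite in_itv in rab.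
apply: (@le_trans _ _ ((`|c s| + 1) * `|r - s|)).
  move: Ir; near: r; apply: quotient_growth; apply: H; exact: abI.
rewrite mulrC -ler_pdivlMr// distrC.
by near: r; apply: cvgr_dist_le => //; rewrite divr_gt0.
Unshelve. all: by end_near. Qed.

(** At an interior point of [I] the restriction of the filter to [I] changes nothing. *)
Lemma quotient_is_derive g I s c : nbhs s I ->
  (g r - g s) / (r - s) @[r --> within I s^'] --> c ->
  is_derive s 1 g c.
Proof.
move=> nI H.
have {}H : (g r - g s) / (r - s) @[r --> s^'] --> c.
  apply: cvg_trans H => P HP.
  have sI : s^' I by exact: (cvg_within _ nI).
  have HP' : s^' [set r | I r -> P ((g r - g s) / (r - s))] := HP.
  have : s^' [set r | P ((g r - g s) / (r - s))].
    by apply: filterS2 sI HP' => r Ir; exact.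
  exact.
have Hc : h^-1 *: (g (h *: (1 : R) + s) - g s) @[h --> (0:R)^'] --> c.
  have E : (fun h : R => h^-1 *: (g (h *: (1 : R) + s) - g s)) =
      (fun r => (g r - g s) / (r - s)) \o (fun h => h + s).
    apply/funext => h /=.
    by rewrite /GRing.scale/= mulr1 addrK mulrC.
  rewrite E; apply: cvg_comp H => P /=.
  rewrite !nbhs_simpl /= /dnbhs /within/= => /nbhs_ballP[e e0 he].
  apply/nbhs_ballP; exists e => // h bh h0; apply: he.
    move: bh; rewrite /ball/= sub0r normrN => bh.
    by rewrite opprD addrA [s - h]addrC addrK normrN.
  by rewrite -subr_eq0 addrK.
apply: DeriveDef; first by apply/cvg_ex; exists c.
exact: cvg_lim.
Unshelve. all: by end_near. Qed.

End Curves.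

(** * Balance laws for sheared sums of disjoint waves *)

Lemma cvg_opp_sub_eq (R : realType) (a b c : nat -> R) (la lb lc : R) :
  a n @[n --> \oo] --> la -> b n @[n --> \oo] --> lb ->
  c n @[n --> \oo] --> lc -> (forall n, - a n - b n = c n) -> - la - lb = lc.
Proof.
move=> ha hb hc E.
have h : (- a n - b n) @[n --> \oo] --> - la - lb by apply: cvgB => //; exact: cvgN.
have h' : (- a n - b n) @[n --> \oo] --> lc.
  by have -> : (fun n => - a n - b n) = c by apply/funext.
exact: (cvg_unique _ h h').
Qed.

Section ClassicalSolutions.
Variable R : realType.
Variables (f v : R -> R).
Hypothesis df : forall y : R, is_derive y 1 f (v y).
Hypothesis cv : continuous v.

(** Integration by parts: the integrals of the [t]-derivative of [u * phi] and of the [x]-derivative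
    of [f(u) * phi] are zero. *)
Lemma balance_law_classical (u ut ux : R * R -> R) :
  continuous u -> continuous ut -> continuous ux ->
  (forall t x : R, is_derive t 1 (fun s => u (s, x)) (ut (t, x))) ->
  (forall t x : R, is_derive x 1 (fun s => u (t, s)) (ux (t, x))) ->
  balance_law f u (fun p => ut p + ux p * v (u p)).
Proof.
move=> cu cut cux dut dux phi tf; have [M M0 supp] := test_function_support tf.
have [/(_ 1%N)[cphi d1 d2 cdt cdx] _] := tf; simpl in cdt, cdx.
have cf : continuous f by move=> y; exact: is_derive_continuous (df y).
have cfu : continuous (fun p => f (u p)) by exact: (continuous_compf cu cf).
have cvu : continuous (fun p => v (u p)) by exact: (continuous_compf cu cv).
have out p : ~ box M p -> [/\ phi p = 0, dt phi p = 0 & dx phi p = 0].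
  by move=> h; apply: supp; left.
have out' (t x : R) : M <= `|t| \/ M <= `|x| ->
    [/\ phi (t, x) = 0, dt phi (t, x) = 0 & dx phi (t, x) = 0].
  by move=> h; apply: supp; right.
have c1 := continuous_mulf cut cphi.
have c2 := continuous_mulf cu cdt.
have c3 := continuous_mulf (continuous_mulf cux cvu) cphi.
have c4 := continuous_mulf cfu cdx.
have z1 p : ~ box M p -> ut p * phi p = 0 by move=> /out[-> _ _]; rewrite mulr0.
have z2 p : ~ box M p -> u p * dt phi p = 0 by move=> /out[_ -> _]; rewrite mulr0.
have z3 p : ~ box M p -> ux p * v (u p) * phi p = 0.
  by move=> /out[-> _ _]; rewrite mulr0.
have z4 p : ~ box M p -> f (u p) * dx phi p = 0.
  by move=> /out[_ _ ->]; rewrite mulr0.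
have int F : continuous F -> (forall p, ~ box M p -> F p = 0) ->
    (@leb2 R).-integrable setT (EFin \o F).
  move=> cF F0; have [C FC] := continuous_bounded_in_box cF F0.
  exact: (integrable_in_box (continuous_measurable_plane cF) FC F0).
have I1 : \int[@leb2 R]_p (ut p * phi p + u p * dt phi p) = 0.
  have c := continuous_addf c1 c2.
  apply: (integral_dt_vanishes (F := fun p => u p * phi p) M0 _ c).
  - move=> t x; exact: (is_derive_mulf (dut t x) (is_derive_dt (d1 _))).
  - apply: (continuous_bounded_in_box c (M := M)) => p h.
    by rewrite z1// z2// addr0.
  - by move=> t x /out'[-> -> _]; rewrite !mulr0 addr0.
have I2 : \int[@leb2 R]_p (ux p * v (u p) * phi p + f (u p) * dx phi p) = 0.
  have c := continuous_addf c3 c4.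
  apply: (integral_dx_vanishes (F := fun p => f (u p) * phi p) M0 _ c).
  - move=> t x.
    exact: (is_derive_mulf (is_derive_compf (df _) (dux t x)) (is_derive_dx (d2 _))).
  - apply: (continuous_bounded_in_box c (M := M)) => p h.
    by rewrite z3// z4// addr0.
  - by move=> t x /out'[-> _ ->]; rewrite !mulr0 addr0.
have i1 := int _ c1 z1; have i2 := int _ c2 z2.
have i3 := int _ c3 z3; have i4 := int _ c4 z4.
rewrite (RintegralD measurableT i1 i2) in I1.
rewrite (RintegralD measurableT i3 i4) in I2.
have -> : \int[@leb2 R]_p ((ut p + ux p * v (u p)) * phi p) =
    \int[@leb2 R]_p (ut p * phi p) + \int[@leb2 R]_p (ux p * v (u p) * phi p).
  rewrite -(RintegralD measurableT i1 i3); apply: eq_Rintegral => p _.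
  by rewrite mulrDl.
move/eqP: I1; rewrite addr_eq0 => /eqP ->.
by move/eqP: I2; rewrite addr_eq0 => /eqP ->.
Qed.

Lemma balance_law_eq (u g g' : R * R -> R) : g =1 g' ->
  balance_law f u g -> balance_law f u g'.
Proof. by move=> /funext ->. Qed.

End ClassicalSolutions.

Section ShearedPerturbation.
Variable R : realType.
Variables (f v : R -> R) (A A' B B' : nat -> R -> R) (G : R).
Hypothesis df : forall y : R, is_derive y 1 f (v y).
Hypothesis cv : continuous v.
Hypothesis dA : forall k, class_C1 (A k) (A' k).
Hypothesis dB : forall k, class_C1 (B k) (B' k).
Hypothesis disjoint_terms : forall k l t x, k <> l ->
  A k t * B k x = 0 \/ A l t * B l x = 0.
Hypothesis A_critical : forall k t, A k t = 0 -> A' k t = 0.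
Hypothesis B_critical : forall k x, B k x = 0 -> B' k x = 0.
Hypothesis terms_small : forall k t x, `|A k t * B k x| <= 2^-1 ^+ k.
Hypothesis time_rate : forall k t x, `|A' k t * B k x| <= G.
Hypothesis transport_rate : forall k t x,
  `|(v (t + A k t * B k x) - v t) * (A k t * B' k x)| <= G.

Definition term k (q : R * R) := A k q.1 * B k q.2.

Local Notation wN N := (partial_sum term N).
Local Notation w := (total_sum term).

(** Straightens the characteristics of the background solution [u = t], which are the curves
    [x = f(t) + c]. *)
Definition shear (p : R * R) : R * R := (p.1, p.2 - f p.1).
Definition sheared_sum (p : R * R) := p.1 + w (shear p).
Definition sheared_partial N (p : R * R) := p.1 + wN N (shear p).

Local Notation u := sheared_sum.
Local Notation uN := sheared_partial.

Definition slope_t N (q : R * R) := \sum_(0 <= k < N) A' k q.1 * B k q.2.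
Definition slope_x N (q : R * R) := \sum_(0 <= k < N) A k q.1 * B' k q.2.
(** The source of the partial sum, that is, the derivative of [sheared_partial N] along its
    characteristics. The 1 comes from the background [t], and the difference of speeds is the
    velocity of a characteristic in sheared coordinates. *)
Definition rate N (q : R * R) :=
  1 + slope_t N q + (v (q.1 + wN N q) - v q.1) * slope_x N q.

Let term_le k q : `|term k q| <= 2^-1 ^+ k.
Proof. exact: terms_small. Qed.

Let term_eq0 k q : term k q = 0 ->
  A' k q.1 * B k q.2 = 0 /\ A k q.1 * B' k q.2 = 0.
Proof.
move=> /eqP; rewrite mulf_eq0 => /orP[/eqP a0|/eqP b0].
  by rewrite a0 A_critical// !mul0r.
by rewrite b0 B_critical// !mulr0.
Qed.

Let sum_single (F : nat -> R) N k :
  (forall l, l <> k -> F l = 0) -> (k < N)%N -> \sum_(0 <= l < N) F l = F k.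
Proof.
move=> F0 kN; rewrite big_mkord (bigD1 (Ordinal kN))//= big1 ?addr0//.
by move=> i ik; apply: F0 => ik'; move/eqP: ik; apply; exact: val_inj.
Qed.

(** By disjointness at most one term is nonzero at a point; by criticality the derivatives of the
    vanishing terms contribute nothing there either. All sums at [q] thus reduce to one summand or
    none. *)
Let active N q : (forall k, (k < N)%N -> term k q = 0) \/
  exists k, [/\ (k < N)%N, term k q != 0 & forall l, l <> k -> term l q = 0].
Proof.
have [H|/existsNP[k /not_implyP[kN /eqP kq]]] :=
  pselect (forall k, (k < N)%N -> term k q = 0); first by left.
right; exists k; split=> // l lk.
have [//|h] := disjoint_terms q.1 q.2 lk.
by rewrite /term h eqxx in kq.
Qed.

Let idle N q : (forall k, (k < N)%N -> term k q = 0) ->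
  [/\ wN N q = 0, slope_t N q = 0 & slope_x N q = 0].
Proof.
move=> H; rewrite /partial_sum /slope_t /slope_x.
by split; rewrite big_nat_cond big1// => k /andP[/andP[_ kN] _];
  have := H _ kN => // /term_eq0[].
Qed.

Let solo N q k : (k < N)%N -> (forall l, l <> k -> term l q = 0) ->
  [/\ wN N q = term k q, slope_t N q = A' k q.1 * B k q.2 &
   slope_x N q = A k q.1 * B' k q.2].
Proof.
move=> kN H; split; rewrite /partial_sum /slope_t /slope_x (sum_single (k := k))//;
  by move=> l /H/term_eq0[].
Qed.

(** Since only one term acts at each point, the bounds for single terms do not add up with [N]. *)
Lemma rate_le N q : `|rate N q| <= 1 + G + G.
Proof.
have G0 : 0 <= G := le_trans (normr_ge0 _) (time_rate 0 0 0).
rewrite /rate; have [/idle[-> -> ->]|[k [kN _ /(solo kN)[-> -> ->]]]] := active N q.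
  rewrite addr0 mulr0 addr0 normr1 -addrA lerDl; lra.
apply: le_trans (ler_normD _ _) _; apply: lerD; last exact: transport_rate.
apply: le_trans (ler_normD _ _) _; rewrite normr1 lerD2l.
exact: time_rate.
Qed.

(** Once the only term that can act at [q] has entered the sum, nothing changes any more. *)
Lemma rate_eventually_constant q :
  exists N0, forall N, (N0 <= N)%N -> rate N q = rate N0 q.
Proof.
have [H|/existsNP[k /eqP kq]] := pselect (forall k, term k q = 0).
  have H' N k : (k < N)%N -> term k q = 0 by move=> _; exact: H.
  exists 0%N => N _; rewrite /rate.
  by have [-> -> ->] := idle (@H' N); have [-> -> ->] := idle (@H' 0%N).
have H l : l <> k -> term l q = 0.
  move=> lk; have [//|h] := disjoint_terms q.1 q.2 lk.
  by rewrite /term h eqxx in kq.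
exists k.+1 => N kN; rewrite /rate.
by have [-> -> ->] := solo kN H; have [-> -> ->] := solo (ltnSn k) H.
Qed.

Definition limit_rate q : R := limn (fun N => rate N q).

Lemma rate_cvg q : rate N q @[N --> \oo] --> limit_rate q.
Proof.
have [N0 H] := rate_eventually_constant q.
suff : cvgn (fun N => rate N q) by [].
apply/cvg_ex; exists (rate N0 q).
apply: cvg_near_cst; near=> N; apply: H.
by near: N; exact: nbhs_infty_ge.
Unshelve. all: by end_near. Qed.

Lemma total_sum_of_solo q k : (forall l, l <> k -> term l q = 0) ->
  w q = term k q.
Proof.
move=> H; have c := partial_sum_cvg term_le (p := q).
have c' : wN N q @[N --> \oo] --> term k q.
  apply: cvg_near_cst; near=> N.
  have kN : (k < N)%N by near: N; exact: nbhs_infty_gt.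
  by have [-> _ _] := solo kN H.
exact: (cvg_unique _ c c').
Unshelve. all: by end_near. Qed.

Lemma total_sum_cases q : w q = 0 /\ (forall k, term k q = 0) \/
  exists k, [/\ w q = term k q, term k q != 0 & forall l, l <> k -> term l q = 0].
Proof.
have [H|/existsNP[k /eqP kq]] := pselect (forall k, term k q = 0).
  by left; split=> //; rewrite (@total_sum_of_solo q 0%N).
right; exists k.
have H l : l <> k -> term l q = 0.
  move=> lk; have [//|h] := disjoint_terms q.1 q.2 lk.
  by rewrite /term h eqxx in kq.
by rewrite (total_sum_of_solo H).
Qed.

(* Where some term with index below [N] is active, [w] and its partial sum
   agree; elsewhere [slope_x N] vanishes.  Hence characteristics of [u] see the
   same rate as those of the smooth approximation. *)
Lemma rate_total N q :
  rate N q = 1 + slope_t N q + (v (q.1 + w q) - v q.1) * slope_x N q.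
Proof.
rewrite /rate; have [/idle[-> -> ->]|[k [kN _ H]]] := active N q.
  by rewrite !mulr0.
by have [-> _ _] := solo kN H; rewrite (total_sum_of_solo H).
Qed.

Let cf : continuous f.
Proof. by move=> y; exact: is_derive_continuous (df y). Qed.

Let cA k : continuous (A k). Proof. exact: class_C1_continuous (dA k). Qed.
Let cB k : continuous (B k). Proof. exact: class_C1_continuous (dB k). Qed.
Let cA' k : continuous (A' k). Proof. by case: (dA k). Qed.
Let cB' k : continuous (B' k). Proof. by case: (dB k). Qed.

Let cfst := @continuous_fst_plane R.
Let csnd := @continuous_snd_plane R.

Let c_term k : continuous (term k).
Proof. by apply: continuous_mulf; exact: continuous_compf. Qed.

Lemma continuous_shear : continuous shear.
Proof.
move=> p; apply: (@cvg_pair _ _ _ _ (nbhs p.1) (nbhs (p.2 - f p.1))).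
  exact: cfst.
exact: (continuous_subf csnd (continuous_compf cfst cf)).
Qed.

Let c_shear_comp (F : R * R -> R) : continuous F ->
  continuous (fun p => F (shear p)).
Proof.
by move=> cF p; apply: continuous_comp; [exact: continuous_shear|exact: cF].
Qed.

Lemma continuous_sheared_sum : continuous u.
Proof.
apply: continuous_addf => //; apply: c_shear_comp.
exact: continuous_total_sum.
Qed.

Lemma continuous_sheared_partial N : continuous (uN N).
Proof.
apply: continuous_addf => //; apply: c_shear_comp.
exact: continuous_sumf.
Qed.

Let c_slope_t N : continuous (slope_t N).
Proof.
by apply: continuous_sumf => k; apply: continuous_mulf; exact: continuous_compf.
Qed.

Let c_slope_x N : continuous (slope_x N).
Proof.
by apply: continuous_sumf => k; apply: continuous_mulf; exact: continuous_compf.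
Qed.

Let c_rate N : continuous (rate N).
Proof.
apply: continuous_addf.
  by apply: continuous_addf => //; move=> q; exact: cvg_cst.
apply: continuous_mulf => //; apply: continuous_subf; apply: continuous_compf => //.
by apply: continuous_addf => //; exact: continuous_sumf.
Qed.

Lemma is_derive_partial_along (z : R -> R) (c s : R) N : is_derive s 1 z c ->
  is_derive s 1 (fun r => r + wN N (r, z r))
    (1 + (slope_t N (s, z s) + c * slope_x N (s, z s))).
Proof.
move=> dz; have H := @is_derive_sumf R (fun k r => A k r * B k (z r))
  (fun k r => A' k r * B k (z r) + A k r * (c * B' k (z r))) N s.
have {}H := H (fun k => is_derive_mulf (proj1 (dA k) s)
  (is_derive_compf (proj1 (dB k) (z s)) dz)).
apply: (is_derive_eq (is_derive_addf (is_derive_id s 1) H)).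
rewrite big_split/=; congr (_ + (_ + _)); rewrite /slope_x mulr_sumr.
by apply: eq_bigr => k _ /=; lra.
Qed.

(** The limit [u] need not be differentiable along [gamma]. The mean value theorem is applied to the
    smooth partial sums along the characteristic of [u], with a bound independent of [N], and then
    [N] tends to infinity. *)
Lemma sheared_sum_lipschitz_along_characteristics (I : set R) (gamma : R -> R) :
  characteristic f u I gamma -> (1 + G + G).-lipschitz_I (fun t => u (t, gamma t)).
Proof.
move=> [itvI _ dgamma].
have fv : f^`() = v.
  by apply/funext => y; rewrite derive1E; apply: derive_val.
rewrite fv in dgamma.
have main a b : I a -> I b -> a <= b ->
    `|u (b, gamma b) - u (a, gamma a)| <= (1 + G + G) * (b - a).
  move=> Ia Ib ab.
  have abI s : a <= s <= b -> I s by move=> sab; exact: itvI Ia Ib _ sab.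
  pose phi N s := uN N (s, gamma s).
  have bound N : `|phi N b - phi N a| <= (1 + G + G) * (b - a).
    have wc : {within `[a, b], continuous (phi N)}.
      apply/subspace_continuousP => s /=; rewrite in_itv/= => sab.
      apply: (@cvg_comp _ _ _ (fun r => ((r, gamma r) : R * R)) (uN N) _
        (nbhs ((s, gamma s) : R * R))); last exact: continuous_sheared_partial.
      apply: (@cvg_pair _ _ _ _ (nbhs s) (nbhs (gamma s))).
        exact: cvg_within.
      exact: (quotient_within_continuous dgamma abI).
    have dphi s : a < s < b -> is_derive s 1 (phi N) (rate N (shear (s, gamma s))).
      move=> /andP[a_s sb].
      have Is : I s by apply: abI; rewrite !ltW.
      have nI : nbhs s I.
        have : \forall r \near s, r \in `]a, b[%R.
          by apply: near_in_itvoo; rewrite in_itv/= a_s.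
        apply: filterS => r; rewrite in_itv/= => /andP[? ?].
        by apply: abI; rewrite !ltW.
      have dg := quotient_is_derive nI (dgamma s Is).
      have := @is_derive_partial_along (fun r => gamma r - f r) _ s N
        (is_derive_subf dg (df s)).
      (* The curve moves with the speed of the full sum, yet the derivative is [rate N]: this is the
         content of [rate_total]. *)
      by rewrite rate_total /shear /= addrA.
    have := MVT_bounds ab wc dphi (m := - (1 + G + G)) (M := 1 + G + G).
    rewrite mulNr ler_norml; apply => s _.
    by rewrite -ler_norml; exact: rate_le.
  have c s : phi N s @[N --> \oo] --> u (s, gamma s).
    by apply: cvgD; [exact: cvg_cst|exact: (partial_sum_cvg term_le)].
  apply: (cvgr_to_le (cvg_norm (cvgB (c b) (c a)))).
  by apply: nearW => N; exact: bound.
move=> [a b] /= [Ia Ib]; rewrite /self_sub/=.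
have [ab|ba] := leP a b; first by
  rewrite distrC [`|a - b|]distrC (ger0_norm (_ : 0 <= b - a)) ?subr_ge0// main.
by rewrite (ger0_norm (_ : 0 <= a - b)) ?subr_ge0 ?main// ltW.
Qed.

Lemma is_derive_partial_t N (t x : R) :
  is_derive t 1 (fun s => uN N (s, x))
    (1 + slope_t N (shear (t, x)) - v t * slope_x N (shear (t, x))).
Proof.
have := @is_derive_partial_along (fun r => x - f r) _ t N
  (is_derive_subf (is_derive_cst x t 1) (df t)).
by rewrite sub0r mulNr addrA.
Qed.

Lemma is_derive_partial_x N (t x : R) :
  is_derive x 1 (fun s => uN N (t, s)) (slope_x N (shear (t, x))).
Proof.
have dz : is_derive x 1 (fun s => 1 * s + - f t) 1 := is_derive_affine _ _ _.
have H := @is_derive_sumf R (fun k r => A k t * B k (1 * r + - f t))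
  (fun k r => 0 * B k (1 * r + - f t) + A k t * (1 * B' k (1 * r + - f t))) N x.
have {}H := H (fun k => is_derive_mulf (is_derive_cst (A k t) x 1)
  (is_derive_compf (proj1 (dB k) _) dz)).
have {}H := is_derive_addf (is_derive_cst t x 1) H.
have E : (fun s => uN N (t, s)) = (fun y : R => cst t y +
    \sum_(0 <= k < N) A k t * B k (1 * y + - f t)).
  apply/funext => y; rewrite /sheared_partial /shear /partial_sum /term/=.
  by congr (_ + _); apply: eq_bigr => k _; rewrite mul1r.
rewrite E; apply: (is_derive_eq H); rewrite add0r /slope_x.
by apply: eq_bigr => k _; rewrite /= mul0r add0r !mul1r.
Qed.

Let mc (F : R * R -> R) : continuous F -> measurable_fun setT F.
Proof. exact: continuous_measurable_plane. Qed.

Lemma balance_law_partial N : balance_law f (uN N) (fun p => rate N (shear p)).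
Proof.
have csx : continuous (fun p => slope_x N (shear p)) by exact: c_shear_comp.
have cst_ : continuous (fun p : R * R =>
    1 + slope_t N (shear p) - v p.1 * slope_x N (shear p)).
  have c1 : continuous (fun _ : R * R => 1 : R) by move=> ?; exact: cvg_cst.
  exact: (continuous_subf (continuous_addf c1 (c_shear_comp (@c_slope_t N)))
    (continuous_mulf (continuous_compf cfst cv) csx)).
have := balance_law_classical df cv (@continuous_sheared_partial N) cst_ csx
  (@is_derive_partial_t N) (@is_derive_partial_x N).
apply: balance_law_eq => p; rewrite /rate /sheared_partial /shear /=.
move: (slope_t N _) (slope_x N _) (v _) (v _) => a b c d; lra.
Qed.

Lemma limit_rate_measurable : measurable_fun setT (fun p => limit_rate (shear p)).
Proof.
apply: (measurable_fun_cvg (h := fun N p => rate N (shear p))).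
  by move=> N; apply: mc; exact: (c_shear_comp (@c_rate N)).
by move=> p _; exact: rate_cvg.
Qed.

Lemma limit_rate_le p : `|limit_rate (shear p)| <= 1 + G + G.
Proof.
apply: (cvgr_to_le (cvg_norm (rate_cvg (q := shear p)))).
by apply: nearW => N; exact: rate_le.
Qed.

(** The law of the partial sums passes to the limit in each of its three integrals by dominated
    convergence on the support of [phi]. *)
Lemma balance_law_sheared_sum : balance_law f u (fun p => limit_rate (shear p)).
Proof.
move=> phi tf; have [M M0 supp] := test_function_support tf.
have [/(_ 1%N)[cphi d1 d2 cdt cdx] _] := tf; simpl in cdt, cdx.
have out p : ~ box M p -> [/\ phi p = 0, dt phi p = 0 & dx phi p = 0].
  by move=> h; apply: supp; left.
have [Cp HCp] := continuous_bounded_in_box cphi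
  (fun p h => let: And3 a _ _ := out p h in a).
have [Ct HCt] := continuous_bounded_in_box cdt
  (fun p h => let: And3 _ a _ := out p h in a).
have [Cx HCx] := continuous_bounded_in_box cdx
  (fun p h => let: And3 _ _ a := out p h in a).
have ccvg p : uN N p @[N --> \oo] --> u p.
  by apply: cvgD; [exact: cvg_cst|exact: (partial_sum_cvg term_le)].
(* The single active term has size at most 1, which gives a bound uniform in [N], and so a bound on
   [f (uN N p)] by compactness. *)
have uN_le N p : box M p -> `|uN N p| <= M + 2.
  move=> [] /=; rewrite in_itv/= -ler_norml => h _.
  apply: le_trans (ler_normD _ _) _; apply: lerD => //.
  have := total_sum_tail term_le 0 (shear p); have := total_sum_tail term_le N (shear p).
  have [/idle[-> _ _] _ _|[k [kN _ /(solo kN)[-> _ _]] _ _]] := active N (shear p).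
    by rewrite normr0.
  apply: le_trans (term_le _ _) _; apply: (@le_trans _ _ 1); last by rewrite ler1n.
  by apply: exprn_ile1; rewrite ?invr_ge0// invf_le1// ler1n.
have [Cf HCf] : exists C, forall y, `[- (M + 2), M + 2]%classic y -> `|f y| <= C.
  by apply: continuous_bounded_on_compact => //; exact: segment_compact.
have lim1 : \int[@leb2 R]_p (uN N p * dt phi p) @[N --> \oo] -->
    \int[@leb2 R]_p (u p * dt phi p).
  apply: (@Rintegral_bounded_cvg _ _ _ M ((M + 2) * Ct)).
  - move=> N; apply: mc.
    exact: (continuous_mulf (@continuous_sheared_partial N) cdt).
  - move=> N p; have [bp|/out[_ -> _]] := pselect (box M p).
      by rewrite normrM ler_pM// uN_le.
    rewrite mulr0 normr0 mulr_ge0 ?addr_ge0// ?(ltW M0)//.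
    exact: le_trans (normr_ge0 _) (HCt p).
  - by move=> N p /out[_ -> _]; rewrite mulr0.
  - by move=> p; apply: cvgM; [exact: ccvg|exact: cvg_cst].
have lim2 : \int[@leb2 R]_p (f (uN N p) * dx phi p) @[N --> \oo] -->
    \int[@leb2 R]_p (f (u p) * dx phi p).
  have Cf0 : 0 <= Cf.
    apply: le_trans (normr_ge0 _) (HCf 0 _).
    by rewrite /= in_itv/= oppr_le0 !addr_ge0 ?(ltW M0).
  apply: (@Rintegral_bounded_cvg _ _ _ M (Cf * Cx)).
  - move=> N; apply: mc.
    exact: (continuous_mulf (continuous_compf (@continuous_sheared_partial N) cf) cdx).
  - move=> N p; have [bp|/out[_ _ ->]] := pselect (box M p).
      rewrite normrM ler_pM// HCf//=.
      by rewrite in_itv/= -ler_norml uN_le.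
    rewrite mulr0 normr0 mulr_ge0//.
    exact: le_trans (normr_ge0 _) (HCx p).
  - by move=> N p /out[_ _ ->]; rewrite mulr0.
  - move=> p; apply: cvgM; last exact: cvg_cst.
    apply: (@cvg_comp _ _ _ (fun N => uN N p) f _ (nbhs (u p))); first exact: ccvg.
    exact: cf.
have lim3 : \int[@leb2 R]_p (rate N (shear p) * phi p) @[N --> \oo] -->
    \int[@leb2 R]_p (limit_rate (shear p) * phi p).
  have G0 : 0 <= 1 + G + G := le_trans (normr_ge0 _) (rate_le 0 (0, 0)).
  apply: (@Rintegral_bounded_cvg _ _ _ M ((1 + G + G) * Cp)).
  - move=> N; apply: mc.
    exact: (continuous_mulf (c_shear_comp (@c_rate N)) cphi).
  - by move=> N p; rewrite normrM ler_pM// rate_le.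
  - by move=> N p /out[-> _ _]; rewrite mulr0.
  - by move=> p; apply: cvgM; [exact: rate_cvg|exact: cvg_cst].
have E N : - (\int[@leb2 R]_p (uN N p * dt phi p)) -
    \int[@leb2 R]_p (f (uN N p) * dx phi p) =
    \int[@leb2 R]_p (rate N (shear p) * phi p).
  exact: (@balance_law_partial N phi tf).
have := cvg_opp_sub_eq lim1 lim2 lim3 E; exact.
Qed.

End ShearedPerturbation.

(** * Scales, periodic bumps and cut-offs *)

Section Scales.
Variable R : realType.
Implicit Types n m : nat.

(** The exponent 8 leaves room in a cell for all the multiples of [gap n] used below, and keeps the
    measure lost in the core below one half. *)
Definition gap n : R := 2^-1 ^+ (n + 8).

Fixpoint period n : R := if n is m.+1 then gap m * period m / 4 else 1.

(* Steepness of the flux on the gaps of level [n].  The power makes the space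
   period below negligible with respect to any power of [period n]. *)
Fixpoint steep n : R := if n is m.+1 then
  steep m * gap m ^+ 4 * period m ^+ 2 * period n ^+ n / 32 else 1.

Definition width n : R := gap n ^+ 3 * period n ^+ 2 * steep n.

Lemma gap_gt0 n : 0 < gap n.
Proof. by rewrite exprn_gt0 ?invr_gt0. Qed.

Lemma gap_S n : gap n.+1 = gap n / 2.
Proof. by rewrite /gap addSn exprS mulrC. Qed.

Lemma gap_le n : gap n <= 256^-1.
Proof.
have g0 : gap 0 = 256^-1 :> R by rewrite /gap !exprS expr0; lra.
elim: n => [|n IH]; first by rewrite g0.
rewrite gap_S; have := gap_gt0 n; lra.
Qed.

Lemma period_gt0 n : 0 < period n.
Proof. by elim: n => //= n IH; rewrite divr_gt0// mulr_gt0// gap_gt0. Qed.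

Lemma period_S n : period n.+1 = gap n * period n / 4.
Proof. by []. Qed.

Lemma period_half n : period n.+1 <= period n / 1024.
Proof.
have := period_gt0 n; have := gap_gt0 n; have := gap_le n.
rewrite period_S; nra.
Qed.

Lemma period_le1 n : period n <= 1.
Proof.
elim: n => // n IH; have := period_half n; have := period_gt0 n; lra.
Qed.

Lemma period_le n : period n <= 2^-1 ^+ (n.*2).
Proof.
elim: n => // n IH; rewrite doubleS !exprS.
have := period_half n; have := period_gt0 n; lra.
Qed.

Lemma period_mono m n : (m <= n)%N -> period n <= period m.
Proof.
elim: n => [|n IH]; first by rewrite leqn0 => /eqP ->.
rewrite leq_eqVlt => /predU1P[->//|]; rewrite ltnS => /IH.
have := period_half n; have := period_gt0 n; lra.
Qed.

Lemma period_gap m n : (m < n)%N -> 4 * period n <= gap m * period m.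
Proof. move=> /period_mono; rewrite period_S; lra. Qed.

Lemma steep_gt0 n : 0 < steep n.
Proof.
elim: n => // n IH; have -> : steep n.+1 =
  steep n * gap n ^+ 4 * period n ^+ 2 * period n.+1 ^+ n.+1 / 32 by [].
rewrite divr_gt0// mulr_gt0 ?exprn_gt0 ?period_gt0//.
by rewrite mulr_gt0 ?exprn_gt0 ?period_gt0// mulr_gt0 ?exprn_gt0 ?gap_gt0.
Qed.

Lemma width_gt0 n : 0 < width n.
Proof.
by rewrite /width mulr_gt0 ?steep_gt0// mulr_gt0// exprn_gt0 ?gap_gt0 ?period_gt0.
Qed.

Lemma steep_S n : steep n.+1 = gap n * width n * period n.+1 ^+ n.+1 / 32.
Proof. rewrite /width [in LHS]/=; ring. Qed.

Lemma pow_period_le1 n k : 0 <= period n ^+ k <= 1.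
Proof.
have p0 := ltW (period_gt0 n); apply/andP; split; first exact: exprn_ge0.
by apply: exprn_ile1 => //; exact: period_le1.
Qed.

Lemma width_le_steep n : width n <= steep n.
Proof.
have s0 := steep_gt0 n; have g0 := gap_gt0 n; have g1 := gap_le n.
have /andP[p0 p1] := pow_period_le1 n 2.
rewrite /width -[leRHS]mul1r ler_wpM2r ?(ltW s0)//.
apply: mulr_ile1 => //; first exact: exprn_ge0 (ltW g0).
by apply: exprn_ile1; [exact: ltW|lra].
Qed.

Lemma steep_S_le n : steep n.+1 <= gap n * width n / 32.
Proof.
rewrite steep_S ler_pM2r ?invr_gt0//.
have /andP[p0 p1] := pow_period_le1 n.+1 n.+1.
by rewrite ler_piMr// mulr_ge0// ltW// ?gap_gt0// width_gt0.
Qed.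

Lemma steep_half n : steep n.+1 <= steep n / 2.
Proof.
have h := steep_S_le n; have h1 := width_le_steep n; have := width_gt0 n.
have := gap_gt0 n; have := gap_le n; nra.
Qed.

Lemma steep_mono m n : (m <= n)%N -> steep n <= steep m.
Proof.
elim: n => [|n IH]; first by rewrite leqn0 => /eqP ->.
rewrite leq_eqVlt => /predU1P[->//|]; rewrite ltnS => /IH.
have := steep_half n; have := steep_gt0 n; lra.
Qed.

Lemma steep_le n : steep n <= 2^-1 ^+ n.
Proof.
elim: n => // n IH; rewrite exprS; have := steep_half n; lra.
Qed.

(** The factor [period n ^+ n] built into [steep n] is inherited by the width. It defeats every
    Hoelder exponent. *)
Lemma width_le_power n : width n <= period n ^+ n.
Proof.
apply: le_trans (width_le_steep n) _.
case: n => [|n]; first by rewrite expr0.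
rewrite steep_S; have /andP[p0 p1] := pow_period_le1 n.+1 n.+1.
have h1 := width_le_steep n; have h2 := steep_le n.
have h3 : (2^-1 : R) ^+ n <= 1 by apply: exprn_ile1; rewrite ?invr_ge0// invf_le1// ler1n.
have := width_gt0 n; have := gap_gt0 n; have := gap_le n => g1 g0 w0.
have gw : gap n * width n <= 1 by nra.
have gw0 : 0 < gap n * width n by rewrite mulr_gt0.
move: (period n.+1 ^+ n.+1) (gap n * width n) p0 gw gw0 => a b; nra.
Qed.

Lemma width_S n : width n.+1 <= gap n * width n / 32.
Proof. exact: le_trans (width_le_steep _) (steep_S_le n). Qed.

Lemma width_mono m n : (m <= n)%N -> width n <= width m.
Proof.
elim: n => [|n IH]; first by rewrite leqn0 => /eqP ->.
rewrite leq_eqVlt => /predU1P[->//|]; rewrite ltnS => /IH.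
have := width_S n; have := width_gt0 n; have := gap_gt0 n; have := gap_le n; nra.
Qed.

Lemma width_gap m n : (m < n)%N -> 32 * width n <= gap m * width m.
Proof. by move=> /width_mono; have := width_S m; lra. Qed.

End Scales.

Arguments steep : simpl never.
Arguments period : simpl never.

Section CriticalPoints.
Variable R : realType.
Implicit Types f g : R -> R.

(** A zero of a nonnegative function is a minimum. This gives the criticality of the waves without
    inspecting the formulas of their derivatives. *)
Lemma class_C1_critical f (f' : R -> R) x : class_C1 f f' -> (forall y, 0 <= f y) ->
  f x = 0 -> f' x = 0.
Proof.
move=> [df _] f0 fx0.
have xin : x \in `](x - 1), (x + 1)[%R.
  by rewrite in_itv/= ltrBlDr ltrDl ltr01.
have H : is_derive x 1 f 0.
  have ab : x - 1 <= x + 1 by lra.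
  have dfy y : y \in `](x - 1), (x + 1)[%R -> derivable f y 1.
    by move=> _; have [] := df y.
  by apply: (derive1_at_min ab dfy xin) => y _; rewrite fx0.
by have [_ <-] := df x; have [_ ->] := H.
Qed.

Lemma class_C1_onem f (f' : R -> R) : class_C1 f f' ->
  class_C1 (fun x => 1 - f x) (fun x => - f' x).
Proof.
move=> F; have := class_C1D (class_C1_cst 1) (class_C1_scale (- 1) F).
have -> : (fun x : R => 1 + -1 * f x) = (fun x => 1 - f x).
  by apply/funext => x; rewrite mulN1r.
have -> : (fun x : R => 0 + -1 * f' x) = (fun x => - f' x).
  by apply/funext => x; rewrite mulN1r add0r.
by [].
Qed.

End CriticalPoints.

Section PeriodicBumps.
Variable R : realType.
Implicit Types x y P : R.

Definition pbump l l' r' r P : R -> R := periodize (bump l l' r' r) P.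
Definition dpbump l l' r' r P x : R := P^-1 * periodize (dbump l l' r' r) P x.

Variables l l' r' r P : R.
Hypotheses (l0 : 0 < l) (ll' : l < l') (lr' : l' <= r') (rr' : r' < r) (r1 : r < 1).
Hypothesis P0 : 0 < P.

Let edge : bump l l' r' r 0 = bump l l' r' r 1.
Proof. by rewrite !bump_eq0//; [right|left]; exact: ltW. Qed.

Lemma pbump_cell (j : int) y : 0 <= y <= 1 ->
  pbump l l' r' r P ((j%:~R + y) * P) = bump l l' r' r y.
Proof. by move=> y01; apply: periodize_cell. Qed.

Lemma pbump_bounds x : 0 <= pbump l l' r' r P x <= 1.
Proof. exact: bump_bounds. Qed.

Lemma class_C1_pbump : class_C1 (pbump l l' r' r P) (dpbump l l' r' r P).
Proof.
have out y : y <= l \/ r <= y -> bump l l' r' r y = 0 by exact: bump_eq0.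
apply: (class_C1_periodize P0 l0 _ r1 out); last exact: class_C1_bump.
  by apply: lt_trans ll' _; apply: le_lt_trans lr' _.
move=> y /out; apply: class_C1_critical (class_C1_bump _ _ _ _) _ => z.
by have /andP[] := bump_bounds l l' r' r z.
Qed.

Lemma dpbump_le d x : 0 < d -> d <= l' - l -> d <= r - r' ->
  `|dpbump l l' r' r P x| <= 4 / (d * P).
Proof.
move=> d0 d1 d2; rewrite normrM ger0_norm ?invr_ge0 ?(ltW P0)//.
have -> : 4 / (d * P) = P^-1 * (4 / d) by rewrite invfM mulrA mulrC.
rewrite ler_pM2l ?invr_gt0//.
exact: dbump_le.
Qed.

Lemma pbump_neq0 x : pbump l l' r' r P x != 0 ->
  exists (j : int) y, l < y < r /\ x = (j%:~R + y) * P.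
Proof.
have [j [y [/andP[y0 y1] ->]]] := cell_decomposition x P0.
rewrite pbump_cell ?y0 ?ltW// => /(bump_neq0 ll' rr') h.
by exists j, y.
Qed.

Lemma pbump_onem_neq0 x j y : 0 <= y <= 1 -> x = (j%:~R + y) * P ->
  1 - pbump l l' r' r P x != 0 -> y < l' \/ r' < y.
Proof.
move=> y01 ->; rewrite pbump_cell// => h.
have [|yl] := ltP y l'; first by left.
have [|yr] := ltP r' y; first by right.
by rewrite bump_eq1 ?subrr ?eqxx// ?yl// in h.
Qed.

End PeriodicBumps.

(** * Products of the cut-offs of all lower levels *)

Section CutProducts.
Variable R : realType.
Variables (cut dcut : nat -> R -> R) (scale : nat -> R).
Hypothesis scale_gt0 : forall n, 0 < scale n.
Hypothesis scale_S : forall n, 4 * scale n.+1 <= gap R n * scale n.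
Hypothesis cutC : forall n, class_C1 (cut n) (dcut n).
Hypothesis cut01 : forall n x, 0 <= cut n x <= 1.
Hypothesis dcut_le : forall n x, `|dcut n x| <= 8 / (gap R n * scale n).

Fixpoint cutprod n x : R := if n is m.+1 then cutprod m x * cut m x else 1.
Fixpoint dcutprod n x : R :=
  if n is m.+1 then dcutprod m x * cut m x + cutprod m x * dcut m x else 0.

Lemma class_C1_cutprod n : class_C1 (cutprod n) (dcutprod n).
Proof. by elim: n => [|n IH]; [exact: class_C1_cst|exact: class_C1M]. Qed.

Lemma cutprod_bounds n x : 0 <= cutprod n x <= 1.
Proof.
elim: n => [|n /andP[IH0 IH1]] /=; first by rewrite ler01 lexx.
by have /andP[c0 c1] := cut01 n x; rewrite mulr_ge0// mulr_ile1.
Qed.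

(** The finest factor dominates: by induction the derivative is at most
    [4 / scale n + 8 / (gap n * scale n)], hence at most [16 / (gap n * scale n)], and [scale_S]
    turns this into [4 / scale n.+1]. *)
Lemma dcutprod_le n x : `|dcutprod n x| <= 4 / scale n.
Proof.
elim: n => [|n IH] /=; first by rewrite normr0 divr_ge0// ltW.
have s0 := scale_gt0 n; have g0 := gap_gt0 R n; have g1 := gap_le R n.
have /andP[c0 c1] := cut01 n x; have /andP[p0 p1] := cutprod_bounds n x.
apply: (@le_trans _ _ (4 / scale n + 8 / (gap R n * scale n))).
  apply: le_trans (ler_normD _ _) _; rewrite !normrM; apply: lerD.
    rewrite (ger0_norm c0); apply: le_trans (ler_piMr _ c1) IH.
    exact: normr_ge0.
  rewrite (ger0_norm p0); apply: le_trans (ler_piMl _ p1) (dcut_le n x).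
  exact: normr_ge0.
have gs : 0 < gap R n * scale n by rewrite mulr_gt0.
apply: (@le_trans _ _ (16 / (gap R n * scale n))).
  have -> : 4 / scale n = 4 * gap R n / (gap R n * scale n).
    by field; rewrite !gt_eqF.
  rewrite -mulrDl ler_pM2r ?invr_gt0//; lra.
rewrite ler_pdivrMr// mulrAC ler_pdivlMr//; have := scale_S n; lra.
Qed.

Lemma cutprod_neq0 n x m : cutprod n x != 0 -> (m < n)%N -> cut m x != 0.
Proof.
elim: n => // n IH /=; rewrite mulf_eq0 negb_or => /andP[h1 h2].
by rewrite ltnS leq_eqVlt => /predU1P[->//|]; exact: IH.
Qed.

Lemma cutprod_eq1 n x : (forall m, (m < n)%N -> cut m x = 1) -> cutprod n x = 1.
Proof.
elim: n => // n IH H /=; rewrite H// IH ?mulr1// => m mn.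
by apply: H; exact: ltnW.
Qed.

Lemma cutprod_eq0 n x m : (m < n)%N -> cut m x = 0 -> cutprod n x = 0.
Proof.
move=> mn c0; apply/eqP; apply: contraT => /cutprod_neq0/(_ mn).
by rewrite c0 eqxx.
Qed.

End CutProducts.

(** * The flux *)

Section Construction.
Variable R : realType.
Local Notation e := (gap R).
Local Notation T := (period R).
Local Notation b := (width R).
Local Notation lam := (steep R).
Implicit Types (n m k : nat) (t x s y z : R).

Ltac gap_lra n := have := gap_gt0 R n; have := gap_le R n; lra.

(** Layout of one cell, in units of [e n]. In time: [push] lives on [[4, 6]], inside the plateau
    [[3, 6]] of [kink], whose support [[2, 7]] is inside the plateau [[1, 8]] of [hole_t] with
    margin 1. In space: [lane] vanishes up to 4 and is 1 from 5 on, so displaced points stop between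
    4 and 5; a drift of 1 keeps them in the plateau [[3, 7]] of [shoulder], whose support [[2, 8]]
    is the plateau of [hole_x]. Both holes end at 9. *)
Definition kink n := pbump (2 * e n) (3 * e n) (6 * e n) (7 * e n) (T n).
Definition push n := pbump (4 * e n) (9 / 2 * e n) (11 / 2 * e n) (6 * e n) (T n).
Definition dpush n := dpbump (4 * e n) (9 / 2 * e n) (11 / 2 * e n) (6 * e n) (T n).
Definition rise n := pbump (1 / 4) (3 / 8) (5 / 8) (3 / 4) (T n).
Definition drise n := dpbump (1 / 4) (3 / 8) (5 / 8) (3 / 4) (T n).
Definition hole_t n := pbump (e n / 2) (e n) (8 * e n) (9 * e n) (T n).
Definition dhole_t n := dpbump (e n / 2) (e n) (8 * e n) (9 * e n) (T n).
Definition lane n := pbump (4 * e n) (5 * e n) (1 - 5 * e n) (1 - 4 * e n) (b n).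
Definition dlane n := dpbump (4 * e n) (5 * e n) (1 - 5 * e n) (1 - 4 * e n) (b n).
Definition shoulder n := pbump (2 * e n) (3 * e n) (7 * e n) (8 * e n) (b n).
Definition dshoulder n := dpbump (2 * e n) (3 * e n) (7 * e n) (8 * e n) (b n).
Definition hole_x n := pbump (e n) (2 * e n) (8 * e n) (9 * e n) (b n).
Definition dhole_x n := dpbump (e n) (2 * e n) (8 * e n) (9 * e n) (b n).

Definition cut_t n t := 1 - hole_t n t.
Definition cut_x n x := 1 - hole_x n x.
(** These factors switch off the waves of level [n] on the holes of all lower levels. *)
Definition CT := cutprod cut_t.
Definition dCT := dcutprod cut_t (fun n t => - dhole_t n t).
Definition CX := cutprod cut_x.
Definition dCX := dcutprod cut_x (fun n x => - dhole_x n x).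

(** Measures [s] in the cell of a known point; the new coordinate is the old one plus the
    displacement divided by the period. *)
Lemma cell_shift P (j : int) y s : 0 < P ->
  s = (j%:~R + (y + (s - (j%:~R + y) * P) / P)) * P.
Proof. by move=> P0; field; rewrite gt_eqF. Qed.

Lemma kink_bounds n y : 0 <= kink n y <= 1.
Proof. by apply: pbump_bounds; gap_lra n. Qed.

Lemma kink_neq0 n s : kink n s != 0 ->
  exists (j : int) y, 2 * e n < y < 7 * e n /\ s = (j%:~R + y) * T n.
Proof. by apply: pbump_neq0; [gap_lra n..|exact: period_gt0]. Qed.

Lemma kink_eq1 n (j : int) y : 3 * e n <= y <= 6 * e n ->
  kink n ((j%:~R + y) * T n) = 1.
Proof.
move=> /andP[y0 y1].
have y01 : 0 <= y <= 1 by apply/andP; split; gap_lra n.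
rewrite /kink pbump_cell//; try (exact: period_gt0); try by gap_lra n.
by rewrite bump_eq1 ?y0//; gap_lra n.
Qed.

Lemma continuous_kink n : continuous (kink n).
Proof.
have H : class_C1 (kink n)
    (dpbump (2 * e n) (3 * e n) (6 * e n) (7 * e n) (T n)).
  by apply: class_C1_pbump; [gap_lra n..|exact: period_gt0].
exact: class_C1_continuous H.
Qed.

Definition kinks n y := lam n * kink n y.
Definition flux'' := total_sum kinks.

Lemma kinks_le n y : `|kinks n y| <= 2^-1 ^+ n.
Proof.
have /andP[k0 k1] := kink_bounds n y; have l0 := ltW (steep_gt0 R n).
rewrite /kinks (ger0_norm (mulr_ge0 l0 k0)).
apply: (le_trans _ (steep_le R n)).
exact: ler_piMr.
Qed.

Lemma continuous_flux'' : continuous flux''.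
Proof.
apply: continuous_total_sum; first exact: kinks_le.
move=> n; apply: continuous_mulf; last exact: continuous_kink.
by move=> y; exact: cvg_cst.
Qed.

Lemma kinks_ge0 n y : 0 <= kinks n y.
Proof.
have /andP[k0 _] := kink_bounds n y.
exact: mulr_ge0 (ltW (steep_gt0 R n)) k0.
Qed.

Lemma flux''_ge n y : lam n * kink n y <= flux'' y.
Proof.
apply: (cvgr_to_ge (partial_sum_cvg kinks_le (p := y))).
near=> N; rewrite /partial_sum.
have nN : (n < N)%N by near: N; exact: nbhs_infty_gt.
rewrite big_mkord (bigD1 (Ordinal nN))//= lerDl.
by apply: sumr_ge0 => i _; exact: kinks_ge0.
Unshelve. all: by end_near. Qed.

Lemma flux''_ge0 y : 0 <= flux'' y.
Proof. exact: le_trans (kinks_ge0 0 y) (flux''_ge 0 y). Qed.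

Lemma steep_tail n k : \sum_(n <= i < n + k) lam i <= 2 * lam n - 2 * lam (n + k).
Proof.
elim: k => [|k IH]; first by rewrite addn0 big_geq// subrr.
rewrite addnS big_nat_recr ?leq_addr//.
by move: (steep_half R (n + k)) IH; move: (steep R (n + k).+1) => a; rewrite /=; lra.
Qed.

(** The steepness at least halves from level to level, so a tail is at most twice its first term. *)
Lemma flux''_le n y : (forall m, (m < n)%N -> kink m y = 0) -> flux'' y <= 2 * lam n.
Proof.
move=> k0; apply: (cvgr_to_le (partial_sum_cvg kinks_le (p := y))).
near=> N; rewrite /partial_sum.
have nN : (n <= N)%N by near: N; exact: nbhs_infty_ge.
rewrite (big_cat_nat (leq0n n) nN)/= big_nat_cond big1 ?add0r; last first.
  by move=> m /andP[/andP[_ mn] _]; rewrite /kinks k0 ?mulr0.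
apply: (@le_trans _ _ (\sum_(n <= i < N) lam i)).
  apply: ler_sum => i _; have /andP[_ k1] := kink_bounds i y.
  by apply: ler_piMr => //; exact: ltW (steep_gt0 R i).
rewrite -(subnKC nN); apply: le_trans (steep_tail _ _) _.
have := steep_gt0 R (n + (N - n)); lra.
Unshelve. all: by end_near. Qed.

Definition speed := antiderivative flux''.
Definition flux := antiderivative speed.

Lemma is_derive_speed y : is_derive y 1 speed (flux'' y).
Proof. exact: is_derive_antiderivative continuous_flux'' y. Qed.

Lemma continuous_speed : continuous speed.
Proof. by move=> y; exact: is_derive_continuous (is_derive_speed y). Qed.

Lemma is_derive_flux y : is_derive y 1 flux (speed y).
Proof. exact: is_derive_antiderivative continuous_speed y. Qed.

Lemma continuous_flux : continuous flux.
Proof. by move=> y; exact: is_derive_continuous (is_derive_flux y). Qed.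

Lemma flux_derivative : flux^`() = speed.
Proof.
by apply/funext => y; rewrite derive1E; have [_ ->] := is_derive_flux y.
Qed.

Lemma speed_derivative : speed^`() = flux''.
Proof.
by apply/funext => y; rewrite derive1E; have [_ ->] := is_derive_speed y.
Qed.

Lemma classC2_flux : classC2 flux.
Proof.
split.
- by move=> y; have [] := is_derive_flux y.
- by rewrite flux_derivative => y; have [] := is_derive_speed y.
- rewrite derive1nS derive1n1 flux_derivative speed_derivative.
  exact: continuous_flux''.
Qed.

Lemma speed_increment (y z m M : R) : y <= z ->
  (forall s, y < s < z -> m <= flux'' s <= M) ->
  m * (z - y) <= speed z - speed y <= M * (z - y).
Proof.
move=> yz H; apply: (@MVT_bounds R speed flux'') => //.
  exact: continuous_subspaceT continuous_speed.
by move=> s _; exact: is_derive_speed.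
Qed.

Lemma speed_increment_ge (y z m : R) : y <= z ->
  (forall s, y < s < z -> m <= flux'' s) -> m * (z - y) <= speed z - speed y.
Proof.
move=> yz H; have [<-|[c cyz ->]] := MVT_cc yz
  (continuous_subspaceT continuous_speed) (fun s _ => is_derive_speed s).
  by rewrite !subrr mulr0.
by rewrite ler_wpM2r ?subr_ge0// H.
Qed.

Lemma speed_le y z : y <= z -> speed y <= speed z.
Proof.
move=> yz; rewrite -subr_ge0 -[leLHS](mul0r (z - y)).
by apply: speed_increment_ge => // s _; exact: flux''_ge0.
Qed.

(** Every interval contains the plateau of some [kink N], where [flux''] is at least [lam N > 0]. *)
Lemma speed_lt y z : y < z -> speed y < speed z.
Proof.
move=> yz.
have zy : 0 < (z - y) / 2 by rewrite divr_gt0// subr_gt0.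
have [N HN] := half_power_small zy.
have TN : T N <= (z - y) / 2.
  apply: le_trans (period_le R N) (le_trans _ (ltW HN)).
  by rewrite ler_wiXn2l ?invr_ge0// ?invf_le1// ?ler1n// -addnn leq_addr.
have T0 := period_gt0 R N.
have [j [r [/andP[r0 r1] yE]]] := cell_decomposition y T0.
have g0 := gap_gt0 R N; have g1 := gap_le R N.
(* The plateau in the cell after that of [y]. It ends before [y + 2 * T N], hence before [z]. *)
pose s1 := ((j + 1)%:~R + 3 * e N) * T N.
pose s2 := ((j + 1)%:~R + 6 * e N) * T N.
have s1E : s1 = y + (1 - r + 3 * e N) * T N by rewrite /s1 yE intrD mulr1z; ring.
have s2E : s2 = s1 + 3 * e N * T N by rewrite /s1 /s2; ring.
have ys1 : y <= s1.
  by rewrite s1E lerDl mulr_ge0 ?(ltW T0)//; lra.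
have s12 : s1 < s2 by rewrite s2E ltrDl !mulr_gt0.
have s2z : s2 <= z.
  have h : (1 - r + 6 * e N) * T N <= 2 * T N by rewrite ler_pM2r//; lra.
  have -> : s2 = y + (1 - r + 6 * e N) * T N by rewrite s2E s1E; ring.
  lra.
apply: le_lt_trans (speed_le ys1) _; apply: (lt_le_trans _ (speed_le s2z)).
rewrite -subr_gt0.
apply: (@lt_le_trans _ _ (lam N * (s2 - s1))).
  by rewrite mulr_gt0 ?steep_gt0// subr_gt0.
apply: speed_increment_ge; first exact: ltW.
move=> s /andP[h1 h2]; apply: (le_trans _ (flux''_ge N s)).
rewrite (cell_shift (j + 1) 0 s T0) kink_eq1 ?mulr1// add0r addr0.
rewrite ler_pdivlMr// ler_pdivrMr//; move: h1 h2; rewrite /s1 /s2.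
by move=> h1 h2; apply/andP; split; lra.
Qed.

Lemma strictly_convex_flux : strictly_convex flux.
Proof.
have main a c s : a < c -> 0 < s < 1 ->
    flux (s * a + (1 - s) * c) < s * flux a + (1 - s) * flux c.
  move=> ac /andP[s0 s1]; set m := s * a + (1 - s) * c.
  have mE : m = s * a + (1 - s) * c by [].
  have am : a < m by rewrite mE; nra.
  have mc : m < c by rewrite mE; nra.
  have sub := continuous_subspaceT continuous_flux.
  (* The mean value theorem on the two sides of [m] gives slopes at [p < m < q], which are strictly
     ordered by [speed_lt]. *)
  have [E|[p /andP[_ pm] Ep]] := MVT_cc (ltW am) (sub _) (fun y _ => is_derive_flux y).
    by rewrite E ltxx in am.
  have [E|[q /andP[mq _] Eq]] := MVT_cc (ltW mc) (sub _) (fun y _ => is_derive_flux y).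
    by rewrite E ltxx in mc.
  have pq : speed p < speed q by apply: speed_lt; lra.
  have h : s * (1 - s) * (c - a) * speed p < s * (1 - s) * (c - a) * speed q.
    by rewrite ltr_pM2l// !mulr_gt0// subr_gt0.
  have E1 : m - a = (1 - s) * (c - a) by rewrite mE; ring.
  have E2 : c - m = s * (c - a) by rewrite mE; ring.
  rewrite E1 in Ep; rewrite E2 in Eq.
  have -> : flux a = flux m - speed p * ((1 - s) * (c - a)) by rewrite -Ep; ring.
  have -> : flux c = flux m + speed q * (s * (c - a)) by rewrite -Eq; ring.
  rewrite -subr_gt0.
  have -> : s * (flux m - speed p * ((1 - s) * (c - a))) +
    (1 - s) * (flux m + speed q * (s * (c - a))) - flux m =
    s * (1 - s) * (c - a) * speed q - s * (1 - s) * (c - a) * speed p by ring.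
  by rewrite subr_gt0.
move=> a c s; rewrite neq_lt => /orP[ac|ca]; first exact: main.
move=> /andP[s0 s1].
have := @main c a (1 - s) ca; rewrite subKr [s * a + _]addrC [s * flux a + _]addrC.
by apply; rewrite subr_gt0 s1 ltrBlDr ltrDl.
Qed.

(** * Estimates for the cut-offs, and steepness at times that survive them *)

Lemma cut_tC n : class_C1 (cut_t n) (fun t => - dhole_t n t).
Proof.
by apply: class_C1_onem; apply: class_C1_pbump; [gap_lra n..|exact: period_gt0].
Qed.

Lemma cut_xC n : class_C1 (cut_x n) (fun x => - dhole_x n x).
Proof.
by apply: class_C1_onem; apply: class_C1_pbump; [gap_lra n..|exact: width_gt0].
Qed.

Lemma cut_t01 n t : 0 <= cut_t n t <= 1.
Proof.
have /andP[h0 h1] := @pbump_bounds R (e n / 2) (e n) (8 * e n) (9 * e n) (T n) t.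
by rewrite /cut_t subr_ge0 h1 lerBlDr lerDl h0.
Qed.

Lemma cut_x01 n x : 0 <= cut_x n x <= 1.
Proof.
have /andP[h0 h1] := @pbump_bounds R (e n) (2 * e n) (8 * e n) (9 * e n) (b n) x.
by rewrite /cut_x subr_ge0 h1 lerBlDr lerDl h0.
Qed.

Lemma dcut_t_le n t : `|- dhole_t n t| <= 8 / (e n * T n).
Proof.
have g0 := gap_gt0 R n; have T0 := period_gt0 R n; have g1 := gap_le R n.
rewrite normrN.
have -> : 8 / (e n * T n) = 4 / (e n / 2 * T n).
  by field; rewrite !gt_eqF.
by apply: dpbump_le => //; lra.
Qed.

Lemma dcut_x_le n x : `|- dhole_x n x| <= 8 / (e n * b n).
Proof.
have g0 := gap_gt0 R n; have b0 := width_gt0 R n; have g1 := gap_le R n.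
rewrite normrN; apply: (@le_trans _ _ (4 / (e n * b n))).
  by apply: dpbump_le => //; lra.
have h : 0 <= (e n * b n)^-1 by rewrite invr_ge0 mulr_ge0// ltW.
by apply: (ler_wpM2r h); lra.
Qed.

Lemma period_scale n : 4 * T n.+1 <= e n * T n.
Proof. exact: period_gap. Qed.

Lemma width_scale n : 4 * b n.+1 <= e n * b n.
Proof. have := @width_gap R n n.+1 (ltnSn n); have := width_gt0 R n.+1; lra. Qed.

Lemma CT_bounds n t : 0 <= CT n t <= 1.
Proof. exact: cutprod_bounds cut_t01 n t. Qed.

Lemma CX_bounds n x : 0 <= CX n x <= 1.
Proof. exact: cutprod_bounds cut_x01 n x. Qed.

Lemma dCT_le n t : `|dCT n t| <= 4 / T n.
Proof.
exact: (dcutprod_le (@period_gt0 R) period_scale cut_t01 dcut_t_le).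
Qed.

Lemma dCX_le n x : `|dCX n x| <= 4 / b n.
Proof.
exact: (dcutprod_le (@width_gt0 R) width_scale cut_x01 dcut_x_le).
Qed.

Lemma class_C1_CT n : class_C1 (CT n) (dCT n).
Proof. exact: class_C1_cutprod cut_tC n. Qed.

Lemma class_C1_CX n : class_C1 (CX n) (dCX n).
Proof. exact: class_C1_cutprod cut_xC n. Qed.

(* The margin between [kink] and [hole_t]: times that survive the cut at level
   [m] are at distance at least [e m * T m] from the support of [kink m]. *)
Lemma kink_far m t s : cut_t m t != 0 -> `|s - t| <= e m * T m -> kink m s = 0.
Proof.
move=> ct st; apply/eqP; apply: contraT => /kink_neq0[j [y [/andP[y0 y1] sE]]].
have T0 := period_gt0 R m; have g0 := gap_gt0 R m; have g1 := gap_le R m.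
pose d := (t - (j%:~R + y) * T m) / T m.
have dT : `|d| <= e m.
  by rewrite /d -sE normrM normfV (gtr0_norm T0) ler_pdivrMr// distrC.
have tE : t = (j%:~R + (y + d)) * T m by exact: cell_shift.
move: dT; rewrite ler_norml => /andP[d0 d1].
have [] : y + d < e m \/ 8 * e m < y + d.
  by apply: (@pbump_onem_neq0 R (e m / 2) (e m) (8 * e m) (9 * e m) (T m) _ _ _ _ _ t j);
    try (apply/andP; split); try exact: ct; try exact: tE; lra.
all: lra.
Qed.

Lemma flux''_le_near n t s : CT n t != 0 -> `|s - t| <= T n -> flux'' s <= 2 * lam n.
Proof.
move=> ct st; apply: flux''_le => m mn.
apply: (@kink_far m t); first exact: cutprod_neq0 ct mn.
by apply: le_trans st _; have := @period_gap R m n mn; have := period_gt0 R n; lra.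
Qed.

Lemma flux''_le_near_S n t s : CT n t != 0 -> `|s - t| <= T n -> kink n s = 0 ->
  flux'' s <= 2 * lam n.+1.
Proof.
move=> ct st ks; apply: flux''_le => m; rewrite ltnS leq_eqVlt => /predU1P[->//|mn].
apply: (@kink_far m t); first exact: cutprod_neq0 ct mn.
by apply: le_trans st _; have := @period_gap R m n mn; have := period_gt0 R n; lra.
Qed.

Lemma speed_osc t w M : (forall s, `|s - t| <= `|w| -> flux'' s <= M) ->
  `|speed (t + w) - speed t| <= M * `|w|.
Proof.
move=> H; have [w0|w0] := leP 0 w.
  have tw : t <= t + w by rewrite lerDl.
  have Hs s : t < s < t + w -> 0 <= flux'' s <= M.
    move=> /andP[h1 h2]; rewrite flux''_ge0/=; apply: H.
    by rewrite !ger0_norm//; lra.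
  have /andP[h1 h2] := speed_increment tw Hs.
  have E : t + w - t = w by ring.
  rewrite E in h1 h2; rewrite (ger0_norm w0) ger0_norm//.
  by rewrite mul0r in h1.
have tw : t + w <= t by rewrite gerDl ltW.
have Hs s : t + w < s < t -> 0 <= flux'' s <= M.
  move=> /andP[h1 h2]; rewrite flux''_ge0/=; apply: H.
  by rewrite !ltr0_norm//; lra.
have /andP[h1 h2] := speed_increment tw Hs.
have E : t - (t + w) = - w by ring.
rewrite E in h1 h2; rewrite (ltr0_norm w0) distrC ger0_norm//.
by rewrite mul0r in h1.
Qed.

End Construction.

(** * The waves and the solution *)

Section Waves.
Variable R : realType.
Local Notation e := (gap R).
Local Notation T := (period R).
Local Notation b := (width R).
Local Notation lam := (steep R).
Implicit Types (n m k : nat) (t x s y z : R) (o : bool).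

Ltac gap_lra n := have := gap_gt0 R n; have := gap_le R n; lra.

(* Two waves for each level: the pushing one ([o = false]) lives on the time
   gaps of level [n] and displaces characteristics, the rising one
   ([o = true]) lives between the gaps, in the strip where the displaced
   characteristics end up. *)
Definition amplitude o n : R := if o then T n / 8 else - (e n ^+ 2 * T n).
Definition profile_t o n : R -> R := if o then @rise R n else push n.
Definition dprofile_t o n : R -> R := if o then @drise R n else dpush n.
Definition profile_x o n : R -> R := if o then @shoulder R n else lane n.
Definition dprofile_x o n : R -> R := if o then @dshoulder R n else dlane n.

(** Both families are merged into one sequence: index [k] has level [k./2], and its parity selects
    the kind of wave. *)
Definition wave_t k t := amplitude (odd k) k./2 * (profile_t (odd k) k./2 t * CT k./2 t).
Definition dwave_t k t := amplitude (odd k) k./2 *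
  (dprofile_t (odd k) k./2 t * CT k./2 t + profile_t (odd k) k./2 t * dCT k./2 t).
Definition wave_x k x := profile_x (odd k) k./2 x * CX k./2 x.
Definition dwave_x k x :=
  dprofile_x (odd k) k./2 x * CX k./2 x + profile_x (odd k) k./2 x * dCX k./2 x.

Lemma profile_t_bounds o n t : 0 <= profile_t o n t <= 1.
Proof. by case: o; exact: pbump_bounds. Qed.

Lemma profile_x_bounds o n x : 0 <= profile_x o n x <= 1.
Proof. by case: o; exact: pbump_bounds. Qed.

Lemma class_C1_profile_t o n : class_C1 (profile_t o n) (dprofile_t o n).
Proof.
have g0 := gap_gt0 R n; have g1 := gap_le R n; have T0 := period_gt0 R n.
case: o.
  by apply: (@class_C1_pbump R (1 / 4) (3 / 8) (5 / 8) (3 / 4) (T n)) => //; lra.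
by apply: (@class_C1_pbump R (4 * e n) (9 / 2 * e n) (11 / 2 * e n) (6 * e n)
  (T n)) => //; lra.
Qed.

Lemma class_C1_profile_x o n : class_C1 (profile_x o n) (dprofile_x o n).
Proof.
have g0 := gap_gt0 R n; have g1 := gap_le R n; have b0 := width_gt0 R n.
case: o.
  by apply: (@class_C1_pbump R (2 * e n) (3 * e n) (7 * e n) (8 * e n) (b n)) => //;
    lra.
by apply: (@class_C1_pbump R (4 * e n) (5 * e n) (1 - 5 * e n) (1 - 4 * e n) (b n))
  => //; lra.
Qed.

Lemma amplitude_le o n : `|amplitude o n| <= T n / 8.
Proof.
have T0 := period_gt0 R n; have g0 := gap_gt0 R n; have g1 := gap_le R n.
case: o => /=; first by rewrite ger0_norm// divr_ge0// ltW.
rewrite normrN ger0_norm ?mulr_ge0 ?exprn_ge0 ?(ltW T0) ?(ltW g0)// mulrC.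
apply: ler_wpM2l; first exact: ltW.
apply: (@le_trans _ _ (e n)); last by lra.
by rewrite expr2; apply: ler_piMr; lra.
Qed.

Lemma amplitude_dprofile_le o n t : `|amplitude o n| * `|dprofile_t o n t| <= 8.
Proof.
have T0 := period_gt0 R n; have g0 := gap_gt0 R n; have g1 := gap_le R n.
case: o => /=.
  have H : `|drise n t| <= 4 / (1 / 8 * T n).
    by apply: dpbump_le; [lra..|exact: period_gt0|lra|lra|lra].
  rewrite ger0_norm ?divr_ge0 ?(ltW T0)//.
  apply: le_trans (ler_wpM2l _ H) _; first by rewrite divr_ge0 ?(ltW T0).
  have -> : T n / 8 * (4 / (1 / 8 * T n)) = 4 by field; rewrite gt_eqF.
  lra.
have H : `|dpush n t| <= 4 / (e n / 2 * T n).
  by apply: dpbump_le; [lra..|exact: period_gt0|lra|lra|lra].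
have h0 : 0 <= e n ^+ 2 * T n by rewrite mulr_ge0 ?exprn_ge0 ?(ltW T0) ?(ltW g0).
rewrite normrN (ger0_norm h0).
apply: le_trans (ler_wpM2l h0 H) _.
have -> : e n ^+ 2 * T n * (4 / (e n / 2 * T n)) = 8 * e n.
  by field; rewrite !gt_eqF.
lra.
Qed.

Lemma dprofile_x_le o n x : `|dprofile_x o n x| <= 4 / (e n * b n).
Proof.
have b0 := width_gt0 R n; have g0 := gap_gt0 R n; have g1 := gap_le R n.
by case: o; apply: dpbump_le; (try exact: b0); lra.
Qed.

Lemma class_C1_wave_t k : class_C1 (wave_t k) (dwave_t k).
Proof.
apply: class_C1_scale; apply: class_C1M; first exact: class_C1_profile_t.
exact: class_C1_CT.
Qed.

Lemma class_C1_wave_x k : class_C1 (wave_x k) (dwave_x k).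
Proof. exact: class_C1M (class_C1_profile_x _ _) (class_C1_CX _ _). Qed.

Lemma amplitude_neq0 o n : amplitude o n != 0.
Proof.
have T0 := period_gt0 R n; have g0 := gap_gt0 R n.
case: o; first by rewrite gt_eqF// divr_gt0.
by rewrite oppr_eq0 gt_eqF// mulr_gt0// exprn_gt0.
Qed.

Lemma wave_t_critical k t : wave_t k t = 0 -> dwave_t k t = 0.
Proof.
move=> /eqP; rewrite mulf_eq0 (negbTE (amplitude_neq0 _ _)) /= => /eqP w0.
rewrite /dwave_t (class_C1_critical (class_C1M (class_C1_profile_t _ _)
  (class_C1_CT _ _)) _ w0) ?mulr0// => s.
have /andP[p0 _] := profile_t_bounds (odd k) k./2 s.
have /andP[c0 _] := CT_bounds k./2 s.
exact: mulr_ge0.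
Qed.

Lemma wave_x_critical k x : wave_x k x = 0 -> dwave_x k x = 0.
Proof.
move=> w0; apply: (class_C1_critical (class_C1_wave_x k) _ w0) => s.
have /andP[p0 _] := profile_x_bounds (odd k) k./2 s.
have /andP[c0 _] := CX_bounds k./2 s.
exact: mulr_ge0.
Qed.

Lemma wave_x_bounds k x : 0 <= wave_x k x <= 1.
Proof.
have /andP[p0 p1] := profile_x_bounds (odd k) k./2 x.
have /andP[c0 c1] := CX_bounds k./2 x.
by rewrite /wave_x (mulr_ge0 p0 c0) (mulr_ile1 p0 c0 p1 c1).
Qed.

Lemma wave_le k t x : `|wave_t k t * wave_x k x| <= `|amplitude (odd k) k./2|.
Proof.
have /andP[w0 w1] := wave_x_bounds k x.
have /andP[p0 p1] := profile_t_bounds (odd k) k./2 t.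
have /andP[c0 c1] := CT_bounds k./2 t.
rewrite normrM (ger0_norm w0) /wave_t normrM (ger0_norm (mulr_ge0 p0 c0)).
rewrite -mulrA; apply: ler_piMr => //.
have h := mulr_ile1 p0 c0 p1 c1; have h0 := mulr_ge0 p0 c0.
exact: mulr_ile1.
Qed.

Lemma wave_small k t x : `|wave_t k t * wave_x k x| <= 2^-1 ^+ k.
Proof.
apply: le_trans (wave_le k t x) _; apply: le_trans (amplitude_le _ _) _.
have h := period_le R k./2; have T0 := period_gt0 R k./2.
(* The index [k] is at most [2 * k./2 + 1], and the period of level [n] is at most
   [2^-1 ^+ (2 * n)]. *)
apply: (@le_trans _ _ (2^-1 ^+ (k./2).*2.+1)); first by rewrite exprS; lra.
rewrite ler_wiXn2l ?invr_ge0// ?invf_le1// ?ler1n//.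
by rewrite -{1}(odd_double_half k); case: (odd k); rewrite ?add1n// add0n.
Qed.

Lemma push_hole n t : push n t != 0 -> cut_t n t = 0.
Proof.
have g0 := gap_gt0 R n; have g1 := gap_le R n.
move=> /pbump_neq0[|||||j [y [/andP[y0 y1] ->]]]; (try exact: period_gt0); try lra.
rewrite /cut_t /hole_t pbump_cell; (try exact: period_gt0); try lra.
by rewrite bump_eq1 ?subrr//; lra.
Qed.

Lemma shoulder_hole n x : shoulder n x != 0 -> cut_x n x = 0.
Proof.
have g0 := gap_gt0 R n; have g1 := gap_le R n.
move=> /pbump_neq0[|||||j [y [/andP[y0 y1] ->]]]; (try exact: width_gt0); try lra.
rewrite /cut_x /hole_x pbump_cell; (try exact: width_gt0); try lra.
by rewrite bump_eq1 ?subrr//; lra.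
Qed.

Lemma rise_push n t : rise n t != 0 -> push n t = 0.
Proof.
have g0 := gap_gt0 R n; have g1 := gap_le R n.
move=> /pbump_neq0[|||||j [y [/andP[y0 y1] ->]]]; (try exact: period_gt0); try lra.
rewrite /push pbump_cell; (try exact: period_gt0); try lra.
by rewrite bump_eq0//; try lra; right; lra.
Qed.

(** The wave of the lower level lives on a plateau of one of its own holes: in space if it is
    rising, in time if it is pushing. The cut-offs of the higher level vanish there. *)
Lemma waves_disjoint_lt k l t x : (k./2 < l./2)%N ->
  wave_t k t * wave_x k x = 0 \/ wave_t l t * wave_x l x = 0.
Proof.
move=> kl; rewrite /wave_t /wave_x.
case: (boolP (odd k)) => ok /=.
  have [->|/shoulder_hole h] := eqVneq (shoulder k./2 x) 0.
    by left; rewrite mul0r mulr0.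
  by right; rewrite [CX _ _](cutprod_eq0 kl h) !mulr0.
have [->|/push_hole h] := eqVneq (push k./2 t) 0.
  by left; rewrite mul0r mulr0 mul0r.
by right; rewrite [CT _ _](cutprod_eq0 kl h) !mulr0 mul0r.
Qed.

Lemma waves_disjoint k l t x : k <> l ->
  wave_t k t * wave_x k x = 0 \/ wave_t l t * wave_x l x = 0.
Proof.
move=> kl; case: (ltngtP k./2 l./2) => h; first exact: waves_disjoint_lt.
  by case: (waves_disjoint_lt t x h); [right|left].
(* At equal level the indices differ in parity, and the two kinds of wave act at different times. *)
have okl : odd k != odd l.
  apply/negP => /eqP o; apply: kl.
  by rewrite -(odd_double_half k) -(odd_double_half l) o h.
rewrite /wave_t -h; have [r0|/rise_push r0] := eqVneq (rise k./2 t) 0;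
  case: (odd k) (odd l) okl => [] [] // _ /=; rewrite r0 !mul0r mulr0 mul0r;
  by [left|right].
Qed.

(* The wave of level [n] only sees the steepness of the flux at level [n],
   and the rising one, which avoids the gaps, at level [n.+1]. *)
Lemma wave_osc k t x : wave_t k t != 0 ->
  `|speed (t + wave_t k t * wave_x k x) - speed t| <=
  2 * lam (k./2 + odd k)%N * `|wave_t k t * wave_x k x|.
Proof.
move=> wt0; apply: speed_osc => s st.
have T0 := period_gt0 R k./2.
have {}st : `|s - t| <= T k./2 / 8.
  exact: le_trans st (le_trans (wave_le k t x) (amplitude_le _ _)).
have stT : `|s - t| <= T k./2 by lra.
move: wt0; rewrite /wave_t mulf_eq0 negb_or => /andP[_].
rewrite mulf_eq0 negb_or => /andP[p0 c0].
case: (boolP (odd k)) p0 => ok /= p0; last by rewrite addn0; exact: flux''_le_near c0 stT.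
rewrite addn1; apply: flux''_le_near_S c0 stT _.
have g0 := gap_gt0 R k./2; have g1 := gap_le R k./2.
move: p0 => /pbump_neq0[|||||j [y [/andP[y0 y1] tE]]]; (try exact: period_gt0); try lra.
have sE := @cell_shift R (T k./2) j y s T0.
set d := (s - _) / _ in sE.
have : `|d| <= 1 / 8.
  by rewrite /d -tE normrM normfV (gtr0_norm T0) ler_pdivrMr// mulrC mulrA mulr1.
rewrite ler_norml => /andP[d0 d1].
rewrite sE /kink pbump_cell; (try exact: T0); try lra.
by rewrite bump_eq0//; try lra; right; lra.
Qed.

Lemma wave_time_rate k t x : `|dwave_t k t * wave_x k x| <= 16.
Proof.
set n := k./2; have T0 := period_gt0 R n.
have /andP[w0 w1] := wave_x_bounds k x.
have /andP[p0 p1] := profile_t_bounds (odd k) n t.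
have /andP[c0 c1] := CT_bounds n t.
rewrite normrM (ger0_norm w0); apply: (@le_trans _ _ `|dwave_t k t|).
  exact: ler_piMr.
rewrite /dwave_t -/n normrM.
have h1 : `|amplitude (odd k) n| * `|dprofile_t (odd k) n t * CT n t| <= 8.
  apply: le_trans (amplitude_dprofile_le (odd k) n t).
  apply: ler_wpM2l => //; rewrite normrM (ger0_norm c0); exact: ler_piMr.
have h2 : `|amplitude (odd k) n| * `|profile_t (odd k) n t * dCT n t| <= 1.
  have h : `|profile_t (odd k) n t * dCT n t| <= 4 / T n.
    by rewrite normrM (ger0_norm p0); apply: le_trans (ler_piMl _ p1) (dCT_le n t).
  apply: (@le_trans _ _ (T n / 8 * (4 / T n))).
    by apply: ler_pM => //; exact: amplitude_le.
  have -> : T n / 8 * (4 / T n) = 1 / 2 by field; rewrite gt_eqF.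
  lra.
apply: le_trans (ler_wpM2l (normr_ge0 _) (ler_normD _ _)) _.
by rewrite mulrDr; lra.
Qed.

Lemma dwave_x_le k x : `|dwave_x k x| <= 8 / (e k./2 * b k./2).
Proof.
set n := k./2; have b0 := width_gt0 R n; have g0 := gap_gt0 R n; have g1 := gap_le R n.
have /andP[p0 p1] := profile_x_bounds (odd k) n x.
have /andP[c0 c1] := CX_bounds n x.
apply: (@le_trans _ _ (4 / (e n * b n) + 4 / b n)).
  apply: le_trans (ler_normD _ _) _; rewrite !normrM; apply: lerD.
    by rewrite (ger0_norm c0); apply: le_trans (ler_piMr _ c1) (dprofile_x_le _ _ _).
  by rewrite (ger0_norm p0); apply: le_trans (ler_piMl _ p1) (dCX_le n x).
have -> : 4 / b n = 4 * e n / (e n * b n) by field; rewrite !gt_eqF.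
rewrite -mulrDl; apply: ler_wpM2r; last by lra.
by rewrite invr_ge0 mulr_ge0// ltW.
Qed.

(** This balances height against steepness. For the pushing wave it is an equality, by the choice of
    [width]; for the rising wave it holds because [lam n.+1] is tiny. *)
Lemma steep_amplitude o n :
  lam (n + o)%N * `|amplitude o n| ^+ 2 <= e n * b n.
Proof.
have T0 := period_gt0 R n; have T1 := period_le1 R n; have g0 := gap_gt0 R n.
have g1 := gap_le R n; have b0 := width_gt0 R n.
case: o => /=.
  rewrite addn1 ger0_norm ?divr_ge0 ?(ltW T0)//.
  have h := steep_S_le R n; have s0 := steep_gt0 R n.+1.
  have h2 : (T n / 8) ^+ 2 <= 1 by rewrite exprn_ile1 ?divr_ge0 ?(ltW T0)//; lra.
  have gb : 0 < e n * b n by rewrite mulr_gt0.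
  apply: (@le_trans _ _ (lam n.+1)); last by lra.
  by apply: ler_piMr => //; exact: ltW.
rewrite addn0 normrN ger0_norm ?mulr_ge0 ?exprn_ge0 ?(ltW T0) ?(ltW g0)//.
by rewrite /width le_eqVlt; apply/orP; left; apply/eqP; ring.
Qed.

Lemma wave_transport_rate k t x :
  `|(speed (t + wave_t k t * wave_x k x) - speed t) * (wave_t k t * dwave_x k x)|
  <= 16.
Proof.
have [->|wt0] := eqVneq (wave_t k t) 0; first by rewrite !mul0r mulr0 normr0.
set n := k./2; have b0 := width_gt0 R n; have g0 := gap_gt0 R n.
have s0 := steep_gt0 R (n + odd k)%N.
have h1 := wave_osc x wt0; have h2 := wave_le k t x; have h3 := dwave_x_le k x.
set a := `|amplitude (odd k) k./2| in h2.
have a0 : 0 <= a by exact: normr_ge0.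
have h4 : `|wave_t k t| <= a.
  have /andP[p0 p1] := profile_t_bounds (odd k) n t.
  have /andP[c0 c1] := CT_bounds n t.
  rewrite /wave_t -/n normrM (ger0_norm (mulr_ge0 p0 c0)).
  by apply: ler_piMr => //; exact: mulr_ile1.
rewrite 2!normrM; apply: (@le_trans _ _ (2 * lam (n + odd k)%N * a * (a * (8 / (e n * b n))))).
  apply: ler_pM => //; last by apply: ler_pM.
  by apply: le_trans h1 _; apply: (ler_wpM2l _ h2); apply: mulr_ge0 => //; exact: ltW.
have h5 := steep_amplitude (odd k) n; rewrite -/a in h5.
have gb : 0 < e n * b n by rewrite mulr_gt0.
have -> : 2 * lam (n + odd k)%N * a * (a * (8 / (e n * b n))) =
   16 * (lam (n + odd k)%N * a ^+ 2) / (e n * b n) by field; rewrite !gt_eqF.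
by rewrite ler_pdivrMr// ler_pM2l.
Qed.

Definition solution : R * R -> R := sheared_sum (@flux R) wave_t wave_x.
Definition source (p : R * R) : R :=
  limit_rate (@speed R) wave_t dwave_t wave_x dwave_x (shear (@flux R) p).

Lemma continuous_solution : continuous solution.
Proof.
exact: (continuous_sheared_sum (@is_derive_flux R) class_C1_wave_t class_C1_wave_x
  wave_small).
Qed.

Lemma source_measurable : measurable_fun setT source.
Proof.
exact: (limit_rate_measurable (@is_derive_flux R) (@continuous_speed R)
  class_C1_wave_t class_C1_wave_x waves_disjoint wave_t_critical wave_x_critical).
Qed.

Lemma source_bounded p : `|source p| <= 1 + 16 + 16.
Proof.
exact: (limit_rate_le (@flux R) waves_disjoint wave_t_critical wave_x_critical
  wave_time_rate wave_transport_rate).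
Qed.

Lemma balance_law_solution : balance_law (@flux R) solution source.
Proof.
exact: (balance_law_sheared_sum (@is_derive_flux R) (@continuous_speed R)
  class_C1_wave_t class_C1_wave_x waves_disjoint wave_t_critical wave_x_critical
  wave_small wave_time_rate wave_transport_rate).
Qed.

Lemma solution_lipschitz :
  lipschitz_along_characteristics (@flux R) solution.
Proof.
exists (1 + 16 + 16) => I gamma.
exact: (sheared_sum_lipschitz_along_characteristics (@is_derive_flux R)
  class_C1_wave_t class_C1_wave_x waves_disjoint
  wave_t_critical wave_x_critical wave_small wave_time_rate wave_transport_rate).
Qed.

End Waves.

(** * Characteristics starting in the core *)

Section Continuation.
Variable R : realType.
Implicit Types (z : R -> R) (p q r s : R).

Lemma derivable_within_cc z (dz : R -> R) p q :
  (forall s, p <= s <= q -> is_derive s 1 z (dz s)) ->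
  {within `[p, q], continuous z}.
Proof.
move=> D; apply: derivable_within_continuous => s; rewrite in_itv/= => /D[].
by [].
Qed.

Lemma continuous_window z (c a b : R) : {for c, continuous z} -> a < z c < b ->
  exists2 d : R, 0 < d & forall r, `|c - r| < d -> a < z r < b.
Proof.
move=> cz /andP[za zb].
have e0 : 0 < Num.min (z c - a) (b - z c) by rewrite lt_min !subr_gt0 za.
have /cvgrPdist_lt/(_ _ e0)[d /= d0 Hd] := cz.
exists d => // r /Hd /=; rewrite lt_min !ltr_norml => /andP[/andP[h1 h2] /andP[h3 h4]].
by apply/andP; split; lra.
Qed.

(** A bootstrap principle. Nothing fails before the infimum of the failure times, so the hypothesis
    gives strict bounds there; by continuity they persist a little longer, a contradiction. *)
Lemma open_continuation z (dz : R -> R) p q (a b : R) :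
  (forall s, p <= s <= q -> is_derive s 1 z (dz s)) ->
  (forall r, p <= r <= q -> (forall s, p <= s < r -> a < z s < b) -> a < z r < b) ->
  forall s, p <= s <= q -> a < z s < b.
Proof.
move=> D H s spq; apply: contrapT => ns.
pose S : set R := [set r : R | p <= r <= q /\ ~ (a < z r < b)].
have Ss : S s by [].
have infS : has_inf S by split; [exists s|exists p => r [/andP[]]].
have mS r : S r -> inf S <= r by move=> Sr; apply: inf_lbound => //; case: infS.
have pm : p <= inf S by apply: lb_le_inf; [exists s|move=> r [/andP[]]].
have /andP[ps sq] := spq.
have mq : inf S <= q := le_trans (mS _ Ss) sq.
have zm : a < z (inf S) < b.
  apply: H; first by rewrite pm.
  move=> r /andP[pr rm]; apply: contrapT => nr.
  have : S r by split=> //; rewrite pr (le_trans (ltW rm)).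
  by move=> /mS; rewrite leNgt rm.
have cz := is_derive_continuous (D _ (introT andP (conj pm mq))).
have [d d0 Hd] := continuous_window cz zm.
have [r Sr rd] := inf_adherent d0 infS.
have [_ nr] := Sr; apply: nr; apply: Hd.
have := mS _ Sr => mr.
by rewrite distrC ger0_norm ?subr_ge0// ltrBlDr addrC.
Qed.

End Continuation.

Section Dynamics.
Variable R : realType.
Local Notation e := (gap R).
Local Notation T := (period R).
Local Notation b := (width R).
Local Notation lam := (steep R).
Implicit Types (n m k : nat) (t x s y z : R) (i j : int).

(** Value 1 means a distance of at least 10 gap units from the cell ends, one unit beyond the end of
    the holes. *)
Definition core_t n := pbump (9 * e n) (10 * e n) (1 - 10 * e n) (1 - 9 * e n) (T n).
Definition core_x n := pbump (9 * e n) (10 * e n) (1 - 10 * e n) (1 - 9 * e n) (b n).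

Lemma pcoreP n P t : 0 < P ->
  pbump (9 * e n) (10 * e n) (1 - 10 * e n) (1 - 9 * e n) P t = 1 ->
  exists j y, 10 * e n <= y <= 1 - 10 * e n /\ t = (j%:~R + y) * P.
Proof.
move=> P0; have g0 := gap_gt0 R n; have g1 := gap_le R n.
have [j [y [/andP[y0 y1] ->]]] := cell_decomposition t P0.
rewrite pbump_cell//; try lra.
by move/bump_plateau => h; exists j, y; split=> //; apply: h; lra.
Qed.

Local Notation w := (total_sum (term (@wave_t R) (@wave_x R))).
Local Notation wave k t x := (wave_t k t * wave_x k x).

Ltac cell := rewrite pbump_cell; (try exact: period_gt0); (try exact: width_gt0);
  try lra.

Variables t0 x0 : R.
Hypothesis t0_core : forall m, core_t m t0 = 1.
Hypothesis x0_core : forall m, core_x m x0 = 1.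

(** A time of [2 * T n] is at most one gap unit of any lower level [m], so a core time stays outside
    the holes of that level. *)
Lemma near_core_t m n t : (m < n)%N -> t0 <= t <= t0 + 2 * T n ->
  cut_t m t = 1 /\ push m t = 0.
Proof.
move=> mn /andP[h1 h2]; have T0 := period_gt0 R m.
have g0 := gap_gt0 R m; have g1 := gap_le R m.
have [j [y [/andP[y0 y1] tE]]] := pcoreP T0 (t0_core m).
have tmn := @period_gap R m n mn.
have sE := @cell_shift R (T m) j y t T0; rewrite -tE in sE.
set d := (t - t0) / T m in sE.
have d0 : 0 <= d by rewrite divr_ge0 ?(ltW T0)// subr_ge0.
have d1 : d <= e m by rewrite ler_pdivrMr//; lra.
rewrite sE /cut_t /hole_t /push; split; cell.
  by rewrite bump_eq0 ?subr0//; try lra; right; lra.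
by rewrite bump_eq0//; try lra; right; lra.
Qed.

Lemma near_core_x m n x : (m < n)%N -> `|x - x0| <= b n ->
  cut_x m x = 1 /\ shoulder m x = 0.
Proof.
move=> mn h; have b0 := width_gt0 R m.
have g0 := gap_gt0 R m; have g1 := gap_le R m.
have [i [z [/andP[z0 z1] xE]]] := pcoreP b0 (x0_core m).
have bmn := @width_gap R m n mn; have bn0 := width_gt0 R n.
have sE := @cell_shift R (b m) i z x b0; rewrite -xE in sE.
set d := (x - x0) / b m in sE.
have : `|d| <= e m.
  by rewrite /d normrM normfV (gtr0_norm b0) ler_pdivrMr//; lra.
rewrite ler_norml => /andP[d0 d1].
rewrite sE /cut_x /hole_x /shoulder; split; cell.
  by rewrite bump_eq0 ?subr0//; try lra; right; lra.
by rewrite bump_eq0//; try lra; right; lra.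
Qed.

Lemma wave_below n k t x : (k./2 < n)%N -> t0 <= t <= t0 + 2 * T n ->
  `|x - x0| <= b n -> wave k t x = 0.
Proof.
move=> kn ht hx; have [_ p0] := near_core_t kn ht; have [_ q0] := near_core_x kn hx.
rewrite /wave_t /wave_x; case: (odd k) => /=.
  by rewrite q0 mul0r mulr0.
by rewrite p0 mul0r mulr0 mul0r.
Qed.

Lemma CT_near_core n t : t0 <= t <= t0 + 2 * T n -> CT n t = 1.
Proof. by move=> ht; apply: cutprod_eq1 => m mn; have [] := near_core_t mn ht. Qed.

Lemma CX_near_core n x : `|x - x0| <= b n -> CX n x = 1.
Proof. by move=> hx; apply: cutprod_eq1 => m mn; have [] := near_core_x mn hx. Qed.

Lemma wave_at_core : w (t0, x0) = 0.
Proof.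
have H k : wave k t0 x0 = 0.
  apply: (@wave_below k./2.+1); rewrite ?ltnS//.
    by rewrite lexx lerDl mulr_ge0// ltW// period_gt0.
  by rewrite subrr normr0 ltW// width_gt0.
have [[]//|[k [_ k0 _]]] := total_sum_cases (@waves_disjoint R) (@wave_t_critical R)
    (@wave_x_critical R) (@wave_small R) (t0, x0).
by rewrite /term H eqxx in k0.
Qed.

(** Lower levels are silent near the core. Without the pushing wave of level [n], every remaining
    wave sees a steepness of at most [lam n.+1]. *)
Lemma drift_near_core n t x : t0 <= t <= t0 + 2 * T n -> `|x - x0| <= b n ->
  push n t = 0 -> `|speed (t + w (t, x)) - speed t| <= 2 * lam n.+1 * T n.
Proof.
move=> ht hx p0; have T0 := period_gt0 R n; have s0 := steep_gt0 R n.+1.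
have [[-> _]|[k [-> k0 _]]] :=
  total_sum_cases (@waves_disjoint R) (@wave_t_critical R)
    (@wave_x_critical R) (@wave_small R) (t, x).
  rewrite addr0 subrr normr0.
  exact: (mulr_ge0 (mulr_ge0 (ler0n _ 2) (ltW s0)) (ltW T0)).
rewrite /term /= in k0 *.
have kn : (n <= k./2)%N.
  by rewrite leqNgt; apply/negP => kn; rewrite (wave_below kn ht hx) eqxx in k0.
have wt0 : wave_t k t != 0 by apply: contraNneq k0 => ->; rewrite mul0r.
apply: le_trans (wave_osc x wt0) _.
apply: ler_pM => //.
    exact: (mulr_ge0 (ler0n _ 2) (ltW (steep_gt0 _ _))).
  apply: (ler_wpM2l (ler0n R 2)).
  apply: steep_mono.
  move: kn; rewrite leq_eqVlt => /predU1P[nE|]; last first.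
    by move=> h; exact: leq_trans h (leq_addr _ _).
  have -> : odd k; last by rewrite -nE addn1.
  apply: contraNT k0 => /negbTE ok.
  by rewrite /wave_t ok /= -nE p0 mul0r mulr0 mul0r.
apply: le_trans (wave_le k t x) _; apply: le_trans (amplitude_le _ _ _) _.
have := period_gt0 R k./2; have := @period_mono R _ _ kn; lra.
Qed.

Lemma wave_in_gap n t x : t0 <= t <= t0 + 2 * T n -> `|x - x0| <= b n ->
  cut_t n t = 0 -> rise n t = 0 ->
  w (t, x) = - (e n ^+ 2 * T n) * (push n t * lane n x).
Proof.
move=> ht hx c0 r0.
have H l : l <> n.*2 -> term (@wave_t R) (@wave_x R) l (t, x) = 0.
  move=> ln; rewrite /term/=; case: (ltngtP l./2 n) => h.
  - exact: wave_below h ht hx.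
  - by rewrite /wave_t [CT _ _](cutprod_eq0 h c0) !mulr0 mul0r.
  - have ol : odd l.
      by apply: contra_notT ln => /negbTE ol; rewrite -(odd_double_half l) ol h.
    by rewrite /wave_t ol /= h r0 mul0r mulr0 mul0r.
rewrite (total_sum_of_solo (@wave_t_critical R) (@wave_x_critical R) (@wave_small R) H).
rewrite /term /wave_t /wave_x /=.
rewrite odd_double doubleK /= CT_near_core// CX_near_core// !mulr1.
by rewrite /amplitude /profile_t /profile_x -mulrA.
Qed.

(** As the rising wave is nonzero here, disjointness excludes all other terms. *)
Lemma wave_on_shoulder n t x : t0 <= t <= t0 + 2 * T n -> `|x - x0| <= b n ->
  rise n t = 1 -> shoulder n x = 1 -> w (t, x) = T n / 8.
Proof.
move=> ht hx r1 s1; have T0 := period_gt0 R n.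
have E : wave n.*2.+1 t x = T n / 8.
  rewrite /wave_t /wave_x /= odd_double /= uphalf_double r1 s1.
  by rewrite CT_near_core// CX_near_core// !mulr1.
have H l : l <> n.*2.+1 -> term (@wave_t R) (@wave_x R) l (t, x) = 0.
  move=> ln; have [//|] := waves_disjoint t x ln.
  by rewrite E => /eqP; rewrite gt_eqF// divr_gt0.
rewrite (total_sum_of_solo (@wave_t_critical R) (@wave_x_critical R) (@wave_small R) H).
by rewrite /term /= E.
Qed.

(** Speed [lam n * (e n ^+ 2 * T n)] during the time [e n * T n] covers exactly one space cell. *)
Lemma widthE n : lam n * (e n ^+ 2 * T n) * (e n * T n) = b n.
Proof. by rewrite /width; ring. Qed.

(** * The motion of a characteristic from the core through the next gap *)

Section Displacement.
Opaque gap period width steep speed flux.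
Variables (n : nat) (z : R -> R).
Hypothesis z0 : z t0 = x0.
Hypothesis dz : forall s, t0 <= s <= t0 + 2 * T n ->
  is_derive s 1 z (speed (s + w (s, z s)) - speed s).
Variables (i j : int) (yt yx : R).
Hypothesis yt_core : 10 * e n <= yt <= 1 - 10 * e n.
Hypothesis yx_core : 10 * e n <= yx <= 1 - 10 * e n.
Hypothesis t0E : t0 = (j%:~R + yt) * T n.
Hypothesis x0E : x0 = (i%:~R + yx) * b n.

(** Times are measured in the cell after that of [t0], so that small [y] lies in the first gap to
    come; positions are measured in the cell of [x0] itself. *)
Let at_t y := (j%:~R + 1 + y) * T n.
Let at_x y := (i%:~R + y) * b n.

Let T0 : 0 < T n. Proof. exact: period_gt0. Qed.
Let b0 : 0 < b n. Proof. exact: width_gt0. Qed.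
Let g0 : 0 < e n. Proof. exact: gap_gt0. Qed.
Let g1 : e n <= 256^-1. Proof. exact: gap_le. Qed.

Ltac glra := have := g0; have := g1; lra.
Ltac cells := rewrite pbump_cell; (try exact: T0); (try exact: b0); try glra.

Let in_cell x := at_x 0 < x < at_x 1.

Let at_t_range y : 0 <= y <= 1 / 2 -> t0 <= at_t y <= t0 + 2 * T n.
Proof.
move=> /andP[y0 y1]; have /andP[h1 h2] := yt_core.
have -> : t0 + 2 * T n = (j%:~R + yt + 2) * T n by rewrite t0E; ring.
by rewrite t0E /at_t !ler_pM2r//; apply/andP; split; glra.
Qed.

Let in_cell_near x : in_cell x -> `|x - x0| <= b n.
Proof.
move=> /andP[h1 h2]; have /andP[k1 k2] := yx_core.
rewrite x0E ler_norml; move: h1 h2; rewrite /at_x => h1 h2.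
have A : 0 <= yx * b n by apply: mulr_ge0; [glra|exact: ltW].
have B : 0 <= (1 - yx) * b n by apply: mulr_ge0; [glra|exact: ltW].
by apply/andP; split; glra.
Qed.

(** The time [t0] is past the gap of its own cell, so no push occurs until coordinate [4 * e n] of
    the next one. *)
Let before s : t0 <= s <= at_t (4 * e n) -> push n s = 0.
Proof.
move=> /andP[h1 h2]; have /andP[k1 k2] := yt_core.
have sE := @cell_shift R (T n) j yt s T0; rewrite -t0E in sE.
set d := (s - t0) / T n in sE.
have d0 : 0 <= d by rewrite divr_ge0 ?(ltW T0)// subr_ge0.
have d1 : yt + d <= 1 + 4 * e n.
  rewrite -(ler_pM2r T0); move: h2; rewrite /at_t sE; glra.
rewrite sE /push; have [le1|gt1] := leP (yt + d) 1.
  by cells; rewrite bump_eq0//; try glra; right; glra.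
have -> : (j%:~R + (yt + d)) * T n = ((j + 1)%:~R + (yt + d - 1)) * T n.
  by rewrite intrD mulr1z; ring.
by cells; rewrite bump_eq0//; try glra; left; glra.
Qed.

Let at_tE y : at_t y = ((j + 1)%:~R + y) * T n.
Proof. by rewrite /at_t intrD mulr1z. Qed.

Let after y : 6 * e n <= y <= 1 -> push n (at_t y) = 0.
Proof.
move=> /andP[y0 y1]; rewrite at_tE /push; cells.
by rewrite bump_eq0//; try glra; right; glra.
Qed.

Let in_gap y : e n <= y <= 8 * e n -> cut_t n (at_t y) = 0 /\ rise n (at_t y) = 0.
Proof.
move=> /andP[y0 y1]; rewrite at_tE /cut_t /hole_t /rise; split; cells.
  by rewrite bump_eq1 ?subrr//; glra.
by rewrite bump_eq0//; try glra; left; glra.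
Qed.

Let rise_mid : rise n (at_t (1 / 2)) = 1.
Proof. by rewrite at_tE /rise; cells; rewrite bump_eq1//; glra. Qed.

Let push_plateau u : 9 / 2 * e n <= u <= 11 / 2 * e n -> push n (at_t u) = 1.
Proof.
move=> /andP[u1 u2]; rewrite at_tE /push; cells.
by rewrite bump_eq1 ?u1//; glra.
Qed.

Let shoulder_plateau u : 3 * e n <= u <= 6 * e n -> shoulder n (at_x u) = 1.
Proof.
by move=> /andP[u0 u1]; rewrite /shoulder /at_x; cells; rewrite bump_eq1//; glra.
Qed.

Let lane_plateau u : 5 * e n <= u <= 1 - 5 * e n -> lane n (at_x u) = 1.
Proof.
by move=> /andP[u0 u1]; rewrite /lane /at_x; cells; rewrite bump_eq1 ?u0//; glra.
Qed.

Let lane_low u : 0 <= u <= 4 * e n -> lane n (at_x u) = 0.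
Proof.
move=> /andP[u0 u1]; rewrite /lane /at_x; cells.
by rewrite bump_eq0//; try glra; left.
Qed.

Let kink_plateau u : 3 * e n <= u <= 6 * e n -> kink n (at_t u) = 1.
Proof. by move=> h; rewrite at_tE kink_eq1. Qed.

Let at_t_inv s : s = at_t ((s - at_t 0) / T n).
Proof. by rewrite /at_t; field; rewrite gt_eqF. Qed.

Let at_t_between s y y' : at_t y <= s <= at_t y' ->
  exists2 u, s = at_t u & y <= u <= y'.
Proof.
move=> h; exists ((s - at_t 0) / T n); first exact: at_t_inv.
move: h; rewrite {1 2}(at_t_inv s); move: (_ / T n) => u.
by rewrite /at_t !ler_pM2r// !lerD2l.
Qed.

Let within p q : t0 <= p -> q <= t0 + 2 * T n -> {within `[p, q], continuous z}.
Proof.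
move=> h1 h2; apply: derivable_within_cc => s /andP[h3 h4].
by apply: dz; rewrite (le_trans h1 h3) (le_trans h4 h2).
Qed.

Let drift p r : t0 <= p -> p <= r -> r <= t0 + 2 * T n ->
  (forall s, p < s < r -> push n s = 0 /\ in_cell (z s)) ->
  `|z r - z p| <= e n * b n.
Proof.
move=> h1 h2 h3 H; have s0 := steep_gt0 R n.+1; have sS := steep_S_le R n.
set c := 2 * lam n.+1 * T n.
have /andP[m1 m2] : - c * (r - p) <= z r - z p <= c * (r - p).
  apply: (MVT_bounds h2 (within h1 h3)) => s /andP[ps sr].
    by apply: dz; rewrite (le_trans h1 (ltW ps)) (le_trans (ltW sr) h3).
  have [p0 ic] := H s (introT andP (conj ps sr)).
  rewrite -ler_norml; apply: drift_near_core => //.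
    by rewrite (le_trans h1 (ltW ps)) (le_trans (ltW sr) h3).
  exact: in_cell_near.
have T1 := period_le1 R n.
(* Velocity [2 * lam n.+1 * T n] during at most [2 * T n], with [T n <= 1] and
   [lam n.+1 <= e n * b n / 32]. *)
have cb : c * (r - p) <= e n * b n.
  apply: (@le_trans _ _ (c * (2 * T n))).
    have c0 : 0 <= c := mulr_ge0 (mulr_ge0 (ler0n _ 2) (ltW s0)) (ltW T0).
    by apply: (ler_wpM2l c0); glra.
  have TT : T n * T n <= 1 := mulr_ile1 (ltW T0) (ltW T0) T1 T1.
  have -> : c * (2 * T n) = 4 * lam n.+1 * (T n * T n) by rewrite /c; ring.
  apply: (@le_trans _ _ (4 * lam n.+1)).
    exact: ler_piMr (mulr_ge0 (ler0n _ 4) (ltW s0)) TT.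
  have := mulr_gt0 g0 b0; glra.
rewrite ler_norml; apply/andP; split; last glra.
by move: m1; rewrite mulNr; glra.
Qed.

Let gap_formula y : 4 * e n <= y <= 6 * e n -> in_cell (z (at_t y)) ->
  w (at_t y, z (at_t y)) =
    - (e n ^+ 2 * T n) * (push n (at_t y) * lane n (z (at_t y))).
Proof.
move=> /andP[y0 y1] ic; have [c0 r0] := in_gap (y := y) ltac:(apply/andP; split; glra).
apply: wave_in_gap => //; last exact: in_cell_near.
by apply: at_t_range; apply/andP; split; glra.
Qed.

Let gap_speed_le y : 4 * e n <= y <= 6 * e n -> in_cell (z (at_t y)) ->
  speed (at_t y + w (at_t y, z (at_t y))) - speed (at_t y) <= 0.
Proof.
move=> hy ic; rewrite gap_formula// subr_le0; apply: speed_le.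
have /andP[p0 _] := @pbump_bounds R (4 * e n) (9 / 2 * e n) (11 / 2 * e n) (6 * e n)
  (T n) (at_t y).
have /andP[l0 _] := @pbump_bounds R (4 * e n) (5 * e n) (1 - 5 * e n) (1 - 4 * e n)
  (b n) (z (at_t y)).
rewrite gerDl mulNr oppr_le0 mulr_ge0//; last exact: mulr_ge0.
by rewrite mulr_ge0 ?(ltW T0)// exprn_ge0 ?(ltW g0).
Qed.

Let gap_speed_eq0 y : 4 * e n <= y <= 6 * e n -> in_cell (z (at_t y)) ->
  z (at_t y) <= at_x (4 * e n) ->
  speed (at_t y + w (at_t y, z (at_t y))) - speed (at_t y) = 0.
Proof.
move=> hy ic zx; rewrite gap_formula//.
have -> : lane n (z (at_t y)) = 0; last by rewrite !mulr0 addr0 subrr.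
have [u -> hu] : exists2 u, z (at_t y) = at_x u & 0 <= u <= 4 * e n.
  exists (z (at_t y) / b n - i%:~R); first by rewrite /at_x; field; rewrite gt_eqF.
  move/andP: ic => [i1 _]; move: i1 zx; rewrite /at_x => i1 zx.
  rewrite subr_ge0 lerBlDr ler_pdivlMr// ler_pdivrMr//.
  by apply/andP; split; glra.
exact: lane_low.
Qed.

(** During the gap motion is only to the left, and the left edge of [lane] is a barrier. The squared
    depth [phi] beyond the barrier starts at 0 and is constant: at each time either its positive
    part or the velocity vanishes. *)
Let pushed r : at_t (4 * e n) <= r <= at_t (6 * e n) ->
  (forall s, at_t (4 * e n) < s < r -> in_cell (z s)) ->
  at_x (4 * e n) <= z (at_t (4 * e n)) ->
  at_x (4 * e n) <= z r <= z (at_t (4 * e n)).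
Proof.
move=> /andP[r1 r2] H L.
have /andP[p1 p2] := at_t_range (y := 4 * e n) ltac:(apply/andP; split; glra).
have /andP[q1 q2] := at_t_range (y := 6 * e n) ltac:(apply/andP; split; glra).
have rT : r <= t0 + 2 * T n := le_trans r2 q2.
have D s : at_t (4 * e n) < s < r ->
    is_derive s 1 z (speed (s + w (s, z s)) - speed s).
  by move=> /andP[h1 h2]; apply: dz; rewrite (le_trans p1 (ltW h1)) (le_trans (ltW h2)).
have par s : at_t (4 * e n) < s < r -> exists2 u, s = at_t u & 4 * e n <= u <= 6 * e n.
  by move=> /andP[h1 h2]; apply: at_t_between; rewrite (ltW h1) (le_trans (ltW h2) r2).
apply/andP; split; last first.
  have [<-//|[c hc E]] := MVT_cc r1 (within p1 rT) D.
  rewrite -subr_le0 E; apply: mulr_le0_ge0; last by rewrite subr_ge0.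
  have [u uE hu] := par c hc; have := H c hc; rewrite uE => ic.
  exact: gap_speed_le.
pose phi s := sqr_pos (- 1 * z s + at_x (4 * e n)).
pose dphi s := - 1 * (speed (s + w (s, z s)) - speed s) *
  (2 * Num.max (- 1 * z s + at_x (4 * e n)) 0).
have Dphi s : t0 <= s <= t0 + 2 * T n -> is_derive s 1 phi (dphi s).
  move=> hs; apply: (is_derive_compf (proj1 (class_C1_sqr_pos R) _)).
  have h := is_derive_compf (is_derive_affine (- 1) (at_x (4 * e n)) (z s)) (dz hs).
  by apply: (is_derive_eq h); rewrite mulrC.
have wphi : {within `[at_t (4 * e n), r], continuous phi}.
  apply: derivable_within_cc => s /andP[h3 h4].
  by apply: Dphi; rewrite (le_trans p1 h3) (le_trans h4 rT).
have phi0 : phi (at_t (4 * e n)) = 0.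
  rewrite /phi /sqr_pos mulN1r (max_r _) ?expr0n//.
  by rewrite addrC subr_le0.
have : phi r = 0.
  have [<-//|[c hc E]] := MVT_cc r1 wphi (fun s hs => Dphi s
    (ltac:(move/andP: hs => [h1 h2]; rewrite (le_trans p1 (ltW h1)) (le_trans (ltW h2)) //))).
  rewrite phi0 subr0 in E; rewrite E /dphi.
  have [zx|zx] := leP (- 1 * z c + at_x (4 * e n)) 0; first by rewrite !mulr0 mul0r.
  have [u uE hu] := par c hc; have := H c hc; move: zx; rewrite uE => zx ic.
  by rewrite gap_speed_eq0 ?mulr0 ?mul0r//; glra.
rewrite /phi /sqr_pos => /eqP; rewrite sqrf_eq0 => /eqP h.
have : - 1 * z r + at_x (4 * e n) <= 0 by rewrite -h le_max lexx.
glra.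
Qed.

(** A characteristic ending to the right of [5 * e n] would have stayed on the plateau of [lane]
    throughout. The full push would then have moved it by at least [b n], more than the available
    room. *)
Let pushed_far : (forall s, at_t (4 * e n) <= s <= at_t (6 * e n) -> in_cell (z s)) ->
  at_x (4 * e n) <= z (at_t (4 * e n)) <= at_x (1 - 5 * e n) ->
  z (at_t (6 * e n)) <= at_x (5 * e n).
Proof.
move=> H /andP[L U]; rewrite leNgt; apply/negP => far.
have mono y y' : 4 * e n <= y -> y <= y' -> y' <= 6 * e n -> z (at_t y') <= z (at_t y).
  move=> hy yy' hy'.
  have /andP[p1 _] := at_t_range (y := y) ltac:(apply/andP; split; glra).
  have /andP[_ q2] := at_t_range (y := y') ltac:(apply/andP; split; glra).
  have att : at_t y <= at_t y' by rewrite /at_t ler_pM2r// lerD2l.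
  have D s : at_t y < s < at_t y' -> is_derive s 1 z (speed (s + w (s, z s)) - speed s).
    by move=> /andP[h1 h2]; apply: dz; rewrite (le_trans p1 (ltW h1)) (le_trans (ltW h2)).
  have [->//|[c /andP[c1 c2] E]] := MVT_cc att (within p1 q2) D.
  rewrite -subr_le0 E; apply: mulr_le0_ge0; last by rewrite subr_ge0.
  have [u uE /andP[u1 u2]] : exists2 u, c = at_t u & y <= u <= y'.
    by apply: at_t_between; rewrite (ltW c1) (ltW c2).
  have := H c; rewrite uE => ic; apply: gap_speed_le; first by apply/andP; split; glra.
  by apply: ic; rewrite /at_t !ler_pM2r// !lerD2l; apply/andP; split; glra.
have lane1 y : 4 * e n <= y <= 6 * e n -> lane n (z (at_t y)) = 1.
  move=> /andP[y0 y1].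
  have h1 := mono _ _ y0 y1 (lexx _); have h2 := mono _ _ (lexx _) y0 y1.
  have [u -> hu] : exists2 u, z (at_t y) = at_x u & 5 * e n <= u <= 1 - 5 * e n.
    exists (z (at_t y) / b n - i%:~R); first by rewrite /at_x; field; rewrite gt_eqF.
    move: far U h1 h2; rewrite /at_x => far U h1 h2.
    rewrite lerBrDr lerBlDr ler_pdivlMr// ler_pdivrMr//.
    by apply/andP; split; glra.
  exact: lane_plateau.
have a1 := at_t_range (y := 9 / 2 * e n) ltac:(apply/andP; split; glra).
have a2 := at_t_range (y := 11 / 2 * e n) ltac:(apply/andP; split; glra).
move/andP: a1 => [p1 p2]; move/andP: a2 => [q1 q2].
have att : at_t (9 / 2 * e n) <= at_t (11 / 2 * e n).
  by rewrite /at_t ler_pM2r// lerD2l; glra.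
have D s : at_t (9 / 2 * e n) < s < at_t (11 / 2 * e n) ->
    is_derive s 1 z (speed (s + w (s, z s)) - speed s).
  by move=> /andP[h1 h2]; apply: dz; rewrite (le_trans p1 (ltW h1)) (le_trans (ltW h2)).
have [E|[c /andP[c1 c2] E]] := MVT_cc att (within p1 q2) D.
  by move: (mulr_gt0 g0 T0) E; rewrite /at_t => h E; glra.
have [u uE /andP[u1 u2]] : exists2 u, c = at_t u & 9 / 2 * e n <= u <= 11 / 2 * e n.
  by apply: at_t_between; rewrite (ltW c1) (ltW c2).
have hu : 4 * e n <= u <= 6 * e n by apply/andP; split; glra.
have ic : in_cell (z (at_t u)).
  by apply: H; rewrite /at_t !ler_pM2r// !lerD2l.
rewrite uE gap_formula// (lane1 u hu) in E.
have pu : push n (at_t u) = 1.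
  by apply: push_plateau; rewrite u1.
rewrite pu !mulr1 in E.
have eT : 0 < e n ^+ 2 * T n by rewrite mulr_gt0 ?exprn_gt0.
(* Going back by the height of the wave shifts the cell coordinate by [e n ^+ 2 <= e n], so the
   whole segment is on the plateau of [kink n]. *)
have drop : speed (at_t u + - (e n ^+ 2 * T n)) - speed (at_t u) <=
    - (lam n * (e n ^+ 2 * T n)).
  rewrite -opprB lerN2.
  have le : at_t u + - (e n ^+ 2 * T n) <= at_t u by rewrite gerDl oppr_le0 ltW.
  have := @speed_increment_ge R _ _ (lam n) le.
  have -> : at_t u - (at_t u + - (e n ^+ 2 * T n)) = e n ^+ 2 * T n by ring.
  apply=> s /andP[s1 s2].
  apply: (le_trans _ (flux''_ge n s)).
  have sh : at_t u + - (e n ^+ 2 * T n) = at_t (u - e n ^+ 2) by rewrite /at_t; ring.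
  rewrite sh in s1.
  have [v -> /andP[v1 v2]] : exists2 v, s = at_t v & u - e n ^+ 2 <= v <= u.
    by apply: at_t_between; rewrite (ltW s1) (ltW s2).
  have e2 : e n ^+ 2 <= e n by rewrite expr2; apply: ler_piMr; glra.
  by rewrite kink_plateau ?mulr1//; apply/andP; split; glra.
have len : at_t (11 / 2 * e n) - at_t (9 / 2 * e n) = e n * T n.
  by rewrite /at_t; glra.
rewrite len in E.
have total : lam n * (e n ^+ 2 * T n) * (e n * T n) = b n by rewrite -widthE; ring.
have big : z (at_t (11 / 2 * e n)) - z (at_t (9 / 2 * e n)) <= - b n.
  have -> : - b n = - (lam n * (e n ^+ 2 * T n)) * (e n * T n).
    by rewrite -total; ring.
  rewrite E; apply: ler_wpM2r drop.
  exact: mulr_ge0 (ltW g0) (ltW T0).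
have m1 := mono (4 * e n) (9 / 2 * e n) (lexx _) ltac:(glra) ltac:(glra).
have m2 := mono (11 / 2 * e n) (6 * e n) ltac:(glra) ltac:(glra) (lexx _).
have gb := mulr_gt0 g0 b0.
move: far U; rewrite /at_x => far U; glra.
Qed.

Lemma displacement : [/\ t0 < at_t (e n) <= t0 + 2 * T n,
  t0 < at_t (1 / 2) <= t0 + 2 * T n,
  w (at_t (e n), z (at_t (e n))) = 0 &
  w (at_t (1 / 2), z (at_t (1 / 2))) = T n / 8].
Proof.
have /andP[k1 k2] := yt_core; have /andP[l1 l2] := yx_core.
have gb := mulr_gt0 g0 b0.
have gb1 : e n * b n <= 256^-1 * b n by rewrite ler_pM2r.
have lt y : 0 <= y -> t0 < at_t y.
  by move=> y0; rewrite t0E /at_t ltr_pM2r//; glra.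
have r4 := at_t_range (y := 4 * e n) ltac:(apply/andP; split; glra).
have r6 := at_t_range (y := 6 * e n) ltac:(apply/andP; split; glra).
have rh := at_t_range (y := 1 / 2) ltac:(apply/andP; split; glra).
have re := at_t_range (y := e n) ltac:(apply/andP; split; glra).
have lo : at_x (10 * e n) <= x0 by rewrite x0E /at_x ler_pM2r// lerD2l.
have hi : x0 <= at_x (1 - 10 * e n) by rewrite x0E /at_x ler_pM2r// lerD2l.
have mono y y' : y <= y' -> at_t y <= at_t y'.
  by move=> h; rewrite /at_t ler_pM2r// lerD2l.
have m46 : at_t (4 * e n) <= at_t (6 * e n) by apply: mono; glra.
have m6h : at_t (6 * e n) <= at_t (1 / 2) by apply: mono; glra.
move: r4 r6 rh re => /andP[r41 r42] /andP[r61 r62] /andP[rh1 rh2] /andP[re1 re2].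
(* Before the gap the drift is at most one unit, from the 10 units of clearance of the core. *)
have ph1 r : t0 <= r <= at_t (4 * e n) -> (forall s, t0 <= s < r -> in_cell (z s)) ->
    at_x (9 * e n) <= z r <= at_x (1 - 9 * e n).
  move=> /andP[h1 h2] H.
  have Hd s : t0 < s < r -> push n s = 0 /\ in_cell (z s).
    move=> /andP[s1 s2]; split; last by apply: H; rewrite (ltW s1).
    by apply: before; rewrite (ltW s1) (le_trans (ltW s2)).
  have := drift (lexx _) h1 (le_trans h2 r42) Hd.
  rewrite z0 ler_norml => /andP[d1 d2].
  by move: lo hi; rewrite /at_x => lo hi; apply/andP; split; glra.
have ph2 r : at_t (4 * e n) <= r <= at_t (6 * e n) ->
    (forall s, t0 <= s < r -> in_cell (z s)) ->
    at_x (4 * e n) <= z r <= at_x (1 - 9 * e n).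
  move=> /andP[h1 h2] H.
  have /andP[a1 a2] := ph1 (at_t (4 * e n)) ltac:(rewrite r41 lexx //)
    (fun s hs => H s ltac:(move/andP: hs => [q1 q2]; rewrite q1 (lt_le_trans q2) //)).
  have a3 : at_x (4 * e n) <= z (at_t (4 * e n)).
    by move: a1; rewrite /at_x => a1; glra.
  have /andP[c1 c2] := pushed (introT andP (conj h1 h2))
    (fun s hs => H s ltac:(move/andP: hs => [q1 q2]; rewrite (le_trans r41 (ltW q1)) q2 //)) a3.
  by rewrite c1 (le_trans c2 a2).
(* After the gap the position is in [[4, 5]] gap units, and the drift adds at most one unit on each
   side. *)
have ph3 r : at_t (6 * e n) <= r <= at_t (1 / 2) ->
    (forall s, t0 <= s < r -> in_cell (z s)) -> in_cell (z (at_t (6 * e n))) ->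
    at_x (3 * e n) <= z r <= at_x (6 * e n).
  move=> /andP[h1 h2] H ic.
  have H6 s : t0 <= s <= at_t (6 * e n) -> in_cell (z s).
    move=> /andP[s1]; rewrite le_eqVlt => /predU1P[->//|s2].
    by apply: H; rewrite s1 (lt_le_trans s2).
  have /andP[a1 a2] := ph1 (at_t (4 * e n)) ltac:(rewrite r41 lexx //)
    (fun s hs => H6 s ltac:(move/andP: hs => [q1 q2]; rewrite q1 (le_trans (ltW q2)) //)).
  have /andP[c1 _] := ph2 (at_t (6 * e n)) ltac:(rewrite m46 lexx //)
    (fun s hs => H6 s ltac:(move/andP: hs => [q1 q2]; rewrite q1 (ltW q2) //)).
  have c2 := pushed_far
    (fun s hs => H6 s ltac:(move/andP: hs => [q1 q2]; rewrite (le_trans r41 q1) q2 //))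
    ltac:(move: a1 a2; rewrite /at_x => a1 a2; apply/andP; split; glra).
  have Hd s : at_t (6 * e n) < s < r -> push n s = 0 /\ in_cell (z s).
    move=> /andP[s1 s2]; split; last by apply: H; rewrite (le_trans r61 (ltW s1)).
    have [u -> /andP[u1 u2]] : exists2 u, s = at_t u & 6 * e n <= u <= 1 / 2.
      by apply: at_t_between; rewrite (ltW s1) (le_trans (ltW s2)).
    by apply: after; apply/andP; split; glra.
  have := drift r61 h1 (le_trans h2 rh2) Hd.
  rewrite ler_norml => /andP[d1 d2].
  by move: c1 c2; rewrite /at_x => c1 c2; apply/andP; split; glra.
(* The three phases assume that the curve has not left the cell and conclude that it is strictly
   inside, so the bootstrap applies. *)
have stay s : t0 <= s <= at_t (1 / 2) -> in_cell (z s).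
  apply: (@open_continuation _ z _ t0 (at_t (1 / 2)) (at_x 0) (at_x 1) _ _ s).
    by move=> r /andP[h1 h2]; apply: dz; rewrite h1 (le_trans h2).
  move=> r /andP[h1 h2] H.
  have [c|c] := leP r (at_t (4 * e n)).
    have /andP[a1 a2] := ph1 r (introT andP (conj h1 c)) H.
    by move: a1 a2; rewrite /at_x => a1 a2; apply/andP; split; glra.
  have [c'|c'] := leP r (at_t (6 * e n)).
    have /andP[a1 a2] := ph2 r (introT andP (conj (ltW c) c')) H.
    by move: a1 a2; rewrite /at_x => a1 a2; apply/andP; split; glra.
  have ic : in_cell (z (at_t (6 * e n))) by apply: H; rewrite r61.
  have /andP[a1 a2] := ph3 r (introT andP (conj (ltW c') h2)) H ic.
  by move: a1 a2; rewrite /at_x => a1 a2; apply/andP; split; glra.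
split.
- by rewrite re2 andbT; apply: lt; glra.
- by rewrite rh2 andbT; apply: lt; glra.
- have [c0 r0] := in_gap (y := e n) ltac:(apply/andP; split; glra).
  have h : t0 <= at_t (e n) <= t0 + 2 * T n by rewrite re1.
  have hz : `|z (at_t (e n)) - x0| <= b n.
    by apply: in_cell_near; apply: stay; rewrite re1; apply: mono; glra.
  rewrite (wave_in_gap h hz c0 r0) before ?mul0r ?mulr0//.
  by rewrite re1; apply: mono; glra.
- have ih : in_cell (z (at_t (1 / 2))) by apply: stay; rewrite rh1 lexx.
  have /andP[a1 a2] := ph3 (at_t (1 / 2)) ltac:(rewrite m6h lexx //)
    (fun s hs => stay s ltac:(move/andP: hs => [q1 q2]; rewrite q1 (ltW q2) //))
    (stay (at_t (6 * e n)) (introT andP (conj r61 m6h))).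
  apply: wave_on_shoulder.
  + by rewrite rh1.
  + exact: in_cell_near.
  + exact: rise_mid.
  + have [u -> hu] : exists2 u, z (at_t (1 / 2)) = at_x u & 3 * e n <= u <= 6 * e n.
      exists (z (at_t (1 / 2)) / b n - i%:~R); first by rewrite /at_x; field; rewrite gt_eqF.
      move: a1 a2; rewrite /at_x => a1 a2.
      by rewrite lerBrDr lerBlDr ler_pdivlMr// ler_pdivrMr//; apply/andP; split; glra.
    exact: shoulder_plateau.
Qed.

(** In the middle of the time cell, one point is on the plateau of [shoulder] and the other at the
    foot of its left flank, at 2 gap units. The second is on the plateau of [hole_x], which silences
    all higher levels. *)
Lemma steep_pair : exists t x1 x2, [/\ t0 <= t <= t0 + 2 * T n,
  `|x1 - x0| <= b n /\ `|x2 - x0| <= b n, `|x1 - x2| <= b n,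
  w (t, x1) = T n / 8 & w (t, x2) = 0].
Proof.
have gb := mulr_gt0 g0 b0.
have gb1 : e n * b n <= 256^-1 * b n by rewrite ler_pM2r.
have rh : t0 <= at_t (1 / 2) <= t0 + 2 * T n.
  by apply: at_t_range; apply/andP; split; glra.
have ic y : 2 * e n <= y <= 5 * e n -> `|at_x y - x0| <= b n.
  move=> /andP[y0 y1]; apply: in_cell_near.
  by rewrite /in_cell /at_x !ltr_pM2r// !ltrD2l; apply/andP; split; glra.
have h1 := ic (5 * e n) ltac:(apply/andP; split; glra).
have h2 := ic (2 * e n) ltac:(apply/andP; split; glra).
exists (at_t (1 / 2)), (at_x (5 * e n)), (at_x (2 * e n)); split=> //.
- have -> : at_x (5 * e n) - at_x (2 * e n) = 3 * (e n * b n) by rewrite /at_x; ring.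
  by rewrite ger0_norm; lra.
- apply: wave_on_shoulder => //.
  by apply: shoulder_plateau; apply/andP; split; glra.
have H k : wave k (at_t (1 / 2)) (at_x (2 * e n)) = 0.
  case: (ltngtP k./2 n) => h.
  - exact: wave_below h rh h2.
  - have c0 : cut_x n (at_x (2 * e n)) = 0.
      by rewrite /cut_x /hole_x /at_x; cells; rewrite bump_eq1 ?subrr//; glra.
    by rewrite /wave_x [CX _ _](cutprod_eq0 h c0) !mulr0.
  rewrite /wave_t /wave_x h; case: (odd k) => /=.
    have -> : shoulder n (at_x (2 * e n)) = 0.
      by rewrite /shoulder /at_x; cells; rewrite bump_eq0//; try glra; left.
    by rewrite mul0r mulr0.
  by rewrite after ?mul0r ?mulr0 ?mul0r//; apply/andP; split; glra.
have [[]//|[k [_ k0 _]]] := total_sum_cases (@waves_disjoint R) (@wave_t_critical R)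
    (@wave_x_critical R) (@wave_small R) (at_t (1 / 2), at_x (2 * e n)).
by rewrite /term H eqxx in k0.
Qed.

End Displacement.
End Dynamics.

(** * The core is compact with positive measure *)

Section CoreSets.
Variable R : realType.
Local Notation e := (gap R).
Notation mu := (@lebesgue_measure R).
Implicit Types (n k : nat) (x y c : R).

Lemma closed_level_set (F : R -> R) y : continuous F -> closed [set x | F x = y].
Proof.
move=> cF; apply: (@preimage_closed _ _ F [set y]); last exact: closed_eq.
by move=> x _; exact: cF.
Qed.

Section Shifted.
Variables (P : nat -> R) (c : R).
Hypothesis P0 : forall n, 0 < P n.
Hypothesis P1 : forall n, P n <= 1.

Definition core n := pbump (9 * e n) (10 * e n) (1 - 10 * e n) (1 - 9 * e n) (P n).
(** The offset [c] is there for the vertical sections of [core_plane], which are translates by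
    [flux t]. *)
Definition core_set : set R :=
  `[c, c + 1]%classic `&` [set x | forall n, core n (x - c) = 1].

Lemma continuous_core n : continuous (core n).
Proof.
have g0 := gap_gt0 R n; have g1 := gap_le R n.
have H : class_C1 (core n)
    (dpbump (9 * e n) (10 * e n) (1 - 10 * e n) (1 - 9 * e n) (P n)).
  by apply: class_C1_pbump => //; lra.
exact: class_C1_continuous H.
Qed.

Lemma closed_core_set : closed core_set.
Proof.
apply: closedI; first exact: itv_closed.
have -> : [set x | forall n, core n (x - c) = 1] =
    \bigcap_n [set x | core n (x - c) = 1].
  by apply/seteqP; split=> [x H n _|x H n]; exact: H.
apply: closed_bigI => n _; apply: closed_level_set.
apply: continuous_compf; last exact: continuous_core.
by apply: continuous_subf; [move=> ?; exact: cvg_id|move=> ?; exact: cvg_cst].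
Qed.

Lemma compact_core_set : compact core_set.
Proof.
apply: (subclosed_compact closed_core_set (@segment_compact _ c (c + 1))).
by move=> x [].
Qed.

Lemma measurable_core_set : measurable core_set.
Proof. exact: closed_measurable closed_core_set. Qed.

(** Neighbourhoods of the grid points; [bads] also includes the grid point closing the last,
    incomplete cell. *)
Let bad n k := `[c + (k%:R - 10 * e n) * P n, c + (k%:R + 10 * e n) * P n]%classic.
Let bads n := \big[setU/set0]_(k < (Num.truncn (P n)^-1).+2) bad n k.

Let measurable_bads n : measurable (bads n).
Proof. by apply: bigsetU_measurable => k _; exact: measurable_itv. Qed.

(** There are at most [1 / P n + 2] intervals of length [20 * e n * P n], and [P n <= 1]. The bound
    is written as a term of a geometric series. *)
Let bads_le n : (mu (bads n) <= (60 / (2 ^ (n + 8))%:R)%:E)%E.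
Proof.
have g0 := gap_gt0 R n; have p0 := P0 n; have p1 := P1 n.
apply: (@le_trans _ _ (\sum_(k < (Num.truncn (P n)^-1).+2) mu (bad n k))%E).
  by apply: Boole_inequality => k _; exact: measurable_itv.
have bE k : mu (bad n k) = (20 * e n * P n)%:E.
  rewrite /bad lebesgue_measure_itv/= lte_fin.
  have h : 0 < e n * P n by rewrite mulr_gt0.
  rewrite ifT; last by lra.
  by rewrite -EFinB; congr (_%:E); ring.
under eq_bigr do rewrite bE.
have sumE m (z : R) : \sum_(i < m) z = m%:R * z.
  by rewrite sumr_const card_ord mulr_natl.
rewrite sumEFin lee_fin sumE.
have -> : 60 / (2 ^ (n + 8))%:R = 60 * e n.
  by rewrite /gap natrX exprVn.
have /truncn_itv/andP[N1 _] : 0 <= (P n)^-1 by rewrite invr_ge0 ltW.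
have N2 : (Num.truncn (P n)^-1)%:R * P n <= 1.
  by rewrite -ler_pdivlMr// mul1r.
have -> : (Num.truncn (P n)^-1).+2%:R = (Num.truncn (P n)^-1)%:R + 2 :> R.
  by rewrite -addn2 natrD.
have -> : ((Num.truncn (P n)^-1)%:R + 2) * (20 * e n * P n) =
    20 * e n * ((Num.truncn (P n)^-1)%:R * P n + 2 * P n) by ring.
have -> : 60 * e n = 20 * e n * 3 by ring.
by apply: ler_wpM2l; [rewrite mulr_ge0// ltW|lra].
Qed.

Let cover : `[c, c + 1]%classic `<=` core_set `|` \bigcup_n bads n.
Proof.
move=> x xc; have [h|/existsNP[n hn]] := pselect (forall n, core n (x - c) = 1).
  by left.
right; exists n => //.
have g0 := gap_gt0 R n; have g1 := gap_le R n; have p0 := P0 n.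
move: xc; rewrite /= in_itv/= => /andP[x0 x1].
have xP : 0 <= (x - c) / P n by rewrite divr_ge0 ?subr_ge0// ltW.
have /truncn_itv/andP[k1 k2] := xP.
set k := Num.truncn ((x - c) / P n) in k1 k2.
set y := (x - c) / P n - k%:R.
have xE : x - c = (k%:R + y) * P n by rewrite /y [k%:R + _]addrC subrK divfK// gt_eqF.
have y01 : 0 <= y <= 1.
  have k3 : (x - c) / P n <= k%:R + 1 by rewrite natr1; exact: ltW.
  by rewrite /y subr_ge0 k1/=; lra.
have kN : (k <= Num.truncn (P n)^-1)%N.
  apply: le_truncn; rewrite ler_pdivrMr// mulVf ?gt_eqF//; lra.
have coreE : core n (x - c) = bump (9 * e n) (10 * e n) (1 - 10 * e n) (1 - 9 * e n) y.
  by rewrite xE /core -[k%:R]/((k : int)%:~R) pbump_cell//; lra.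
have in_bads m : (m < (Num.truncn (P n)^-1).+2)%N -> bad n m x -> bads n x.
  by move=> mN bx; rewrite /bads -bigcup_mkord; exists m.
have hi z : z * P n <= (10 * e n) * P n -> z <= 10 * e n by rewrite ler_pM2r.
have [ylo|ylo] := ltP y (10 * e n).
  apply: (in_bads k); first by rewrite ltnS (leq_trans kN).
  have l1 : y * P n <= 10 * e n * P n by rewrite ler_pM2r// ltW.
  have l2 : 0 <= y * P n by rewrite mulr_ge0 ?(ltW p0)//; case/andP: y01.
  have l3 : 0 <= e n * P n by rewrite mulr_ge0 ?(ltW p0) ?(ltW g0).
  by rewrite /bad /= in_itv/=; apply/andP; split; lra.
have [yhi|yhi] := ltP (1 - 10 * e n) y.
  apply: (in_bads k.+1); first by rewrite !ltnS.
  have l1 : (1 - 10 * e n) * P n <= y * P n by rewrite ler_pM2r// ltW.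
  have l2 : y * P n <= 1 * P n by rewrite ler_pM2r//; case/andP: y01.
  have l3 : 0 <= e n * P n by rewrite mulr_ge0 ?(ltW p0) ?(ltW g0).
  by rewrite /bad /= in_itv/= -natr1; apply/andP; split; lra.
by exfalso; apply: hn; rewrite coreE bump_eq1 ?ylo//; lra.
Qed.

Lemma core_set_measure : ((1 / 2)%:E <= mu core_set)%E.
Proof.
have mb : measurable (\bigcup_n bads n) by exact: bigcupT_measurable.
have one : mu `[c, c + 1]%classic = 1%E.
  rewrite lebesgue_measure_itv/= lte_fin ltrDl ltr01.
  by rewrite -EFinB; congr (_%:E); ring.
(* The series sums to 60/128, which leaves 68/128 of the unit interval. *)
have bb : (mu (\bigcup_n bads n) <= (60 / 2 ^+ 7)%:E)%E.
  apply: le_trans (generalized_Boole_inequality mu measurable_bads mb) _.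
  rewrite -(cvg_lim _ (@cvg_geometric_eseries_half R 60 7))//.
  by apply: lee_nneseries => [n _ _|n _]; [exact: measure_ge0|exact: bads_le].
have h : (1 <= mu core_set + mu (\bigcup_n bads n))%E.
  rewrite -one; apply: (le_trans _ (measureU2 mu measurable_core_set mb)).
  apply: le_measure => //; rewrite inE; first exact: measurable_itv.
  exact: measurableU measurable_core_set mb.
have {h} : (1 <= mu core_set + (60 / 2 ^+ 7)%:E)%E.
  by apply: (le_trans h); apply: leeD.
case: (mu core_set) => [r|_|]; [|by rewrite leey|by []].
rewrite -EFinD !lee_fin !exprS expr0 => h; lra.
Qed.

End Shifted.
End CoreSets.

Section NonDifferentiabilitySet.
Variable R : realType.
Local Notation T := (period R).
Local Notation b := (width R).
Notation mu := (@lebesgue_measure R).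
Implicit Types (t x : R).

Definition core_times := core_set T 0.
Definition core_points := core_set b 0.
Definition core_plane : set (R * R) :=
  (fun q : R * R => (q.1, q.2 + flux q.1)) @` (core_times `*` core_points).

Lemma width_le1 n : b n <= 1.
Proof.
apply: le_trans (width_le_power R n) _.
by have /andP[] := pow_period_le1 R n n.
Qed.

Lemma core_planeP t x :
  core_plane (t, x) <-> core_times t /\ core_points (x - flux t).
Proof.
split=> [[[s y] [/= hs hy] [<- <-]]|[ht hx]].
  by rewrite addrK.
by exists (t, x - flux t) => //=; rewrite subrK.
Qed.

Lemma compact_core_plane : compact core_plane.
Proof.
apply: continuous_compact; last first.
  apply: compact_setX; apply: compact_core_set.
    exact: period_gt0.
  exact: width_gt0.
apply: continuous_subspaceT => p.
apply: (@cvg_pair _ _ _ _ (nbhs p.1) (nbhs (p.2 + flux p.1))).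
  exact: continuous_fst_plane.
have cs := @continuous_snd_plane R; have cf := @continuous_fst_plane R.
exact: (continuous_addf cs (continuous_compf cf (@continuous_flux R))).
Qed.

Lemma measurable_core_plane : measurable core_plane.
Proof.
have mt := measurable_core_set 0 (@period_gt0 R).
have mx := measurable_core_set 0 (@width_gt0 R).
have c : continuous (fun p : R * R => p.2 - flux p.1).
  exact: (continuous_subf (@continuous_snd_plane R)
    (continuous_compf (@continuous_fst_plane R) (@continuous_flux R))).
have -> : core_plane = (fst @^-1` core_times) `&`
    ((fun p : R * R => p.2 - flux p.1) @^-1` core_points).
  by apply/seteqP; split=> [[t x] /core_planeP|[t x] h] //; apply/core_planeP.
apply: measurableI.
  have := @measurable_fst _ _ R R measurableT _ mt; rewrite setTI; exact.
have := continuous_measurable_plane c measurableT mx; rewrite setTI; exact.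
Qed.

Lemma core_plane_measure : (0 < @leb2 R core_plane)%E.
Proof.
have mK := measurable_core_plane.
have mt := measurable_core_set 0 (@period_gt0 R).
have sec t : core_times t -> ((1 / 2)%:E <= mu (xsection core_plane t))%E.
  move=> ht; have -> : xsection core_plane t = core_set b (flux t).
    apply/seteqP; split=> x; rewrite /xsection/= inE.
      move=> /core_planeP[_ [/= + H]]; rewrite in_itv/= add0r => /andP[h1 h2].
      split; first by rewrite /= in_itv/=; apply/andP; split; lra.
      by move=> n; have := H n; rewrite subr0.
    move=> [/= + H]; rewrite in_itv/= => /andP[h1 h2]; apply/core_planeP; split=> //.
    split; first by rewrite /= in_itv/= add0r; apply/andP; split; lra.
    by move=> n; rewrite subr0.
  exact: (core_set_measure (flux t) (@width_gt0 R) width_le1).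
(* The product measure integrates the measures of the vertical sections, each at least 1/2 over
   [core_times]. *)
apply: (@lt_le_trans _ _ ((1 / 2)%:E * mu core_times)%E).
  apply: mule_gt0; first by rewrite lte_fin.
  apply: lt_le_trans (core_set_measure 0 (@period_gt0 R) (@period_le1 R)).
  by rewrite lte_fin.
rewrite -(integral_cst mu mt) /leb2 /product_measure1/=.
rewrite integral_mkcond.
apply: ge0_le_integral => //.
- by move=> t _; rewrite patchE; case: ifP => // _; rewrite lee_fin.
- apply/(measurable_restrictT _ mt); exact: measurable_cst.
- exact: measurable_fun_xsection.
- move=> t _; rewrite patchE; case: ifPn => [|_]; last exact: measure_ge0.
  by rewrite inE => /sec.
Qed.

End NonDifferentiabilitySet.

(** * Non-differentiability and failure of Hoelder continuity *)

Section Conclusion.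
Variable R : realType.
Local Notation T := (period R).
Local Notation b := (width R).
Implicit Types (t x s y : R).

Local Notation w := (total_sum (term (@wave_t R) (@wave_x R))).

Lemma derivable_growth (g : R -> R) t : derivable g t 1 ->
  exists L : R, forall d, 0 < d -> exists2 r, 0 < r &
    forall s, `|s - t| < r -> `|g s - g t - L * (s - t)| <= d * `|s - t|.
Proof.
move=> /cvg_ex[L H]; exists L => d d0.
have /cvgrPdist_le/(_ _ d0) := H.
rewrite near_withinE => /nbhs_ballP[r /= r0 Hr].
exists r => // s sr; have [->|st] := eqVneq s t.
  by rewrite !subrr mulr0 subrr normr0 mulr0.
have st0 : s - t != 0 by rewrite subr_eq0.
have := Hr (s - t); rewrite /ball/= sub0r normrN => /(_ sr st0).
rewrite /GRing.scale/= mulr1 subrK => h.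
have -> : g s - g t - L * (s - t) = - (L - (s - t)^-1 * (g s - g t)) * (s - t).
  by field.
by rewrite normrM normrN; apply: ler_wpM2r.
Qed.

Lemma close_after (t s h r : R) : t < s -> s <= t + h -> h < r -> `|s - t| < r.
Proof. by move=> ts sh hr; rewrite ger0_norm; lra. Qed.

(* Two difference quotients at [t], one equal to [1] and one at least
   [1 + 1/16], cannot both be within [1/64] of the derivative. *)
Lemma incompatible_slopes (g : R -> R) (t s1 s2 L h : R) : 0 < h ->
  t < s1 -> t < s2 -> s2 <= t + 2 * h ->
  g t = t -> g s1 = s1 -> g s2 = s2 + h / 8 ->
  `|g s1 - g t - L * (s1 - t)| <= 1 / 64 * `|s1 - t| ->
  `|g s2 - g t - L * (s2 - t)| <= 1 / 64 * `|s2 - t| -> False.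
Proof.
move=> h0 a1 b1 b2 -> -> ->.
rewrite (@ger0_norm _ (s1 - t)) ?(@ger0_norm _ (s2 - t)); [|lra..].
rewrite !ler_norml => /andP[q1 _] /andP[_ q2].
have L1 : (s1 - t) * (L - 1) <= (s1 - t) * (1 / 64) by lra.
have {}L1 : L - 1 <= 1 / 64 by move: L1; rewrite ler_pM2l//; lra.
have L2 : (s2 - t) * (L - 1) <= (s2 - t) * (1 / 64).
  by apply: ler_wpM2l => //; lra.
lra.
Qed.

Lemma period_small (d : R) : 0 < d -> exists N, forall n, (N <= n)%N -> T n < d.
Proof.
move=> /half_power_small[N HN]; exists N => n Nn.
apply: le_lt_trans HN; apply: le_trans (period_le R n) _.
rewrite ler_wiXn2l ?invr_ge0// ?invf_le1// ?ler1n//.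
by rewrite (leq_trans Nn)// -addnn leq_addr.
Qed.

Lemma core_timesP t : core_times t -> forall m, core_t m t = 1.
Proof. by move=> [_ H] m; have := H m; rewrite subr0. Qed.

Lemma core_pointsP x : core_points x -> forall m, core_x m x = 1.
Proof. by move=> [_ H] m; have := H m; rewrite subr0. Qed.

Lemma solution_not_derivable t x : core_plane (t, x) ->
  forall (I : set R) (gamma : R -> R),
    characteristic (@flux R) (@solution R) I gamma -> nbhs t I -> gamma t = x ->
    ~ derivable (fun s => solution (s, gamma s)) t 1.
Proof.
move=> /core_planeP[/core_timesP ct /core_pointsP cx] I gamma [_ _ dgamma] nI gt dphi.
pose z s := gamma s - flux s.
have zt : z t = x - flux t by rewrite /z gt.
have solE s : solution (s, gamma s) = s + w (s, z s) by [].
have phit : solution (t, gamma t) = t by rewrite solE zt wave_at_core// addr0.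
have /nbhs_ballP[d /= d0 dI] := nI.
have e64 : (0 : R) < 1 / 64 by lra.
have [L /(_ _ e64)[r r0 Hr]] := derivable_growth dphi.
(* The level is chosen so fine that [[t, t + 2 * T n]] stays inside [I] and within the radius where
   the difference quotient is 1/64-close to [L]. *)
have dr : 0 < Num.min d r / 4 by rewrite divr_gt0// lt_min d0.
have [n /(_ n (leqnn n)) Tn] := period_small dr.
have T0 := period_gt0 R n.
have [Td Tr] : 2 * T n < d /\ 2 * T n < r.
  by move: Tn; rewrite ltr_pdivlMr// lt_min => /andP[? ?]; split; lra.
have dz s : t <= s <= t + 2 * T n ->
    is_derive s 1 z (speed (s + w (s, z s)) - speed s).
  move=> /andP[s1 s2].
  have nIs : nbhs s I.
    (* All times up to [t + 2 * T n] are interior to [I] with this margin, so the relative quotients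
       are true derivatives. *)
    apply/nbhs_ballP; exists (d - 2 * T n); first by rewrite /= subr_gt0.
    move=> y; rewrite /ball/= => sy; apply: dI; rewrite /ball/=.
    move: sy; rewrite !ltr_norml => /andP[? ?]; apply/andP; split; lra.
  have := dgamma s (nbhs_singleton nIs); rewrite flux_derivative solE => q.
  exact: is_derive_subf (quotient_is_derive nIs q) (is_derive_flux s).
have [j [yt [hyt tE]]] := pcoreP T0 (ct n).
have [i [yx [hyx xE]]] := pcoreP (width_gt0 R n) (cx n).
have [s1 [s2 [/andP[a1 a2] /andP[b1 b2] w1 w2]]] : exists s1 s2,
    [/\ t < s1 <= t + 2 * T n, t < s2 <= t + 2 * T n, w (s1, z s1) = 0 &
    w (s2, z s2) = T n / 8].
  have [q1 q2 q3 q4] := displacement ct cx zt dz hyt hyx tE xE.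
  by eexists; eexists; split; [exact: q1|exact: q2|exact: q3|exact: q4].
have n1 := close_after a1 a2 Tr; have n2 := close_after b1 b2 Tr.
have phis1 : solution (s1, gamma s1) = s1 by rewrite solE w1 addr0.
exact: (@incompatible_slopes (fun s => solution (s, gamma s)) t s1 s2 L (T n)
  T0 a1 b1 b2 phit phis1
  (etrans (solE s2) (congr1 _ w2)) (Hr _ n1) (Hr _ n2)).
Qed.

Lemma core_plane_nonempty : exists t x, core_times t /\ core_points x.
Proof.
have [p hp] : exists p, @core_plane R p.
  apply: contrapT => h; have := core_plane_measure R.
  have -> : @core_plane R = set0 by apply/seteqP; split=> // p hp; case: h; exists p.
  by rewrite /leb2 measure0 ltxx.
by move: p hp => [t x] /core_planeP[ht hx]; exists t, (x - flux t).
Qed.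

Lemma solution_not_holder (alpha : R) : 0 < alpha ->
  ~ holder_continuous alpha (@solution R).
Proof.
move=> alpha0 H.
have [t0 [x0 [ht0 hx0]]] := core_plane_nonempty.
have ct := core_timesP ht0; have cx := core_pointsP hx0.
pose unshear (q : R * R) : R * R := (q.1, q.2 + flux q.1).
have cun : continuous unshear.
  move=> q; apply: (@cvg_pair _ _ _ _ (nbhs q.1) (nbhs (q.2 + flux q.1))).
    exact: continuous_fst_plane.
  have cs := @continuous_snd_plane R; have cf := @continuous_fst_plane R.
  exact: (continuous_addf cs (continuous_compf cf (@continuous_flux R))).
(* One compact set containing the steep pairs of every level, so that the constant [C] is fixed
   before [n]. *)
pose A := unshear @` (`[t0, t0 + 2]%classic `*` `[x0 - 1, x0 + 1]%classic).
have cA : compact A.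
  apply: continuous_compact; first exact: continuous_subspaceT.
  by apply: compact_setX; exact: segment_compact.
have [C HC] := H A cA.
have C1 : 0 < 1 / (8 * (`|C| + 1)) by rewrite divr_gt0// mulr_gt0// ltr_wpDl.
have [N1 HN1] := period_small C1.
(* With [n * alpha >= 2] the Hoelder bound is at most [|C| * T n ^+ 2], which falls below the actual
   increment [T n / 8] once [T n] is small against [1 / (8 * (|C| + 1))]. *)
pose N2 := (Num.truncn (2 / alpha)).+1.
pose n := maxn N1 N2.
have Tn := HN1 n (leq_maxl _ _).
have T0 := period_gt0 R n; have T1 := period_le1 R n.
have na : 2 <= n%:R * alpha.
  rewrite -ler_pdivrMr//; apply: (@le_trans _ _ N2%:R).
    by apply: ltW; rewrite /N2; apply: truncnS_gt.
  by rewrite ler_nat leq_maxr.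
have [j [yt [hyt tE]]] := pcoreP T0 (ct n).
have [i [yx [hyx xE]]] := pcoreP (width_gt0 R n) (cx n).
have [t [x1 [x2 [/andP[t1 t2] [h1 h2] h12 w1 w2]]]] :=
  steep_pair ct cx hyt hyx tE xE.
have inA x : `|x - x0| <= b n -> A (t, x + flux t).
  move=> hx; exists (t, x) => //=; split; rewrite /= in_itv/=; first by lra.
  by have := width_le1 R n; move: hx; rewrite ler_norml => /andP[? ?]; lra.
have := HC _ _ (inA _ h1) (inA _ h2).
have solE x : solution (t, x + flux t) = t + w (t, x).
  by rewrite /solution /sheared_sum /shear /= addrK.
rewrite !solE w1 w2 addr0 [t + _]addrC addrK ger0_norm ?divr_ge0 ?(ltW T0)//.
have dist : `|(t, x1 + flux t) - (t, x2 + flux t)| <= b n.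
  rewrite prod_normE /= subrr normr0 ge_max (ltW (width_gt0 R n)) /=.
  by rewrite opprD addrACA subrr addr0.
apply/negP; rewrite -ltNge.
set D := `|_ - _| in dist *.
have D0 : 0 <= D by exact: normr_ge0.
have step1 : D `^ alpha <= T n ^+ 2.
  apply: (@le_trans _ _ ((T n ^+ n) `^ alpha)).
    apply: ge0_ler_powR; rewrite ?nnegrE ?(ltW alpha0)//.
      by rewrite exprn_ge0 ?(ltW T0).
    exact: le_trans dist (width_le_power R n).
  rewrite -powR_mulrn ?(ltW T0)// -powRrM -powR_mulrn ?(ltW T0)//.
  by apply: ger_powR; rewrite ?T0.
apply: (@le_lt_trans _ _ (`|C| * T n ^+ 2)).
  apply: (@le_trans _ _ (`|C| * D `^ alpha)).
    by apply: ler_wpM2r; [exact: powR_ge0|exact: ler_norm].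
  by apply: ler_wpM2l.
have c1 : 0 < `|C| + 1 by rewrite ltr_wpDl.
move: Tn; rewrite ltr_pdivlMr ?mulr_gt0// => Tn.
have c0 := normr_ge0 C.
rewrite expr2 mulrA ltr_pdivlMr//.
have : T n * (`|C| * T n * 8) < T n * 1.
  rewrite ltr_pM2l//; move: Tn; rewrite mulrCA; nra.
lra.
Qed.

End Conclusion.

Theorem mainTheorem3 (R : realType) :
  exists (f : R -> R) (u g : R * R -> R) (K : set (R * R)),
    [/\ strictly_convex f /\ classC2 f,
        continuous u,
        measurable_fun [set: R * R] g /\ (exists M : R, forall p, `|g p| <= M) &
        balance_law f u g] /\
    [/\ compact K /\ (0 < @leb2 R K)%E,
        lipschitz_along_characteristics f u,
        (forall (t x : R), K (t, x) ->
          forall (I : set R) (gamma : R -> R),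
            characteristic f u I gamma -> nbhs t I -> gamma t = x ->
            ~ derivable (fun s => u (s, gamma s)) t 1) &
        (forall alpha : R, 0 < alpha -> ~ holder_continuous alpha u)].
Proof.
exists (@flux R), (@solution R), (@source R), (@core_plane R); split; split.
- by split; [exact: strictly_convex_flux|exact: classC2_flux].
- exact: continuous_solution.
- by split; [exact: source_measurable|exists (1 + 16 + 16); exact: source_bounded].
- exact: balance_law_solution.
- by split; [exact: compact_core_plane|exact: core_plane_measure].
- exact: solution_lipschitz.
- exact: solution_not_derivable.
- exact: solution_not_holder.
Qed.
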